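(* MB Dom Game, after the first move of Dominator, has a linear kernel parameterized by the feedback edge number of the graph. That is, there are constants $a,b$ and a polynomial-time algorithm which, given a graph $G$ and a vertex $v\in V(G)$, outputs a position $(G',D',S')$ of the Maker-Breaker domination game with $|V(G')|\le a\cdot fen(G)+b$ such that, with Staller being the next player to move in both positions, Dominator has a winning strategy in the position $(G,\{v\},\emptyset)$ if and only if she has one in the position $(G',D',S')$.
   Context: All graphs are finite, simple and undirected. The Maker-Breaker domination game on a graph $G$ is played by Dominator and Staller, who alternately claim one unclaimed vertex of $G$. Dominator wins if the vertices she claims contain a dominating set of $G$; otherwise Staller wins. For disjoint $D,S\subseteq V(G)$, the position $(G,D,S)$ is the state of the game on $G$ in which Dominator has claimed exactly the vertices of $D$ and Staller exactly those of $S$; play continues by alternately claiming the remaining vertices. A set $F$ of edges of $G$ is a feedback edge set if $G\setminus F$ is a forest; the feedback edge number $fen(G)$ is the minimum size of a feedback edge set. *)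

(* Defs.v *)
From mathcomp Require Import all_boot.

Set Implicit Arguments.
Unset Strict Implicit.
Unset Printing Implicit Defensive.

(* An algorithm receives a graph through an encoding, so the vertex set is
   {0, ..., n-1}; every finite graph is isomorphic to one of this form. *)
Record sgraph (n : nat) := SGraph {
  adj :> rel 'I_n;
  adj_sym : symmetric adj;
  adj_irr : irreflexive adj }.

Section Graph.
Variables (n : nat) (G : sgraph n).

Definition edges : {set {set 'I_n}} :=
  [set [set p.1; p.2] | p : 'I_n * 'I_n & G p.1 p.2].

(* A cycle of a simple graph is a duplicate-free cyclic sequence of at least
   three vertices: [:: x; y] is a [ucycle] for every edge xy.  Such a sequence
   has at most n entries, so bounding the length loses nothing. *)
Definition forest (e : rel 'I_n) : bool :=
  [forall k : 'I_n.+1, forall c : k.-tuple 'I_n, (2 < k) ==> ~~ ucycleb e c].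

Definition remove_edges (F : {set {set 'I_n}}) : rel 'I_n :=
  [rel x y | G x y && ([set x; y] \notin F)].

Definition feedback_edge_set (F : {set {set 'I_n}}) : bool :=
  (F \subset edges) && forest (remove_edges F).

Definition fen : nat :=
  #|[arg min_(F < edges | feedback_edge_set F) #|F| ]|.

Lemma forestP (e : rel 'I_n) :
  reflect (forall c : seq 'I_n, ucycle e c -> size c <= 2) (forest e).
Proof.
apply: (iffP forallP) => [H c uc | H k].
  rewrite leqNgt; apply/negP => c2.
  have cn : size c < n.+1.
    by rewrite ltnS -[leqRHS]card_ord -(card_uniqP (ucycle_uniq uc)) max_card.
  have /forallP/(_ (in_tuple c)) := H (Ordinal cn).
  by rewrite /= c2 /= => /negP; apply.
apply/forallP => c; apply/implyP => k2; apply/negP => uc.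
by have := H c uc; rewrite size_tuple leqNgt k2.
Qed.

(* In particular the minimum in [fen] ranges over a nonempty family. *)
Lemma feedback_edge_set_edges : feedback_edge_set edges.
Proof.
rewrite /feedback_edge_set subxx /=; apply/forestP => -[|x [|y c]] //=.
case: c => [|z c] //; rewrite /ucycle /ucycleb /= => /andP[/andP[/andP[Gxy]]].
by move=> /negP nxy; case: nxy; apply/imsetP; exists (x, y); rewrite ?inE.
Qed.

Lemma fen_min (F : {set {set 'I_n}}) : feedback_edge_set F -> fen <= #|F|.
Proof.
move=> hF; rewrite /fen.
by case: arg_minnP => [|F0 _ ->]; rewrite ?feedback_edge_set_edges.
Qed.

Lemma fen_attained : exists2 F, feedback_edge_set F & #|F| = fen.
Proof.
rewrite /fen; case: arg_minnP => [|F0 hF _]; first exact: feedback_edge_set_edges.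
by exists F0.
Qed.

Definition dominating (X : {set 'I_n}) : bool :=
  [forall x, (x \in X) || [exists y in X, G x y]].

Section Position.
Variables D S : {set 'I_n}.

Definition unclaimed : {set 'I_n} := ~: (D :|: S).

(* A history lists the moves made from the position (G, D, S) onwards.
   Staller is the next to move in that position, so the moves with an even
   index are Staller's and those with an odd index are Dominator's. *)
Definition history (h : seq 'I_n) : bool :=
  uniq h && all [in unclaimed] h.

Definition complete_play (h : seq 'I_n) : bool :=
  history h && (size h == #|unclaimed|).

Definition dominator_moves (h : seq 'I_n) : {set 'I_n} :=
  [set x in h | odd (index x h)].

(* [None] is an escape value, needed because 'I_n may be empty; a legal
   strategy never returns it when a move is due. *)
Definition strategy := seq 'I_n -> option 'I_n.

Definition legal_strategy (sigma : strategy) : Prop :=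
  forall h, history h -> odd (size h) -> size h < #|unclaimed| ->
  exists2 x, sigma h = Some x & history (rcons h x).

Definition follows (sigma : strategy) (h : seq 'I_n) : Prop :=
  forall h1 x h2, h = h1 ++ x :: h2 -> odd (size h1) -> sigma h1 = Some x.

Definition winning_strategy (sigma : strategy) : Prop :=
  legal_strategy sigma /\
  forall h, complete_play h -> follows sigma h ->
  exists2 X : {set 'I_n}, X \subset D :|: dominator_moves h & dominating X.

Definition dominator_wins : Prop := exists sigma, winning_strategy sigma.

End Position.
End Graph.

(* Programs are written in a first-order call-by-value functional language on
   binary trees, essentially the language F of N. D. Jones, "Computability
   and Complexity from a Programming Perspective" (1997).  Each evaluation
   step costs one unit and is a constant-time operation on immutable heap
   cells (pointer copy, allocation of one cell, test and projection of one
   cell, function call), so that running times agree with those of Turing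
   machines up to a polynomial.  There is no arithmetic and no equality test
   at unit cost. *)

Inductive data := Leaf | Node of data & data.

Fixpoint data_size (x : data) : nat :=
  if x is Node y z then (data_size y + data_size z).+1 else 1.

(* Variables are de Bruijn indices.  [ECase e e1 e2] evaluates [e1] if [e] is
   [Leaf]; if [e] is [Node x y] it evaluates [e2] with [x] as variable 0 and [y]
   as variable 1.  Each function has a single argument, its variable 0. *)
Inductive expr :=
  | EVar of nat
  | ELeaf
  | ENode of expr & expr
  | ECase of expr & expr & expr
  | ELet of expr & expr
  | ECall of nat & expr.

(* The f-th entry is the body of function f; function 0 is the entry point. *)
Definition program := seq expr.

(* [eval P env e x t]: in the environment [env], [e] evaluates to [x] in
   exactly [t] steps. *)
Inductive eval (P : program) : seq data -> expr -> data -> nat -> Prop :=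
  | eval_var env i : eval P env (EVar i) (nth Leaf env i) 1
  | eval_leaf env : eval P env ELeaf Leaf 1
  | eval_node env e1 e2 x1 x2 t1 t2 :
      eval P env e1 x1 t1 -> eval P env e2 x2 t2 ->
      eval P env (ENode e1 e2) (Node x1 x2) (t1 + t2).+1
  | eval_case_leaf env e e1 e2 x t t1 :
      eval P env e Leaf t -> eval P env e1 x t1 ->
      eval P env (ECase e e1 e2) x (t + t1).+1
  | eval_case_node env e e1 e2 y z x t t2 :
      eval P env e (Node y z) t -> eval P [:: y, z & env] e2 x t2 ->
      eval P env (ECase e e1 e2) x (t + t2).+1
  | eval_let env e1 e2 x1 x2 t1 t2 :
      eval P env e1 x1 t1 -> eval P (x1 :: env) e2 x2 t2 ->
      eval P env (ELet e1 e2) x2 (t1 + t2).+1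
  | eval_call env f e x y t1 t2 :
      eval P env e x t1 -> eval P [:: x] (nth ELeaf P f) y t2 ->
      eval P env (ECall f e) y (t1 + t2).+1.

Definition runs (P : program) (input output : data) (t : nat) : Prop :=
  eval P [:: input] (nth ELeaf P 0) output t.

Lemma eval_det P env e x t :
  eval P env e x t -> forall x' t', eval P env e x' t' -> x = x' /\ t = t'.
Proof.
move=> H; elim: H => {env e x t} [] *;
  repeat match goal with
  | _ : forall x' t', eval ?P ?env ?e x' t' -> ?x = x' /\ ?t = t',
    H : eval ?P ?env ?e ?x ?t |- _ => clear H
  end;
  match goal with
  | H : eval _ _ _ ?x' ?t' |- _ = ?x' /\ _ = ?t' => inversion H; subst
  end;
  repeat match goal with
  | IH : forall x' t', eval ?P ?env ?e x' t' -> _, H : eval ?P ?env ?e _ _ |- _ =>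
    case: (IH _ _ H) => ? ?; clear IH; subst
  | E : Node _ _ = Node _ _ |- _ => case: E => ? ?; subst
  end; by [].
Qed.

Definition enc_bool (b : bool) : data := if b then Node Leaf Leaf else Leaf.

Definition enc_seq (s : seq data) : data := foldr Node Leaf s.

(* Unary numerals are harmless here: they only encode vertices, and the
   adjacency matrix of an n-vertex graph already has size at least n. *)
Definition enc_nat (k : nat) : data := enc_seq (nseq k Leaf).

Definition enc_graph n (G : sgraph n) : data :=
  enc_seq [seq enc_seq [seq enc_bool (G i j) | j <- enum 'I_n] | i <- enum 'I_n].

Definition enc_set n (X : {set 'I_n}) : data :=
  enc_seq [seq enc_bool (i \in X) | i <- enum 'I_n].

Definition enc_instance n (G : sgraph n) (v : 'I_n) : data :=
  Node (enc_graph G) (enc_nat v).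

Definition enc_position n (G : sgraph n) (D S : {set 'I_n}) : data :=
  Node (enc_graph G) (Node (enc_set D) (enc_set S)).

(* Main.v *)
(* Keep the position where Dominator owns v.  The closed neighbourhoods of
   the vertices not yet dominated form a hypergraph, in which Staller tries to
   fill an edge.  Two rules preserve the winner.
   - If the only neighbour of u is w (and u, w <> v), a move of Staller on w or u
     is answered on the other vertex, so u and w can be deleted; this is encoded
     by making them adjacent to v only.
   - A path with ten inner vertices of degree two can be shortened to eight inner
     vertices: when Dominator answers on the path, or when one of its ends is
     decided, the rest splits into pendant paths, whose value only depends on
     whether they have 0, 1 or more vertices, and on the parity of their length if
     their last vertex still has to be dominated.
   In a reduced graph all relevant vertices but v have degree at least two;
   deleting a minimum feedback edge set leaves a forest, where the number of
   vertices of degree at least three is bounded by the number of leaves, and the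
   vertices of degree two form paths of bounded length. *)

Require Import Defs.
From mathcomp Require Import all_boot.
From mathcomp Require Import zify.

Set Implicit Arguments.
Unset Strict Implicit.
Unset Printing Implicit Defensive.

(** * The hypergraph game *)

(** The path rule is proved by simulation: Dominator plays on one path by consulting a won game on
    the other. The induction on rounds closes only if the surroundings of the path are arbitrary,
    because moves made elsewhere change them; hence a path is glued to any hypergraph [H], and only
    the edges [A], [B] through its ends are singled out. The two games do not run in step: comparing
    pendant pieces lets Staller insert forcing moves, so the transfer lemmas lose rounds. This is
    harmless, since the reduction rules compare positions that are won for every number of rounds.
    Parity must survive, so a path is shortened by two vertices. The length eight comes from
    Staller's moves on the path: each is compared with a move of the same parity inside the other
    path, at a place where Dominator must answer on an adjacent vertex and where either answer
    leaves at least two vertices beyond it. Positions 4 and 5 both qualify, seen from either end,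
    once there are eight vertices. *)

Section Game.
Variable T : finType.
Implicit Types (e : {set T}) (x y : T) (n : nat).

(* The edges of a hypergraph.  Staller claims vertices in order to fill an edge. *)
Definition hyp := {set T} -> Prop.

Implicit Types E H A B : hyp.

(** The order along which [dwin] is monotone: dropping or enlarging edges only helps Dominator. *)
Definition cov E' E := forall e, E' e -> exists2 e0, E e0 & e0 \subset e.

(* The edges left after Staller takes [x] and Dominator [y]; [y = x] is a wasted
   move of Dominator. *)
Definition res x y E : hyp :=
  fun e => exists2 e0, E e0 & y \notin e0 :\ x /\ e = e0 :\ x.

(* Staller has filled no edge within [n] rounds.  Vertices may be claimed again,
   which helps nobody, so that moves need no side condition. *)
Fixpoint dwin n E : Prop :=
  ~ E set0 /\ if n is n'.+1 then forall x, exists y, dwin n' (res x y E) else True.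

Definition hU E1 E2 : hyp := fun e => E1 e \/ E2 e.

Lemma dwin_n0 n E : dwin n E -> ~ E set0.
Proof. by case: n => [|n] []. Qed.

Lemma dwin_step n E : dwin n.+1 E -> forall x, exists y, dwin n (res x y E).
Proof. by case. Qed.

Lemma dwin_cov n E E' : cov E' E -> dwin n E -> dwin n E'.
Proof.
elim: n E E' => [|n IH] E E' c /= [h0 hs].
  by split=> // /c[e0 he]; rewrite subset0 => /eqP e00; subst.
split=> [/c[e0 he]|x]; first by rewrite subset0 => /eqP e00; subst.
have [y hy] := hs x; exists y; apply: IH hy => e [e1 /c[e0 he0 s01] [ny ->]].
exists (e0 :\ x); last exact: setSD.
by exists e0 => //; split=> //; apply: contra ny; apply/subsetP/setSD.
Qed.

Lemma dwin_sub n E E' : (forall e, E' e -> E e) -> dwin n E -> dwin n E'.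
Proof. by move=> h; apply: dwin_cov => e /h; exists e. Qed.

Lemma dwin_pred n E : dwin n.+1 E -> dwin n E.
Proof.
elim: n E => [|n IH] E [h0 hs]; first by split.
by split=> // x; have [y /IH hy] := hs x; exists y.
Qed.

Lemma dwin_leq m n E : m <= n -> dwin n E -> dwin m E.
Proof.
elim: n => [|n IH]; first by rewrite leqn0 => /eqP->.
by rewrite leq_eqVlt => /predU1P[->//|]; rewrite ltnS => /IH h /dwin_pred.
Qed.

(** Any other reply leaves the edge consisting of [z] alone, which Staller fills in the next round;
    the hypothesis has that second round. *)
Lemma dwin_forced n x z E e :
  dwin n.+2 E -> E e -> e :\ x = [set z] -> dwin n.+1 (res x z E).
Proof.
move=> [_ /(_ x)[y hy]] he ez; case: (eqVneq y z) => [<-//|nyz].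
have h1 : res x y E [set z] by exists e; rewrite // ez inE.
have [_ /(_ z)[w /dwin_n0 []]] := hy.
by exists [set z]; rewrite // setDv inE.
Qed.

Lemma dwin_not1 n E z : dwin n.+1 E -> ~ E [set z].
Proof.
move=> [_ /(_ z)[w /dwin_n0 nh]] hz; apply: nh.
by exists [set z]; rewrite // setDv inE.
Qed.

(* After Staller's move [x] the pairs {a,b}, {b,c}, {c,d} are threats; unless
   Dominator takes b or c, Staller answers with a double threat. *)
Lemma dwin_forced4 n x E (a b c d : T) (ea eb ec : {set T}) :
    dwin n.+3 E -> E ea -> E eb -> E ec ->
    ea :\ x = [set a; b] -> eb :\ x = [set b; c] -> ec :\ x = [set c; d] ->
    uniq [:: a; b; c; d] ->
  dwin n.+2 (res x b E) \/ dwin n.+2 (res x c E).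
Proof.
move=> [_ /(_ x)[y hy]] ha hb hc eab ebc ecd.
rewrite /= !inE !negb_or => /and4P[/and3P[ab ac ad] /andP[bc bd] cd _].
case: (eqVneq y b) hy => [<- | yb]; first by left.
case: (eqVneq y c) => [<- | yc] hy; first by right.
have h2 : res x y E [set b; c] by exists eb; rewrite // ebc !inE (negPf yb) (negPf yc).
have sD1 u w : u != w -> [set u; w] :\ u = [set w].
  move=> uw; apply/setP=> z; rewrite !inE.
  by case: (eqVneq z u) => // ->; rewrite (negPf uw).
case: (eqVneq y a) => [eya | ya]; last first.
  have h1 : res x y E [set a; b] by exists ea; rewrite // eab !inE (negPf yb) (negPf ya).
  have [_ /(_ b)[z hz]] := hy; exfalso.
  have /= := @dwin_not1 _ _ c hz; have := @dwin_not1 _ _ a hz.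
  case: (eqVneq z c) => [zc | zc] h h'.
    by apply: h; exists [set a; b] => //; rewrite setUC sD1 1?eq_sym // inE zc eq_sym.
  by apply: h'; exists [set b; c] => //; rewrite sD1 // inE zc.
have h1 : res x y E [set c; d].
  by exists ec; rewrite // ecd !inE eya (negPf ac) (negPf ad).
have [_ /(_ c)[z hz]] := hy; exfalso.
have /= := @dwin_not1 _ _ b hz; have := @dwin_not1 _ _ d hz.
case: (eqVneq z b) => [zb | zb] h h'.
  by apply: h; exists [set c; d] => //; rewrite sD1 // inE zb.
by apply: h'; exists [set b; c] => //; rewrite setUC sD1 1?eq_sym // inE zb.
Qed.

(** Dominator answers in a matched pair by its other vertex, and elsewhere follows her strategy for
    [E0], whose edges avoid the matching. To fill an edge of [E], Staller needs an edge of [E0] or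
    both vertices of a pair. *)
Lemma dwin_pairing n E0 E (M : rel T) :
    dwin n E0 -> symmetric M -> irreflexive M ->
    (forall x y z, M x y -> M x z -> y = z) ->
    (forall e x y, E0 e -> M x y -> x \notin e) ->
    (forall e, E e -> (exists2 e0, E0 e0 & e0 \subset e) \/
       exists x y, [/\ M x y, x \in e & y \in e]) ->
  dwin n E.
Proof.
elim: n E0 E M => [|n IH] E0 E M.
  move=> /dwin_n0 h0 _ _ _ _ cE; split=> // /cE[[e0 he]|[x [y [_]]]]; rewrite ?inE //.
  by rewrite subset0 => /eqP e00; subst.
move=> [h0 hs] sM iM fM aM cE; split.
  move=> /cE[[e0 he]|[x [y [_]]]]; rewrite ?inE //.
  by rewrite subset0 => /eqP e00; subst.
move=> x; case: (pickP (M x)) => [y Mxy | nMx].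
  exists y; pose M' a b := [&& M a b, a \notin [set x; y] & b \notin [set x; y]].
  apply: (IH E0 _ M'); first exact: dwin_pred (conj h0 hs).
  - by move=> a b; rewrite /M' sM [X in _ && X]andbC.
  - by move=> a; rewrite /M' iM.
  - by move=> a b c /and3P[+ _ _] /and3P[+ _ _]; apply: fM.
  - by move=> e a b he /and3P[+ _ _]; apply: aM.
  move=> e [e1 /cE[[e0 he0 s0]|[a [b [Mab ae be]]]] [ny ->]].
    left; exists e0 => //; apply/subsetP=> z ze; rewrite !inE (subsetP s0) // andbT.
    by apply: contraTneq ze => ->; apply: aM he0 Mxy.
  move: ny; rewrite !inE; have -> /= : y != x by apply: contraTneq Mxy => ->; rewrite iM.
  move=> ny; have ay : a != y by apply: contraNneq ny => <-.
  have bY : b != y by apply: contraNneq ny => <-.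
  have ax : a != x by apply: contraNneq bY => E1; subst; apply/eqP/(fM _ _ _ Mab Mxy).
  have bx : b != x.
    by apply: contraNneq ay => E1; subst; apply/eqP/(@fM x) => //; rewrite sM.
  by right; exists a, b; rewrite /M' !inE !negb_or Mab ax ay bx bY ae be.
have [y hy] := hs x; exists y.
(* The reply may hit a matched vertex. Its pair is dropped, and the edges that relied on it contain
   [y], so they are gone. *)
pose M' a b := [&& M a b, a != y & b != y].
apply: (IH (res x y E0) _ M') => //.
- by move=> a b; rewrite /M' sM [X in _ && X]andbC.
- by move=> a; rewrite /M' iM.
- by move=> a b c /and3P[+ _ _] /and3P[+ _ _]; apply: fM.
- move=> e a b [e0 he0 [_ ->]] /and3P[Mab _ _]; rewrite !inE negb_and.
  by rewrite (aM _ _ _ he0 Mab) orbT.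
move=> e [e1 /cE[[e0 he0 s0]|[a [b [Mab ae be]]]] [ny ->]].
  left; exists (e0 :\ x); last exact: setSD.
  by exists e0 => //; split=> //; apply: contra ny; apply/subsetP/setSD.
have ax : a != x by apply: contraTneq Mab => ->; rewrite nMx.
have bx : b != x by apply: contraTneq Mab => ->; rewrite sM nMx.
right; exists a, b; rewrite /M' !inE ax bx ae be Mab /=; split=> //.
by apply/andP; split; apply: contraNneq ny => <-; rewrite !inE ?ax ?bx ?ae ?be.
Qed.

(** Match [p lo] with [p lo.+1], [p lo.+2] with [p lo.+3], and so on: any three consecutive vertices
    contain a pair. This disposes of every stretch of a path that is cut off from the rest. *)
Lemma dwin_chain n E0 E (p : nat -> T) lo hi :
    dwin n E0 ->
    (forall i j, lo <= i <= hi -> lo <= j <= hi -> p i = p j -> i = j) ->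
    (forall e j, E0 e -> lo <= j <= hi -> p j \notin e) ->
    (forall e, E e -> [\/ exists2 e0, E0 e0 & e0 \subset e,
       lo < hi /\ [set p lo; p lo.+1] \subset e |
       exists j, [/\ lo <= j, j.+2 <= hi & [set p j; p j.+1; p j.+2] \subset e]]) ->
  dwin n E.
Proof.
move=> h0 ip aE cE.
pose M x y := [exists i : 'I_hi, [&& lo <= i, ~~ odd (i - lo) &
  ((x == p i) && (y == p i.+1)) || ((y == p i) && (x == p i.+1))]].
have MP x y : reflect (exists i, [/\ lo <= i < hi, ~~ odd (i - lo) &
   (x = p i /\ y = p i.+1) \/ (y = p i /\ x = p i.+1)]) (M x y).
  apply: (iffP existsP) => [[i /and3P[li oi h]]|[i [li oi h]]].
    exists i; split=> //; first by rewrite li ltn_ord.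
    by case/orP: h => /andP[/eqP-> /eqP->]; [left|right].
  case/andP: li => li ih; exists (Ordinal ih); rewrite /= li oi /=.
  by case: h => [] [-> ->]; rewrite !eqxx ?orbT.
apply: (@dwin_pairing n E0 E M) => //.
- by move=> x y; apply/MP/MP => [] [i [a b c]]; exists i; split=> //; case: c => [] []; [right|left|right|left].
- move=> x; apply/negbTE/negP=> /MP[i [a b c]].
  have /ip : p i = p i.+1 by case: c => [] [<- <-].
  by move=> h; have : i = i.+1 by [apply: h; lia]; lia.
- move=> x y z /MP[i [a b c]] /MP[j [a' b' c']].
  case: c => [] [Ex Ey]; case: c' => [] [Ex' Ey'].
  + by have : i = j by [apply: ip; [lia|lia|congruence]]; move=> ?; subst.
  + by have : i = j.+1 by [apply: ip; [lia|lia|congruence]]; lia.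
  + by have : i.+1 = j by [apply: ip; [lia|lia|congruence]]; lia.
  + by have : i.+1 = j.+1 by [apply: ip; [lia|lia|congruence]]; move=> [?]; subst.
- by move=> e x y he /MP[i [a b [] [Ex Ey]]]; subst; apply: aE he _; lia.
move=> e /cE[|[lh s]|[j [lj jh s]]]; first by left.
  right; exists (p lo), (p lo.+1); split; try (apply: (subsetP s); rewrite !inE eqxx ?orbT //).
  by apply/MP; exists lo; split; [lia|lia|left].
right; case: (boolP (odd (j - lo))) => oj.
  exists (p j.+1), (p j.+2); split; try (apply: (subsetP s); rewrite !inE eqxx ?orbT //).
  by apply/MP; exists j.+1; split; [lia|lia|left].
exists (p j), (p j.+1); split; try (apply: (subsetP s); rewrite !inE eqxx ?orbT //).
by apply/MP; exists j; split; [lia|lia|left].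
Qed.

Lemma setD1_notin x e : x \notin e -> e :\ x = e.
Proof. by move=> xe; apply/setDidPl; rewrite disjoint_sym disjoints1. Qed.

Lemma setU1_D1 x z e : z != x -> (z |: e) :\ x = z |: (e :\ x).
Proof. by move=> zx; rewrite setDUl (@setD1_notin _ [set z]) // inE eq_sym. Qed.

(** * Pendant paths whose last vertex need not be dominated *)

Definition sl (al : {set T}) (p : nat -> T) j : {set T} := if j is 0 then al else [set p j].

(* The edges of a path [p 1, ..., p r] attached to the end [al], which is a singleton,
   or empty once Staller owns it; [A] contains the edges through that end, with
   [p 1] left out.  The last vertex [p r] need not be dominated. *)
Definition GB A al p r : hyp := fun e =>
  (0 < r /\ exists2 e0, A e0 & e = p 1 |: e0) \/
  exists2 j, 0 < j < r & e = sl al p j.-1 :|: [set p j; p j.+1].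

Definition inj_upto r (p : nat -> T) :=
  forall i j, 0 < i <= r -> 0 < j <= r -> p i = p j -> i = j.

Definition avoids r (p : nat -> T) E := forall e j, E e -> 0 < j <= r -> p j \notin e.

Definition gad p r H A (al : {set T}) :=
  [/\ inj_upto r p, avoids r p H, avoids r p A & forall j, 0 < j <= r -> p j \notin al].

(** In the application [A] is the closed neighbourhood of the end without [p 1], provided that the
    end is still to be dominated. It contains the end, so Dominator removes all of [A] by taking the
    end. *)
Definition cell A (al : {set T}) :=
  (al = set0 \/ exists a, al = [set a]) /\ forall e, A e -> al \subset e.

Lemma res_avoids x y r p E : avoids r p E -> avoids r p (res x y E).
Proof. by move=> h e j [e0 he [_ ->]] hj; rewrite !inE negb_and (h _ _ he hj) orbT. Qed.

Lemma gad_res x y x' y' p r H A al :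
  gad p r H A al -> gad p r (res x y H) (res x' y' A) (al :\ x).
Proof.
move=> [gi gH gA ga]; split=> //; try exact: res_avoids.
by move=> j hj; rewrite !inE negb_and ga // orbT.
Qed.

Lemma cell_res x y A al : cell A al -> cell (res x y A) (al :\ x).
Proof.
move=> [h s]; split=> [|e [e0 he [_ ->]]]; last exact/setSD/s.
case: h => [->|[a ->]]; first by left; rewrite set0D.
case: (eqVneq x a) => [->|xa]; first by left; rewrite setDv.
by right; exists a; rewrite setD1_notin // inE.
Qed.

Lemma gad_leq p r r' H A al : r' <= r -> gad p r H A al -> gad p r' H A al.
Proof.
move=> rr [gi gH gA ga]; split.
- by move=> i j hi hj; apply: gi; lia.
- by move=> e j he hj; apply: gH he _; lia.
- by move=> e j he hj; apply: gA he _; lia.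
- by move=> j hj; apply: ga; lia.
Qed.

Section Gadget.
Variables (H A : hyp) (al : {set T}) (p : nat -> T) (r : nat).
Hypothesis g : gad p r H A al.

Lemma gad_neq i j : 0 < i <= r -> 0 < j <= r -> (p i == p j) = (i == j).
Proof.
case: g => gi _ _ _ hi hj; case: (eqVneq i j) => [->|ij]; first by rewrite eqxx.
by apply/eqP => /gi h; case/eqP: ij; apply: h.
Qed.

Lemma gad_sl i j : 0 < i <= r -> j <= r -> (p i \in sl al p j) = (i == j).
Proof.
case: j => [|j] hi hj /=; last by rewrite inE gad_neq.
by case: g => _ _ _ ga; rewrite (negPf (ga _ hi)); case: i hi => [|i].
Qed.

Lemma gad_avoids_B i j e : GB A al p i e -> i < j <= r -> p j \notin e.
Proof.
case: g => gi gH gA ga [[i0 [e0 he ->]]|[k hk ->]] hj; rewrite !inE.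
  by rewrite gad_neq ?(negPf (gA _ _ he _)); lia.
rewrite gad_sl ?gad_neq; lia.
Qed.

Lemma D1_tri i j : 0 < i <= r -> 0 < j < r -> i \notin [:: j.-1; j; j.+1] ->
  (sl al p j.-1 :|: [set p j; p j.+1]) :\ p i = sl al p j.-1 :|: [set p j; p j.+1].
Proof.
move=> hi hj; rewrite !inE => ij; apply: setD1_notin; rewrite !inE gad_sl ?gad_neq; lia.
Qed.

Lemma GB_chain n lo : 1 <= lo ->
  forall E0 E, (forall e j, E0 e -> lo <= j <= r -> p j \notin e) -> dwin n E0 ->
    (forall e, E e -> [\/ exists2 e0, E0 e0 & e0 \subset e,
       lo < r /\ [set p lo; p lo.+1] \subset e |
       exists j, [/\ lo <= j, j.+2 <= r & [set p j; p j.+1; p j.+2] \subset e]]) ->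
  dwin n E.
Proof.
move=> l1 E0 E aE dE cE; case: g => gi _ _ _; apply: (dwin_chain dE) cE; last first.
  by move=> e j he hj; apply: aE he _.
move=> i j hi hj; apply: gi; lia.
Qed.

(** The reply dominates [p i.-2], [p i.-1] and [p i]. This leaves a path of [i.-2] vertices with a
    dominated last vertex and, beyond [p i], a chain that starts with the pair [p i.+1],
    [p i.+2]. *)
Lemma GB_Staller_reply n i : 1 < i <= r ->
  dwin n (hU H (GB A al p i.-2)) -> dwin n (res (p i) (p i.-1) (hU H (GB A al p r))).
Proof.
move=> hi dH; have [gi gH gA ga] := g.
apply: (@GB_chain _ i.+1) dH _ => //.
  move=> e j [he|he] hj; first by apply: gH he _; lia.
  by apply: gad_avoids_B he _; lia.
move=> e [e0 [he|[[r0 [e1 he1 E0]]|[j hj E0]]] [ny ->]].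
- apply: Or31; exists e0; first by left.
  by rewrite setD1_notin // (gH _ _ he) //; lia.
- have i2 : i != 2.
    by apply: contraNneq ny => ->; rewrite E0 !inE eqxx gad_neq; lia.
  apply: Or31; exists e0.
    by right; left; split; [lia | exists e1].
  rewrite setD1_notin // E0 !inE gad_neq ?(negPf (gA _ _ he1 _)); lia.
move: ny; rewrite E0 !inE gad_sl ?gad_neq ?negb_and ?negb_or; try lia.
move=> ny; have [ji|ij] := ltnP j i.-2.
  apply: Or31; exists e0; first by right; right; exists j => //; lia.
  by rewrite E0 D1_tri ?inE //; lia.
case: (eqVneq j i.+1) => [ej|nej].
  subst j; apply: Or32; split; first lia.
  by apply/subsetP=> z; rewrite !inE => /orP[] /eqP->; rewrite !eqxx ?orbT ?gad_neq; lia.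
apply: Or33; exists j.-1; split; try lia.
case: j hj E0 ny ij nej => [|[|j]] //= hj E0 ny ij nej; try lia.
apply/subsetP=> z; rewrite !inE -orbA => /or3P[] /eqP->; rewrite !eqxx ?orbT ?gad_neq; lia.
Qed.

(** Beyond [p i] the first vertex is dominated and the last one need not be, so only triples remain
    there and pairing handles them. *)
Lemma GB_Dominator_move n x i : 0 < i <= r -> (forall j, 0 < j <= r -> p j != x) ->
  dwin n (hU (res x x H) (GB (res x x A) (al :\ x) p i.-1)) ->
  dwin n (res x (p i) (hU H (GB A al p r))).
Proof.
move=> hi nx dH; have [gi gH gA ga] := g.
apply: (@GB_chain _ i.+1) dH _ => //.
  move=> e j [he|[[r0 [e0 [e1 he1 [_ ->]] ->]]|[k hk ->]]] hj.
  - by apply: (res_avoids gH) he _; lia.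
  - by rewrite !inE gad_neq ?(negPf (gA _ _ he1 _)) ?andbF; lia.
  - case: k hk => [|[|k]] hk //=; rewrite !inE ?gad_neq ?(negPf (ga j _)) ?andbF; lia.
move=> e [e0 [he|[[r0 [e1 he1 E0]]|[j hj E0]]] [ny ->]].
- apply: Or31; exists (e0 :\ x) => //.
  by left; exists e0 => //; rewrite !inE eqxx.
- have i1 : i != 1.
    by apply: contraNneq ny => ->; rewrite E0 !inE eqxx nx //; lia.
  apply: Or31; exists (e0 :\ x) => //.
  right; left; split; [lia | exists (e1 :\ x)].
    by exists e1; rewrite // !inE eqxx.
  by rewrite E0 setU1_D1 // nx //; lia.
have := ny; rewrite {1}E0 => {}ny; move: ny; rewrite !inE gad_sl ?gad_neq ?negb_and ?negb_or ?negbK ?(negPf (nx _ _)) //=; try lia.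
move=> ny; have [ji|ij] := ltnP j i.-1.
  apply: Or31; exists (e0 :\ x) => //; right; right; exists j; first lia.
  rewrite E0; apply/setP=> z; case: j hj E0 ny ji => [|[|j]] //= hj E0 ny ji; rewrite !inE;
    case: (eqVneq z x) => //= ->; rewrite !(eq_sym x) ?(negPf (nx _ _)) //; lia.
apply: Or33; exists j.-1; split; try lia.
case: j hj E0 ny ij => [|[|j]] //= hj E0 ny ij; try lia.
rewrite E0; apply/subsetP=> z; rewrite !inE -orbA => /or3P[] /eqP->; rewrite ?eqxx ?orbT ?nx ?gad_neq; lia.
Qed.

Lemma GB_Dominator_moveV n x i : 0 < i <= r -> (forall j, 0 < j <= r -> p j != x) ->
  dwin n (res x (p i) (hU H (GB A al p r))) ->
  dwin n (hU (res x x H) (GB (res x x A) (al :\ x) p i.-1)).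
Proof.
move=> hi nx; have [gi gH gA ga] := g; apply: dwin_cov.
move=> e [[e0 he [_ ->]]|[[r0 [e0 [e1 he1 [_ ->]] ->]]|[k hk ->]]].
- exists (e0 :\ x) => //; exists e0; first by left.
  by rewrite !inE negb_and (gH _ _ he) ?orbT.
- exists ((p 1 |: e1) :\ x); last by rewrite setU1_D1 // nx //; lia.
  exists (p 1 |: e1); first by right; left; split; [lia|exists e1].
  split=> //; rewrite !inE negb_and gad_neq ?(negPf (gA _ _ he1 _)); lia.
exists ((sl al p k.-1 :|: [set p k; p k.+1]) :\ x).
  exists (sl al p k.-1 :|: [set p k; p k.+1]); first by right; right; exists k => //; lia.
  split=> //; rewrite !inE negb_and gad_sl ?gad_neq; lia.
by case: k hk => [|[|k]] hk //=; apply/subsetP=> z; rewrite !inE; case: eqP.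
Qed.

Section Core.
Variables (x y : T).
Hypotheses (nx : forall j, 0 < j <= r -> p j != x) (ny : forall j, 0 < j <= r -> p j != y)
  (nal : y \notin al :\ x).

Lemma GB_core n :
  dwin n (hU (res x y H) (GB (res x y A) (al :\ x) p r)) <->
  dwin n (res x y (hU H (GB A al p r))).
Proof.
have tD k : 0 < k < r -> (sl al p k.-1 :|: [set p k; p k.+1]) :\ x
   = sl (al :\ x) p k.-1 :|: [set p k; p k.+1].
  move=> hk; apply/setP=> z; case: k hk => [|[|k]] hk //=; rewrite !inE;
    case: (eqVneq z x) => //= ->; rewrite !(eq_sym x) ?(negPf (nx _ )) //; lia.
split; apply: dwin_sub => e.
  move=> [e0 [he|[[r0 [e1 he1 E0]]|[j hj E0]]] [ye ->]].
  - by left; exists e0.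
  - have p1x : p 1 != x by apply: nx; lia.
    right; left; split=> //; rewrite E0 setU1_D1 //.
    exists (e1 :\ x) => //; exists e1 => //; split=> //.
    by apply: contra ye; rewrite E0 !inE => /andP[-> ->]; rewrite orbT.
  - by right; right; exists j => //; rewrite E0 tD.
move=> [[e0 he [ye ->]]|[[r0 [e0 [e1 he1 [ye ->]] ->]]|[k hk ->]]].
- by exists e0 => //; left.
- exists (p 1 |: e1); first by right; left; split=> //; exists e1.
  have p1x : p 1 != x by apply: nx; lia.
  rewrite setU1_D1 //.
  split=> //; rewrite in_setU1 negb_or ye andbT eq_sym ny //; lia.
exists (sl al p k.-1 :|: [set p k; p k.+1]); first by right; right; exists k.
rewrite tD //; split=> //; rewrite !inE !(eq_sym y) ?(negPf (ny _)) ?orbF; try lia.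
by case: k hk => [|[|k]] hk //=; rewrite inE eq_sym ny //; lia.
Qed.
End Core.

(** Meant for a vertex [x] of the other path in a comparison: here it lies in no edge, so Dominator
    may waste her reply. *)
Lemma GB_junk n x : (forall j, 0 < j <= r -> p j != x) -> x \notin al ->
  (forall e, H e -> x \notin e) -> (forall e, A e -> x \notin e) ->
  dwin n (hU H (GB A al p r)) -> dwin n (res x x (hU H (GB A al p r))).
Proof.
move=> nx xal xH xA; apply: dwin_cov => e [e0 he [_ ->]]; exists e0 => //.
rewrite setD1_notin //; case: he => [/xH//|[[r0 [e1 he1 ->]]|[j hj ->]]].
  by rewrite !inE negb_or eq_sym nx ?xA //; lia.
by rewrite !inE !(eq_sym x) ?(negPf (nx _ _)) ?orbF; try lia; case: j hj => [|[|j]] hj //=; rewrite ?inE 1?eq_sym ?nx //; lia.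
Qed.

End Gadget.
Lemma upto_dec p r x :
  (exists2 i, 0 < i <= r & p i = x) \/ (forall j, 0 < j <= r -> p j != x).
Proof.
case: (boolP (has (fun i => p i == x) (iota 1 r))) => [/hasP[i]|/hasPn h].
  by rewrite mem_iota => hi /eqP; left; exists i => //; lia.
by right=> j hj; apply: h; rewrite mem_iota; lia.
Qed.

(* From two vertices on, all the paths of [GB] are worth the same to Dominator, and
   they are worth at most as much as a path with one vertex. *)
Definition okb r r' := (1 < r /\ 0 < r') \/ r = r'.

(** Once Dominator owns the end, [A] is gone and [p 1] is dominated; the rest is a chain of
    triples. *)
Lemma GB_killed n H A al p r x y :
  gad p r H A al -> cell A al -> (forall j, 0 < j <= r -> p j != x) -> y \in al :\ x ->
  dwin n (res x y H) -> dwin n (res x y (hU H (GB A al p r))).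
Proof.
move=> g [_ sA] nx yal dH; have [gi gH gA ga] := g.
have [yx ya] : y != x /\ y \in al by move: yal; rewrite !inE => /andP[].
apply: (GB_chain g (leqnn 1)) dH _.
  by move=> e j he hj; apply: (res_avoids gH) he _; lia.
move=> e [e0 [he|[[r0 [e1 he1 E0]]|[j hj E0]]] [ny ->]].
- by apply: Or31; exists (e0 :\ x) => //; exists e0.
- by move: ny; rewrite E0 !inE yx (subsetP (sA _ he1)) ?orbT.
case: j hj E0 => [|[|j]] // hj E0.
  by move: ny; rewrite E0 !inE yx ya ?orbT.
apply: Or33; exists j.+1; split; try lia.
rewrite E0; apply/subsetP=> z; rewrite !inE -orbA => /or3P[] /eqP->; rewrite eqxx ?orbT ?nx; lia.
Qed.

Lemma GB_gt0 n H A al p r : dwin n H -> ~ hU H (GB A al p r) set0.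
Proof.
move=> /dwin_n0 h [//|[[r0 [e1 he1 E0]]|[j hj E0]]].
  by have := in_set0 (p 1); rewrite E0 !inE eqxx.
by have := in_set0 (p j); rewrite E0 !inE eqxx ?orbT.
Qed.

(** Dominator simulates the path [p] while playing on [p']. The extra round in the hypothesis is
    what makes a forced reply in the source game really forced. *)
Lemma GB_transfer n H A al p r p' r' :
  okb r r' -> gad p r H A al -> gad p' r' H A al -> cell A al ->
  dwin n.+1 (hU H (GB A al p r)) -> dwin n (hU H (GB A al p' r')).
Proof.
elim: n H A al r r' => [|n IH] H A al r r' ok g g' c dH.
  by split=> //; apply: (@GB_gt0 1); apply: dwin_sub dH => e; left.
case: (posnP r') => [r0|r'0].
  have r'0 : r = 0 by case: ok; lia.
  by subst; apply: dwin_pred; apply: dwin_sub dH => e [|[[]|[j]]] //; [left|lia].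
have ok0 k : 0 < k -> k.-1 = 0 \/ okb r k.-1 \/ (r = 1 /\ 1 < k).
  by move: ok; rewrite /okb; lia.
split; first by apply: (@GB_gt0 n.+2); apply: dwin_sub dH => e; left.
have sub0 m : dwin m H -> dwin m (hU H (GB A al p' 0)).
  by apply: dwin_sub => e [|[[]|[j]]] //; lia.
have dHH m : m <= n.+2 -> dwin m H.
  by move=> hm; apply: dwin_leq hm _; apply: dwin_sub dH => e; left.
have [gi gH gA ga] := g; have [gi' gH' gA' ga'] := g'.
move=> x; case: (upto_dec p' r' x) => [[i hi <-]|nx'].
  case: (ltnP 1 i) => [i1|i1].
    exists (p' i.-1); apply: GB_Staller_reply => //; first lia.
    case: (posnP i.-2) => [->|i2]; first by apply: sub0; apply: dHH; lia.
    apply: (IH H A al r) => //; last exact: dwin_pred.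
      by move: ok; rewrite /okb; lia.
    by apply: gad_leq g'; lia.
  have {i1 hi}-> : i = 1 by lia.
  (* Staller takes [p' 1]. If the end is still present, Dominator takes it, and pairing settles the
     path from [p' 2] on. *)
  have [al1 sA] := c; case: al1 => [al0|[a ala]]; last first.
    have p'a : p' 1 != a by have := ga' 1; rewrite ala inE; apply; lia.
    exists a; apply: (GB_chain g' (isT : 0 < 2)) (dHH n _) _; last 1 first.
    - move=> e [e0 [he|[[r0 [e1 he1 E0]]|[j hj E0]]] [ny ->]].
      + by apply: Or31; exists e0 => //; rewrite setD1_notin // (gH' _ _ he); lia.
      + by move: ny; rewrite E0 !inE (subsetP (sA _ he1)) ?orbT 1?eq_sym ?p'a // ala inE.
      case: j hj E0 => [|[|[|j]]] // hj E0.
      + by move: ny; rewrite E0 /= ala !inE eqxx eq_sym p'a.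
      + apply: Or32; split; first lia.
        by rewrite E0; apply/subsetP=> z; rewrite !inE => /orP[] /eqP->; rewrite eqxx ?orbT (gad_neq g'); lia.
      apply: Or33; exists j.+2; split; try lia.
      by rewrite E0; apply/subsetP=> z; rewrite !inE -orbA => /or3P[] /eqP->; rewrite eqxx ?orbT (gad_neq g'); lia.
    - by move=> e j he hj; apply: gH' he _; lia.
    - lia.
  (* Staller owns the end. In the source she could take [p 1] and force [p 2], which leaves [H] with
     [A]; so Dominator wins these even when [p 1] is lost for [A], and the loss of [p' 1] does no
     harm in the target. *)
  case: (ltnP 1 r) => [r1|r1].
    have dHA : dwin n.+1 (hU H A).
      have h1 : hU H (GB A al p r) (sl al p 0 :|: [set p 1; p 2]) by right; right; exists 1.
      apply: dwin_sub (dwin_forced dH h1 (x := p 1) (z := p 2) _); last first.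
        apply/setP=> z; rewrite /= al0 !inE /=.
        case: (eqVneq z (p 1)) => //= ->; rewrite (gad_neq g); lia.
      move=> e [he|he].
        exists e; first by left.
        by rewrite setD1_notin ?(gH _ _ he) //; lia.
      exists (p 1 |: e); first by right; left; split; [lia|exists e].
      have -> : (p 1 |: e) :\ p 1 = e by rewrite setU1K // (gA _ _ he); lia.
      by rewrite (gA _ _ he) //; lia.
    have nA e : A e -> (p' 1 |: e) :\ p' 1 = e.
      by move=> he; rewrite setU1K // (gA' _ _ he); lia.
    case: (ltnP 1 r') => r'1; last first.
      exists (p' 1); apply: dwin_leq (leqnSn _) _; apply: dwin_sub dHA.
      move=> e [e0 [he|[[r0 [e1 he1 E0]]|[j hj E0]]] [ny ->]]; last lia.
        by left; rewrite setD1_notin // (gH' _ _ he); lia.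
      by right; rewrite E0 nA.
    exists (p' 2); apply: (GB_chain g' (isT : 0 < 3)) (dwin_pred dHA) _.
      by move=> e j [he|he] hj; [apply: gH' he _; lia|apply: gA' he _; lia].
    move=> e [e0 [he|[[r0 [e1 he1 E0]]|[j hj E0]]] [ny ->]].
    + by apply: Or31; exists e0; [left|rewrite setD1_notin // (gH' _ _ he); lia].
    + by apply: Or31; exists e1; [right|rewrite E0 nA].
    have p21 : p' 2 != p' 1 by rewrite (gad_neq g'); lia.
    case: j hj E0 => [|[|[|[|j]]]] // hj E0; try by move: ny; rewrite E0 !inE eqxx p21 ?orbT.
    apply: Or33; exists j.+3; split; try lia.
    by rewrite E0; apply/subsetP=> z; rewrite !inE -orbA => /or3P[] /eqP->; rewrite eqxx ?orbT (gad_neq g'); lia.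
  have [er er'] : r = 1 /\ r' = 1 by move: ok; rewrite /okb; lia.
  subst r r'; have [y hy] := dwin_step dH (p 1); exists y; apply: dwin_pred.
  have nA e (q : nat -> T) : gad q 1 H A al -> A e -> (q 1 |: e) :\ q 1 = e.
    by move=> [_ _ qA _] he; rewrite setU1K // (qA _ _ he); lia.
  have nH e (q : nat -> T) : gad q 1 H A al -> H e -> e :\ q 1 = e.
    by move=> [_ qH _ _] he; rewrite setD1_notin // (qH _ _ he); lia.
  apply: dwin_sub hy => e [e0 [he|[[r0 [e1 he1 E0]]|[j hj E0]]] [ny ->]]; last lia.
    by move: ny; rewrite (nH _ p') // => ny; exists e0; [left|rewrite (nH _ p)].
  move: ny; rewrite E0 (nA _ p') // => ny.
  exists (p 1 |: e1); last by rewrite (nA _ p).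
  by right; left; split=> //; exists e1.
case: (upto_dec p r x) => [[i hi Ex]|nx].
  exists x; apply: GB_junk => //.
  - by rewrite -Ex ga.
  - by move=> e he; rewrite -Ex (gH _ _ he).
  - by move=> e he; rewrite -Ex (gA _ _ he).
  by apply: (IH _ _ _ r) => //; apply: dwin_pred.
have c' y := cell_res x y c.
have [y hy] := dwin_step dH x.
case: (upto_dec p r y) => [[i hi Ey]|ny].
  rewrite -Ey in hy; have {}hy := GB_Dominator_moveV g hi nx hy.
  (* The reply leaves [i.-1] vertices in the source and [k.-1] in the target. No vertex is matched
     with none, one with one if [r'] allows it, and more with as many as [r'] allows; having none
     left is always fine for Dominator. *)
  pose k := if i.-1 > 1 then r' else if (i == 2) && (1 < r') then 2 else 1.
  have hk : 0 < k <= r' by rewrite /k; do 2?case: ifP; lia.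
  have hik : k.-1 = 0 \/ okb i.-1 k.-1.
    by rewrite /k /okb; do 2?case: ifP; lia.
  exists (p' k); apply: (GB_Dominator_move g' hk nx').
  case: hik => [->|hik].
    by apply: dwin_pred; apply: dwin_sub hy => e [|[[]|[j]]] //; [left|lia].
  apply: (IH _ _ _ i.-1) => //.
    by apply/gad_res/(gad_leq _ g); lia.
  by apply/gad_res/(gad_leq _ g'); lia.
case: (boolP (y \in al :\ x)) => yal.
  exists y; apply: (GB_killed g') => //; apply: dwin_pred.
  by apply: dwin_sub hy => e [e0 he h]; exists e0 => //; left.
have {}hy := (GB_core H A nx ny yal n.+1).2 hy.
(* If the source reply lies on [p'], it meets no edge of [H] or [A] and is wasted there, so
   Dominator wastes hers in the target. *)
case: (upto_dec p' r' y) => [[j hj Ey]|ny'].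
  exists x; apply/(GB_core H A nx' nx'); first by rewrite !inE eqxx.
  apply: (IH _ _ _ r) => //; [exact: gad_res|exact: gad_res|].
  have resE (E : hyp) e : avoids r' p' E -> res x x E e -> res x y E e.
    move=> aE [e0 he [_ ->]]; exists e0 => //; split=> //.
    by rewrite -Ey !inE negb_and (aE _ _ he) ?orbT.
  apply: dwin_sub hy => e [he|[[r0 [e1 he1 E0]]|h]]; first by left; apply: resE.
    by right; left; split=> //; exists e1 => //; apply: resE.
  by right; right.
exists y; apply/(GB_core H A nx' ny' yal).
by apply: (IH _ _ _ r) => //; exact: gad_res.
Qed.

End Game.

(** * Invariance under injective renaming of the vertices *)

Section Rename.
Variables (T T' : finType) (f : T -> T').
Hypothesis f_inj : injective f.

(** A vertex outside the image of [f] lies in no edge, so claiming it is a wasted move. *)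
Lemma dwin_imset n (E : hyp T) :
  dwin n E <-> dwin n (fun e => exists2 e0, E e0 & e = f @: e0).
Proof.
have D1 (e : {set T}) x : f @: (e :\ x) = (f @: e) :\ f x.
  apply/setP=> z; apply/imsetP/setD1P => [[y /setD1P[yx ye] ->]|[zx /imsetP[y ye Ez]]].
    by rewrite (inj_eq f_inj) yx imset_f.
  by exists y => //; rewrite !inE ye andbT; apply: contraNneq zx => <-; rewrite Ez.
have D0 (e : {set T}) z : (forall x, f x != z) -> (f @: e) :\ z = f @: e.
  move=> nz; apply: setD1_notin; apply/imsetP=> -[x _ /eqP].
  by rewrite eq_sym (negPf (nz x)).
have E00 (E0 : hyp T) : ~ E0 set0 <-> ~ exists2 e0, E0 e0 & set0 = f @: e0.
  split=> h; last by move=> h0; apply: h; exists set0; rewrite ?imset0.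
  by move=> [e0 he /esym/eqP]; rewrite imset_eq0 => /eqP e00; subst.
have im z : (exists x, f x = z) \/ forall x, f x != z.
  case: (pickP (fun x => f x == z)) => [x /eqP <-|h]; first by left; exists x.
  by right=> x; rewrite h.
elim: n E => [|n IH] E; first by split=> -[h _]; split=> //; apply/E00.
split=> -[h0 hs]; (split; first exact/E00) => z.
- case: (im z) => [[x <-]|nz].
    have [y /IH hy] := hs x; exists (f y); apply: dwin_sub hy.
    move=> e [_ [e0 he ->] [ny ->]]; exists (e0 :\ x); last by rewrite D1.
    by exists e0 => //; split=> //; rewrite -D1 (mem_imset _ _ f_inj) in ny.
  exists z; have := dwin_pred (conj h0 hs : dwin n.+1 E); rewrite IH; apply: dwin_sub.
  by move=> e [_ [e0 he ->] [ny ->]]; exists e0 => //; rewrite D0.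
have [y hy] := hs (f z); case: (im y) => [[x Ex]|ny].
  exists x; apply/IH; apply: dwin_sub hy => _ [e0 [e1 he [ny ->]] ->].
  exists (f @: e1); first by exists e1.
  by rewrite -D1 -Ex (mem_imset _ _ f_inj).
exists z; apply/IH; apply: dwin_sub hy => _ [e0 [e1 he [_ ->]] ->].
exists (f @: e1); first by exists e1.
rewrite -D1; split=> //; apply/imsetP=> -[x _ /eqP].
by rewrite eq_sym (negPf (ny x)).
Qed.
End Rename.

(** * Pendant paths whose last vertex must be dominated *)

Section WhitePath.
Variable T : finType.
Implicit Types (e : {set T}) (x y : T) (n : nat).
Implicit Types E H A B : hyp T.

(* As [GB], except that the last vertex has to be dominated too. *)
Definition GW A al (p : nat -> T) k : hyp T :=
  if k is k'.+1 then hU (GB A al p k) (fun e => e = sl al p k' :|: [set p k]) else A.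

(** Staller's move on [p k.+1] threatens to isolate [p k.+2], so Dominator must answer there. Both
    vertices are then dominated, while [p k] has lost its outer neighbour to Staller and becomes the
    last vertex to be dominated. *)
Lemma GW_down n H A al p k : gad p k.+2 H A al ->
  dwin n.+2 (hU H (GW A al p k.+2)) -> dwin n.+1 (hU H (GW A al p k)).
Proof.
move=> g dH; have [gi gH gA ga] := g.
have h1 : hU H (GW A al p k.+2) (sl al p k.+1 :|: [set p k.+2]) by right; right.
apply: dwin_sub (dwin_forced dH h1 (x := p k.+1) (z := p k.+2) _); last first.
  apply/setP=> z; rewrite /= !inE /=; case: (eqVneq z (p k.+1)) => //= ->.
  by rewrite (gad_neq g); lia.
move=> e [he|].
  exists e; first by left.
  by rewrite setD1_notin ?(gH _ _ he) //; lia.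
case: k g dH gi gH gA ga h1 => [|k] g dH gi gH gA ga h1.
  move=> he; exists (p 1 |: e); first by right; left; left; split=> //; exists e.
  have -> : (p 1 |: e) :\ p 1 = e by rewrite setU1K // (gA _ _ he); lia.
  by split=> //; rewrite (gA _ _ he); lia.
move=> [[[_ [e1 he1 ->]]|[j hj ->]]|->].
- exists (p 1 |: e1); first by right; left; left; split=> //; exists e1.
  rewrite setU1_D1 ?(gad_neq g); try lia.
  rewrite setD1_notin; last by rewrite (gA _ _ he1); lia.
  by split=> //; rewrite !inE (gad_neq g) ?(negPf (gA _ _ he1 _)); lia.
- exists (sl al p j.-1 :|: [set p j; p j.+1]).
    by right; left; right; exists j => //; lia.
  rewrite (D1_tri g) ?inE; try lia.
  by split=> //; rewrite ?inE (gad_sl g) ?(gad_neq g); lia.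
exists (sl al p k.+1.-1 :|: [set p k.+1; p k.+2]).
  by right; left; right; exists k.+1 => //; lia.
split.
  by rewrite !inE (gad_sl g) ?(gad_neq g); lia.
apply/setP=> z; rewrite !inE; case: (eqVneq z (p k.+2)) => [->|_]; last by rewrite /= orbF.
by rewrite (gad_sl g) ?(gad_neq g) //; lia.
Qed.

(** Conversely Dominator pairs the two new vertices; the edge of [p k] only grows by [p k.+1]. *)
Lemma GW_up n H A al p k : gad p k.+2 H A al ->
  dwin n (hU H (GW A al p k)) -> dwin n (hU H (GW A al p k.+2)).
Proof.
move=> g dH; have [gi gH gA ga] := g.
apply: (GB_chain g (isT : 0 < k.+1)) dH _.
  move=> e j [he hj|]; first by apply: gH he _; lia.
  case: k g gi gH gA ga => [|k] g gi gH gA ga.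
    by move=> he hj; apply: (gA e j he); lia.
  move=> [he|->] hj; first by apply: (gad_avoids_B g) he _; lia.
  by rewrite !inE (gad_sl g) ?(gad_neq g); lia.
have O2 e : e = sl al p k.+1 :|: [set p k.+2] \/ e = sl al p k :|: [set p k.+1; p k.+2] ->
    k.+1 < k.+2 /\ [set p k.+1; p k.+2] \subset e.
  by move=> h; split=> //; case: h => ->; apply/subsetP=> z; rewrite !inE => /orP[->|->]; rewrite ?orbT.
move=> e [he|[[[_ [e1 he1 ->]]|[j hj ->]]|->]].
- by apply: Or31; exists e => //; left.
- apply: Or31; case: k g gi gH gA ga O2 => [|k] g gi gH gA ga O2.
    by exists e1; [right|apply: subsetUr].
  by exists (p 1 |: e1) => //; right; left; left; split=> //; exists e1.
- case: (ltngtP j k.+1) => jk; last by subst j; apply: Or32; apply: O2; right.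
    apply: Or31; case: k g gi gH gA ga O2 hj jk => [|k] g gi gH gA ga O2 hj jk; first lia.
    case: (eqVneq j k.+1) => [->|jk'].
      exists (sl al p k :|: [set p k.+1]); first by right; right.
      by apply/subsetP=> z; rewrite !inE => /orP[->|->]; rewrite ?orbT.
    exists (sl al p j.-1 :|: [set p j; p j.+1]) => //.
    by right; left; right; exists j => //; lia.
  lia.
- by apply: Or32; apply: O2; left.
Qed.

(** Every shortening by two costs one forced round; the [k] spare rounds cover all of them. *)
Lemma GW_parity n H A al p k : gad p k H A al ->
  dwin (n.+1 + k) (hU H (GW A al p k)) -> dwin n.+1 (hU H (GW A al p (odd k))).
Proof.
elim/ltn_ind: k n => -[|[|k]] IH n g; try by apply: dwin_leq; rewrite leq_addr.
move=> h0; have h : dwin (n + k.+1).+1 (hU H (GW A al p k)).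
  by apply: (GW_down g); apply: dwin_leq h0; lia.
rewrite [odd _]/= negbK; apply: IH => //.
  by apply: gad_leq g; lia.
by apply: dwin_leq h; lia.
Qed.

Lemma GW_parityV n H A al p k : gad p k H A al ->
  dwin n (hU H (GW A al p (odd k))) -> dwin n (hU H (GW A al p k)).
Proof.
elim/ltn_ind: k n => -[|[|k]] IH n g //; rewrite [odd _]/= negbK => h.
by apply: GW_up => //; apply: IH h => //; apply: gad_leq g; lia.
Qed.

Lemma GW1_rename n H A al p p' : gad p 1 H A al -> gad p' 1 H A al ->
  dwin n (hU H (GW A al p 1)) -> dwin n (hU H (GW A al p' 1)).
Proof.
move=> [_ gH gA ga] [_ gH' gA' ga'] h.
pose s z := if z == p 1 then p' 1 else if z == p' 1 then p 1 else z.
have s_inj : injective s.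
  apply: (can_inj (g := s)) => z; rewrite /s.
  case: (eqVneq z (p 1)) => [->|n1]; first by rewrite eqxx; case: eqP.
  by case: (eqVneq z (p' 1)) => [->|n2]; rewrite ?eqxx ?(negPf n1) ?(negPf n2).
have sK e : p 1 \notin e -> p' 1 \notin e -> s @: e = e.
  move=> e1 e1'; rewrite -[RHS]imset_id; apply: eq_in_imset => z ze.
  by rewrite /s; do 2?case: eqP => [E|_] //; move: ze; rewrite E ?(negPf e1) ?(negPf e1').
have sU e : s @: (p 1 |: e) = p' 1 |: (s @: e) by rewrite imsetU1 {1}/s eqxx.
have al1 : s @: al = al by apply: sK; [apply: ga|apply: ga'].
have /(dwin_imset s_inj) := h; apply: dwin_sub.
move=> e [he|[[[_ [e1 he1 ->]]|[j hj]]|->]]; last 2 [lia].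
- exists e; first by left.
  by rewrite sK // ?(gH _ _ he) ?(gH' _ _ he).
- exists (p 1 |: e1); first by right; left; left; split=> //; exists e1.
  by rewrite sU sK ?(gA _ _ he1) ?(gA' _ _ he1).
exists (sl al p 0 :|: [set p 1]); first by right; right.
by rewrite /= [in RHS]setUC sU al1 setUC.
Qed.

Lemma GW_transfer n H A al p k p' k' :
  odd k = odd k' -> gad p k H A al -> gad p' k' H A al ->
  dwin (n.+1 + k) (hU H (GW A al p k)) -> dwin n.+1 (hU H (GW A al p' k')).
Proof.
move=> kk g g' /(GW_parity g) h; apply: GW_parityV => //; move: h; rewrite -kk.
case: (boolP (odd k)) => // ok; apply: GW1_rename.
  by apply: gad_leq g; case: (k) ok.
by apply: gad_leq g'; move: ok; rewrite kk; case: (k').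
Qed.
End WhitePath.

(** * Paths between two ends *)

Section Path.
Variable T : finType.
Implicit Types (e al be : {set T}) (x y : T) (n i j k m : nat) (p : nat -> T).
Implicit Types E H A B : hyp T.

(** Slots 0 and [m.+1] are the ends, so that the edge of any path vertex is the union of three
    consecutive slots, even when an end is empty. *)
Definition slP al be p m j : {set T} :=
  if j is 0 then al else if j == m.+1 then be else [set p j].

(* The path [p 1, ..., p m] between the ends [al] and [be]. *)
Definition GP A al B be p m : hyp T := fun e =>
  [\/ exists2 e0, A e0 & e = p 1 |: e0, exists2 e0, B e0 & e = p m |: e0 |
      exists2 j, 0 < j <= m & e = slP al be p m j.-1 :|: [set p j] :|: slP al be p m j.+1].

Definition rv m p k : T := p (m.+1 - k).

Lemma slP_rev al be p m j : j <= m.+1 -> slP al be p m j = slP be al (rv m p) m (m.+1 - j).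
Proof.
rewrite /slP /rv; case: j => [|j] jm; first by rewrite subn0 /= eqxx.
case: eqVneq => [->|jm']; first by rewrite subnn.
have -> : m.+1 - j.+1 = (m - j).-1.+1 by lia.
case: eqP => [|_]; first lia.
by congr [set p _]; lia.
Qed.

Lemma GP_rev A al B be p m e : 0 < m -> GP A al B be p m e <-> GP B be A al (rv m p) m e.
Proof.
move=> m0; have r1 : rv m p m = p 1 by congr p; lia.
have rm : rv m p 1 = p m by congr p; lia.
have trE j : 0 < j <= m ->
    slP al be p m j.-1 :|: [set p j] :|: slP al be p m j.+1 =
    slP be al (rv m p) m (m.+1 - j).-1 :|: [set rv m p (m.+1 - j)] :|:
    slP be al (rv m p) m (m.+1 - j).+1.
  move=> hj; rewrite 2?(@slP_rev al be); try lia.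
  have -> : m.+1 - j.-1 = (m.+1 - j).+1 by lia.
  have -> : m.+1 - j.+1 = (m.+1 - j).-1 by lia.
  have -> : rv m p (m.+1 - j) = p j by congr p; lia.
  by apply/setP=> z; rewrite !in_setU; do 3?case: (z \in _).
split=> -[[e0 he ->]|[e0 he ->]|[j hj ->]].
- by apply: Or32; exists e0; rewrite ?r1.
- by apply: Or31; exists e0; rewrite ?rm.
- by apply: Or33; exists (m.+1 - j); rewrite ?trE //; lia.
- by apply: Or32; exists e0; rewrite ?rm.
- by apply: Or31; exists e0; rewrite ?r1.
apply: Or33; exists (m.+1 - j); first lia.
by rewrite trE; [have -> : m.+1 - (m.+1 - j) = j by lia|lia].
Qed.

(** The ends are kept disjoint so that taking one of them does not touch the other. *)
Definition pctx M H A al B be p :=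
  [/\ gad p M H A al, gad p M H B be, cell A al, cell B be & [disjoint al & be]].

Lemma pctx_res M H A al B be p x y z t : pctx M H A al B be p ->
  pctx M (res x y H) (res x z A) (al :\ x) (res x t B) (be :\ x) p.
Proof.
case=> gA gB cA cB dab; split; try exact: gad_res; try exact: cell_res.
by apply: disjointWl (subsetDl _ _) _; apply: disjointWr (subsetDl _ _) _.
Qed.

Lemma pctx_rev M H A al B be p m : m <= M ->
  pctx M H A al B be p -> pctx m H B be A al (rv m p).
Proof.
have gr A' al' : m <= M -> gad p M H A' al' -> gad (rv m p) m H A' al'.
  rewrite /rv => mM [gi gH gA ga]; split.
  - by move=> i j hi hj h; have := gi _ _ _ _ h; lia.
  - by move=> e j he hj; apply: gH he _; lia.
  - by move=> e j he hj; apply: gA he _; lia.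
  - by move=> j hj; apply: ga; lia.
move=> mM [gA gB cA cB dab]; split=> //; try exact: gr.
by rewrite disjoint_sym.
Qed.

(** * The effect of one round on a path between two ends *)

Section Moves.
Variables (M : nat) (H A : hyp T) (al : {set T}) (B : hyp T) (be : {set T}) (p : nat -> T) (m : nat).
Hypotheses (cx : pctx M H A al B be p) (mM : 0 < m <= M).

Let tri j := slP al be p m j.-1 :|: [set p j] :|: slP al be p m j.+1.

Lemma in_slP i j : 0 < i <= m -> j <= m.+1 -> (p i \in slP al be p m j) = (i == j).
Proof.
case: cx => gA gB _ _ _; rewrite /slP => hi hj; case: j hj => [|j] hj.
  by case: gA => _ _ _ ga; rewrite (negPf (ga _ _)); lia.
case: eqVneq => [->|h]; first by case: gB => _ _ _ ga; rewrite (negPf (ga _ _)); lia.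
by rewrite inE (gad_neq gA); lia.
Qed.

Lemma in_tri i j : 0 < i <= m -> 0 < j <= m ->
  (p i \in tri j) = (i \in [:: j.-1; j; j.+1]).
Proof.
case: (cx) => gA _ _ _ _ hi hj; rewrite !inE !in_slP ?(gad_neq gA) -?orbA; lia.
Qed.

Lemma tri_left j : 0 < j < m -> tri j = sl al p j.-1 :|: [set p j; p j.+1].
Proof.
move=> hj; rewrite /tri /slP -setUA; congr (_ :|: (_ :|: _)).
  by case: j hj => [|[|j]] //= hj; case: eqP => //; lia.
by case: eqP => //; lia.
Qed.

Lemma tri_right j : 1 < j <= m ->
  tri j = sl be (rv m p) (m.+1 - j).-1 :|: [set rv m p (m.+1 - j); rv m p (m.+1 - j).+1].
Proof.
move=> hj; rewrite /tri.
have -> : slP al be p m j.+1 = sl be (rv m p) (m.+1 - j).-1.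
  rewrite /slP /rv /sl; case: eqP => [[->]|jm]; first by rewrite subSnn.
  have -> : (m.+1 - j).-1 = (m.+1 - j).-2.+1 by lia.
  by congr [set p _]; lia.
have -> : slP al be p m j.-1 = [set rv m p (m.+1 - j).+1].
  rewrite /slP /rv; case: j hj => [|[|j]] //= hj; case: eqP => [|_]; first lia.
  by congr [set p _]; lia.
have -> : p j = rv m p (m.+1 - j) by congr p; lia.
by apply/setP=> z; rewrite !in_setU; do 3?case: (z \in _).
Qed.

Lemma p_neq i j : 0 < i <= m -> 0 < j <= m -> (p i == p j) = (i == j).
Proof. by case: cx => gA _ _ _ _ hi hj; rewrite (gad_neq gA); lia. Qed.

Lemma pH i e : H e -> 0 < i <= m -> p i \notin e.
Proof. by case: cx => -[_ gH _ _] _ _ _ _ he hi; apply: gH he _; lia. Qed.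

Lemma pA i e : A e -> 0 < i <= m -> p i \notin e.
Proof. by case: cx => -[_ _ gH _] _ _ _ _ he hi; apply: gH he _; lia. Qed.

Lemma pB i e : B e -> 0 < i <= m -> p i \notin e.
Proof. by case: cx => _ [_ _ gH _] _ _ _ he hi; apply: gH he _; lia. Qed.

Lemma rv1 : rv m p 1 = p m.
Proof. by rewrite /rv; congr p; lia. Qed.

Lemma D1_id x e : x \notin e -> e :\ x = e.
Proof. exact: setD1_notin. Qed.

(** The path splits. Before Staller's vertex, the last vertex still has to be dominated, which gives
    a [GW]; after Dominator's vertex the next one is dominated, which gives a [GB] read from the
    other end. *)
Lemma GP_Staller_reply n i : 0 < i < m ->
  dwin n (res (p i) (p i.+1) (hU H (GP A al B be p m))) <->
  dwin n (hU (hU H (GW A al p i.-1)) (GB B be (rv m p) (m - i.+1))).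
Proof.
move=> hi; split; apply: dwin_sub => e; last first.
  move=> [e0 [he|[[e1 he E0]|[e1 he E0]|[j hj E0]]] [ny ->]].
  - by left; left; rewrite D1_id // pH //; lia.
  - left; right; rewrite E0; case: (i) hi => [|[|k]] // hk.
      by rewrite setU1K //= pA //; lia.
    rewrite setU1_D1 ?D1_id ?pA ?p_neq //; try lia.
    by left; left; split=> //; exists e1.
  - right; left; split.
      case: (posnP (m - i.+1)) => // h; move: ny; rewrite E0.
      have -> : m = i.+1 by lia.
      by rewrite !inE eqxx p_neq; lia.
    exists e1 => //; rewrite rv1 E0 setU1_D1 ?D1_id ?pB ?p_neq //; lia.
  - rewrite -/(tri j) in E0.
    move: ny; rewrite !inE p_neq; try lia; rewrite E0 in_tri ?inE; try lia.
    move=> ny; have [ji|ij] := ltnP j i.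
      left; right; case: (eqVneq j.+1 i) => [<-|ji'].
        case: j hj E0 ny ji => [|j] // hj E0 ny ji; right.
        rewrite tri_left /=; last lia.
        apply/setP=> z; rewrite !inE; case: (eqVneq z (p j.+2)) => [->|_]; last by rewrite /= orbF.
        rewrite /= p_neq; try lia.
        have := @in_slP j.+2 j; rewrite /slP /sl.
        by case: (j) hj ji => [|k] hj ji; [move=> ->|case: eqP => [|_ ->]]; lia.
      have -> : tri j :\ p i = tri j by rewrite D1_id // in_tri ?inE; lia.
      have -> : i.-1 = i.-2.+1 by lia.
      by left; right; exists j; [lia|apply: tri_left; lia].
    right; right; exists (m.+1 - j); first lia.
    by rewrite D1_id ?in_tri ?inE ?tri_right //; lia.
move=> [[he|]|[[r0 [e1 he1 ->]]|[k hk ->]]].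
- exists e; first by left.
  by rewrite D1_id ?pH //; lia.
- case: i hi => [|[|i]] // hi he.
    exists (p 1 |: e); first by right; apply: Or31; exists e.
    have -> : (p 1 |: e) :\ p 1 = e by rewrite setU1K // pA //; lia.
    by split=> //; rewrite pA //; lia.
  move: he => [[[_ [e1 he1 ->]]|[j hj ->]]|->].
  + exists (p 1 |: e1); first by right; apply: Or31; exists e1.
    have -> : (p 1 |: e1) :\ p i.+2 = p 1 |: e1.
      by rewrite setU1_D1 ?p_neq ?D1_id ?pA //; lia.
    by split=> //; rewrite !inE negb_or pA ?p_neq //; lia.
  + exists (tri j); first by right; apply: Or33; exists j => //; lia.
    have -> : tri j :\ p i.+2 = tri j by rewrite D1_id // in_tri ?inE; lia.
    rewrite tri_left; last lia.
    by split=> //; rewrite -tri_left ?in_tri ?inE; lia.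
  exists (tri i.+1); first by right; apply: Or33; exists i.+1 => //; lia.
  have -> : tri i.+1 :\ p i.+2 = sl al p i :|: [set p i.+1].
    rewrite tri_left /=; last lia.
    apply/setP=> z; rewrite !inE; case: (eqVneq z (p i.+2)) => [->|_]; last by rewrite /= orbF.
    rewrite /= p_neq; try lia.
    have := @in_slP i.+2 i; rewrite /slP /sl.
    by case: (i) hi => [|k] hi; [move=> ->|case: eqP => [|_ ->]]; lia.
  split=> //; rewrite !inE p_neq; try lia.
  have := @in_slP i.+3 i; rewrite /slP /sl.
  by case: (i) hi => [|k] hi; [move=> ->|case: eqP => [|_ ->]]; lia.
- exists (p m |: e1); first by right; apply: Or32; exists e1.
  have -> : (p m |: e1) :\ p i = p m |: e1.
    by rewrite setU1_D1 ?p_neq ?D1_id ?pB //; lia.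
  by rewrite rv1; split=> //; rewrite !inE negb_or pB ?p_neq //; lia.
exists (tri (m.+1 - k)); first by right; apply: Or33; exists (m.+1 - k) => //; lia.
have -> : tri (m.+1 - k) :\ p i = tri (m.+1 - k) by rewrite D1_id // in_tri ?inE; lia.
split; first by rewrite in_tri ?inE; lia.
rewrite tri_right; last lia.
by have -> : m.+1 - (m.+1 - k) = k by lia.
Qed.

Section Core.
Variable x : T.
Hypothesis nx : forall j, 0 < j <= m -> p j != x.

Lemma tri_D1 j : 0 < j <= m -> tri j :\ x =
  slP (al :\ x) (be :\ x) p m j.-1 :|: [set p j] :|: slP (al :\ x) (be :\ x) p m j.+1.
Proof.
have slx i : i <= m.+1 -> slP al be p m i :\ x = slP (al :\ x) (be :\ x) p m i.
  move=> hi; rewrite /slP; case: i hi => // i hi; case: eqP => // ne.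
  by rewrite D1_id // inE eq_sym nx //; lia.
move=> hj; rewrite !setDUl !slx; try lia.
by rewrite (@D1_id _ [set p j]) // inE eq_sym nx.
Qed.

Lemma GP_core n y : (forall j, 0 < j <= m -> p j != y) -> y \notin al :\ x -> y \notin be :\ x ->
  dwin n (hU (res x y H) (GP (res x y A) (al :\ x) (res x y B) (be :\ x) p m)) <->
  dwin n (res x y (hU H (GP A al B be p m))).
Proof.
move=> ny nal nbe.
have nt j : 0 < j <= m -> y \notin tri j :\ x.
  move=> hj; rewrite tri_D1 //.
  have h i : i <= m.+1 -> y \notin slP (al :\ x) (be :\ x) p m i.
    move=> hi; rewrite /slP; case: i hi => // i hi; case: eqP => // ne.
    by rewrite inE eq_sym ny //; lia.
  by rewrite !in_setU in_set1 !negb_or !h ?[y == _]eq_sym ?ny //; lia.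
have n1 i : 0 < i <= m -> y != p i by move=> hi; rewrite eq_sym ny.
split; apply: dwin_sub => e.
  move=> [e0 [he|[[e1 he E0]|[e1 he E0]|[j hj E0]]] [ye ->]].
  - by left; exists e0.
  - right; apply: Or31; exists (e1 :\ x); last by rewrite E0 setU1_D1 ?nx //; lia.
    exists e1 => //; split=> //; apply: contra ye; rewrite E0 !inE => /andP[-> ->].
    by rewrite orbT.
  - right; apply: Or32; exists (e1 :\ x); last by rewrite E0 setU1_D1 ?nx //; lia.
    exists e1 => //; split=> //; apply: contra ye; rewrite E0 !inE => /andP[-> ->].
    by rewrite orbT.
  by right; apply: Or33; exists j => //; rewrite E0 tri_D1.
move=> [[e0 he [ye ->]]|[[e0 [e1 he [ye ->]] ->]|[e0 [e1 he [ye ->]] ->]|[j hj ->]]].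
- by exists e0 => //; left.
- exists (p 1 |: e1); first by right; apply: Or31; exists e1.
  by rewrite setU1_D1 ?nx //; [rewrite in_setU1 negb_or ye n1 //|]; lia.
- exists (p m |: e1); first by right; apply: Or32; exists e1.
  by rewrite setU1_D1 ?nx //; [rewrite in_setU1 negb_or ye n1 //|]; lia.
exists (tri j); first by right; apply: Or33; exists j.
by rewrite nt ?tri_D1.
Qed.

Lemma GP_Dominator_move n i : 0 < i <= m ->
  dwin n (res x (p i) (hU H (GP A al B be p m))) <->
  dwin n (hU (hU (res x x H) (GB (res x x A) (al :\ x) p i.-1))
             (GB (res x x B) (be :\ x) (rv m p) (m - i))).
Proof.
move=> hi.
have inx j e : 0 < j <= m -> (p j \in e :\ x) = (p j \in e) by move=> hj; rewrite !inE nx.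
have tL j : 0 < j < m -> tri j :\ x = sl (al :\ x) p j.-1 :|: [set p j; p j.+1].
  move=> hj; rewrite tri_left // setDUl (@D1_id _ [set _; _]); last first.
    by rewrite !inE !(eq_sym x) negb_or !nx //; lia.
  congr (_ :|: _); case: j hj => [|[|j]] //= hj; rewrite D1_id // inE eq_sym nx //; lia.
have tR j : 1 < j <= m -> tri j :\ x = sl (be :\ x) (rv m p) (m.+1 - j).-1 :|:
    [set rv m p (m.+1 - j); rv m p (m.+1 - j).+1].
  move=> hj; rewrite tri_right // setDUl (@D1_id _ [set _; _]); last first.
    by rewrite !inE !(eq_sym x) negb_or !nx //; lia.
  congr (_ :|: _); rewrite /sl; case E: (_.-1) => [|k] //.
  by rewrite D1_id // inE eq_sym nx //; lia.
split; apply: dwin_sub => e; last first.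
  move=> [e0 [he|[[e1 he E0]|[e1 he E0]|[j hj E0]]] [ny ->]].
  - by left; left; exists e0 => //; rewrite !inE eqxx.
  - left; right; left; split.
      case: (posnP i.-1) => // i0; move: ny; rewrite inx // E0.
      by have -> : i = 1 by [lia]; rewrite !inE eqxx.
    exists (e1 :\ x); first by exists e1; rewrite // !inE eqxx.
    by rewrite E0 setU1_D1 // nx; lia.
  - right; left; split.
      case: (posnP (m - i)) => // i0; move: ny; rewrite inx // E0.
      by have -> : i = m by [lia]; rewrite !inE eqxx.
    exists (e1 :\ x); first by exists e1; rewrite // !inE eqxx.
    by rewrite E0 rv1 setU1_D1 // nx; lia.
  rewrite -/(tri j) in E0; move: ny; rewrite inx // E0 in_tri // !inE => ny.
  have [ji|ij] := ltnP j i.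
    left; right; right; exists j; last by rewrite tL //; lia.
    by lia.
  right; right; exists (m.+1 - j); last by rewrite tR //; lia.
  by lia.
move=> [[[e0 he [_ ->]]|[[r0 [e0 [e1 he [_ ->]] ->]]|[k hk ->]]]|[[r0 [e0 [e1 he [_ ->]] ->]]|[k hk ->]]].
- exists e0; first by left.
  by rewrite inx // pH.
- exists (p 1 |: e1); first by right; apply: Or31; exists e1.
  have -> : (p 1 |: e1) :\ x = p 1 |: e1 :\ x by rewrite setU1_D1 ?nx //; lia.
  by split=> //; rewrite !inE negb_or negb_and pA ?p_neq ?orbT ?andbT //; lia.
- exists (tri k); first by right; apply: Or33; exists k => //; lia.
  split; first by rewrite inx ?in_tri ?inE; lia.
  by rewrite tL //; lia.
- exists (p m |: e1); first by right; apply: Or32; exists e1.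
  have -> : (p m |: e1) :\ x = p m |: e1 :\ x by rewrite setU1_D1 ?nx //; lia.
  by rewrite rv1; split=> //; rewrite !inE negb_or negb_and pB ?p_neq ?orbT ?andbT //; lia.
exists (tri (m.+1 - k)); first by right; apply: Or33; exists (m.+1 - k) => //; lia.
split; first by rewrite inx ?in_tri ?inE; lia.
rewrite tR; last lia.
by have -> : m.+1 - (m.+1 - k) = k by lia.
Qed.
End Core.
End Moves.
Definition sep p k q r := forall i j, 0 < i <= k -> 0 < j <= r -> p i != q j.

Lemma sepC p k q r : sep p k q r -> sep q r p k.
Proof. by move=> h i j hi hj; rewrite eq_sym h. Qed.

Lemma avoids_GB p k q r B be : avoids k p B -> (forall j, 0 < j <= k -> p j \notin be) ->
  sep p k q r -> avoids k p (GB B be q r).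
Proof.
move=> aB ab s e j [[r0 [e1 he ->]]|[i hi ->]] hj.
  by rewrite !inE negb_or (aB _ _ he) ?s //; lia.
rewrite !inE !negb_or !s //; try lia.
by case: i hi => [|[|i]] // hi; rewrite /= ?inE ?ab ?s //; lia.
Qed.

Lemma avoids_GW p k q r A al : avoids k p A -> (forall j, 0 < j <= k -> p j \notin al) ->
  sep p k q r -> avoids k p (GW A al q r).
Proof.
move=> aA aa s; case: r s => [|r] s //.
move=> e j [he|->] hj; first exact: (avoids_GB aA aa s he).
by rewrite !inE negb_or s ?andbT //; [case: r s => [|r] s; rewrite /= ?inE ?aa ?s|]; lia.
Qed.

Lemma gad_hU p k H H' A al : gad p k H A al -> avoids k p H' -> gad p k (hU H H') A al.
Proof. by move=> [gi gH gA ga] h; split=> // e j [] he hj; [apply: gH|apply: h]. Qed.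

(** A [GB] without vertices has no edges, so an empty target path can always replace the source
    path. *)
Definition okz r r' := okb r r' \/ r' = 0.

Lemma GB_transferz n H A al p r p' r' :
  okz r r' -> gad p r H A al -> gad p' r' H A al -> cell A al ->
  dwin n.+1 (hU H (GB A al p r)) -> dwin n (hU H (GB A al p' r')).
Proof.
case=> [ok|->] g g' c; first exact: GB_transfer.
move=> /dwin_pred; apply: dwin_sub => e [|[[]|[j]]] //; last lia.
by left.
Qed.

Section TwoSided.
Variables (H A B : hyp T) (al be : {set T}) (p p' q q' : nat -> T) (k k' r r' : nat).
Hypotheses (cA : cell A al) (cB : cell B be).
Hypotheses (gp : gad p k H A al) (gp' : gad p' k' H A al)
  (gq : gad q r H B be) (gq' : gad q' r' H B be).
Hypotheses (gpB : gad p k H B be) (gpB' : gad p' k' H B be)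
  (gqA : gad q r H A al) (gqA' : gad q' r' H A al).
Hypotheses (spq : sep p k q r) (spq' : sep p' k' q' r')
  (sx : sep p' k' q r \/ sep p k q' r').

Let aGB u i v j X xi : gad u i H X xi -> sep u i v j -> avoids i u (GB X xi v j).
Proof. by case=> _ _ gX gx s; apply: avoids_GB. Qed.

Let aGW u i v j X xi : gad u i H X xi -> sep u i v j -> avoids i u (GW X xi v j).
Proof. by case=> _ _ gX gx s; apply: avoids_GW. Qed.

(** The two sides are exchanged one after the other. In between, a new piece on one side faces an
    old piece on the other; [sx] tells which order keeps them disjoint. *)
Lemma BB_transfer n : okz k k' -> okz r r' ->
  dwin n.+2 (hU (hU H (GB A al p k)) (GB B be q r)) ->
  dwin n (hU (hU H (GB A al p' k')) (GB B be q' r')).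
Proof.
have swap m (E F G : hyp T) : dwin m (hU (hU E F) G) -> dwin m (hU (hU E G) F).
  by apply: dwin_sub => e [[]|]; rewrite /hU; tauto.
move=> ok ok' h; case: sx => s.
  apply: (GB_transferz ok' (p := q)) => //; try by apply: gad_hU => //; apply: aGB => //; exact: sepC.
  apply: (swap _ _ _ _); apply: (GB_transferz ok (p := p)) => //;
    try by apply: gad_hU => //; apply: aGB => //; exact: sepC.
  exact: (swap _ _ _ _).
apply: (swap _ _ _ _); apply: (GB_transferz ok (p := p)) => //;
    try by apply: gad_hU => //; apply: aGB => //; exact: sepC.
apply: (swap _ _ _ _); apply: (GB_transferz ok' (p := q)) => //; try by apply: gad_hU => //; apply: aGB => //; exact: sepC.
Qed.

Lemma WB_transfer n : odd k = odd k' -> okz r r' ->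
  dwin (n + k).+2 (hU (hU H (GW A al p k)) (GB B be q r)) ->
  dwin n (hU (hU H (GW A al p' k')) (GB B be q' r')).
Proof.
have swap m (E F G : hyp T) : dwin m (hU (hU E F) G) -> dwin m (hU (hU E G) F).
  by apply: dwin_sub => e [[]|]; rewrite /hU; tauto.
move=> ok ok' h; case: sx => s.
  apply: (GB_transferz ok' (p := q)) => //; try by apply: gad_hU => //; apply: aGW => //; exact: sepC.
  apply: (swap _ _ _ _); apply: (GW_transfer ok (p := p));
    try by apply: gad_hU => //; apply: aGB => //; exact: sepC.
  by apply: (swap _ _ _ _); apply: dwin_pred.
apply: (swap _ _ _ _); apply: dwin_pred; apply: (GW_transfer ok (p := p));
    try by apply: gad_hU => //; apply: aGB => //; exact: sepC.
by apply: (swap _ _ _ _); apply: (GB_transferz ok' (p := q)) => //; try by apply: gad_hU => //; apply: aGW => //; exact: sepC.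
Qed.
End TwoSided.

(** The claimed end dominates [p 1]. Seen from [be], the whole path becomes pendant with a last
    vertex that need not be dominated. *)
Lemma GP_killed n M H A al B be p m x y :
  pctx M H A al B be p -> 1 < m <= M -> (forall j, 0 < j <= m -> p j != x) -> y \in al :\ x ->
  dwin n (res x y (hU H (GP A al B be p m))) <->
  dwin n (hU (res x y H) (GB (res x y B) (be :\ x) (rv m p) m)).
Proof.
move=> cx mM nx yal; have mM' : 0 < m <= M by lia.
have [gA gB [_ sA] cB dab] := cx; have [_ _ _ ga] := gA.
have [yx ya] : y != x /\ y \in al by move: yal; rewrite !inE => /andP[].
have ny j : 0 < j <= m -> p j != y.
  by move=> hj; apply: contraTneq ya => <-; apply: ga; lia.
have yb : y \notin be by rewrite (disjointFr dab ya).
have tR j : 1 < j <= m -> (slP al be p m j.-1 :|: [set p j] :|: slP al be p m j.+1) :\ x =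
    sl (be :\ x) (rv m p) (m.+1 - j).-1 :|: [set rv m p (m.+1 - j); rv m p (m.+1 - j).+1].
  move=> hj; rewrite (tri_right al be p mM') // setDUl (@setD1_notin _ _ [set _; _]); last first.
    by rewrite !inE !(eq_sym x) negb_or !nx //; lia.
  congr (_ :|: _); rewrite /sl; case E: (_.-1) => [|k] //.
  by rewrite setD1_notin // inE eq_sym nx //; lia.
split; apply: dwin_sub => e; last first.
  move=> [e0 [he|[[e1 he E0]|[e1 he E0]|[j hj E0]]] [nye ->]].
  - by left; exists e0.
  - by move: nye; rewrite E0 !inE yx (subsetP (sA _ he)) ?orbT.
  - right; left; split; first lia.
    exists (e1 :\ x); last by rewrite E0 (rv1 p mM') setU1_D1 // nx; lia.
    exists e1 => //; split=> //; apply: contra nye; rewrite E0 !inE => /andP[-> ->].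
    by rewrite orbT.
  right; right; exists (m.+1 - j).
    case: j hj E0 => [|[|j]] // hj E0; last lia.
    by move: nye; rewrite E0 !inE yx ya.
  rewrite E0 tR //.
  case: j hj E0 => [|[|j]] // hj E0.
  by move: nye; rewrite E0 !inE yx ya.
move=> [[e0 he [ye ->]]|[[r0 [e0 [e1 he [ye ->]] ->]]|[k hk ->]]].
- by exists e0 => //; left.
- exists (p m |: e1); first by right; apply: Or32; exists e1.
  rewrite (rv1 p mM') setU1_D1 ?nx //; last lia.
  by rewrite in_setU1 negb_or ye eq_sym ny //; lia.
exists (slP al be p m (m.+1 - k).-1 :|: [set p (m.+1 - k)] :|: slP al be p m (m.+1 - k).+1).
  by right; apply: Or33; exists (m.+1 - k) => //; lia.
rewrite tR; last lia.
have -> : m.+1 - (m.+1 - k) = k by lia.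
split=> //; rewrite !inE !negb_or !(eq_sym y) /rv !ny; try lia.
rewrite andbT; case: k hk => [|[|k]] // hk; first by rewrite /= !inE negb_and yb orbT.
by rewrite /= inE eq_sym ny //; lia.
Qed.

(** Supplies the disjointness needed halfway through a two-sided exchange, whatever the places where
    the two paths are cut. *)
Definition compat p m p' m' := forall k r k' r', k + r <= m -> k' + r' <= m' ->
  sep p' k' (rv m p) r \/ sep p k (rv m' p') r'.

Section Transfer.
Variables (H A : hyp T) (al : {set T}) (B : hyp T) (be : {set T}).

Lemma gad_all p m : pctx m H A al B be p -> forall k r, k <= m -> r <= m ->
  [/\ gad p k H A al, gad p k H B be, gad (rv m p) r H A al & gad (rv m p) r H B be].
Proof.
move=> cx k r km rm; have [gA gB _ _ _] := cx.
have [gB' gA' _ _ _] := pctx_rev (leqnn m) cx.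
by split; [exact: gad_leq gA|exact: gad_leq gB|exact: gad_leq gA'|exact: gad_leq gB'].
Qed.

Lemma sep_self p m k r : pctx m H A al B be p -> k + r <= m -> sep p k (rv m p) r.
Proof.
case=> gA _ _ _ _ kr i j hi hj; rewrite /rv (gad_neq gA); lia.
Qed.

Lemma GP_Staller_near n m p m' p' i j :
  pctx m H A al B be p -> pctx m' H A al B be p' -> compat p m p' m' -> 1 < m' ->
  odd i = odd j -> 0 < i <= m' -> 0 < j -> j.+3 <= m -> (i = m' -> be != set0) ->
  dwin (n + m).+2 (res (p j) (p j.+1) (hU H (GP A al B be p m))) ->
  exists y, dwin n (res (p' i) y (hU H (GP A al B be p' m'))).
Proof.
move=> cx cx' co m'1 ij hi j0 jm nb hD.
have mm : 0 < m <= m by lia. have mm' : 0 < m' <= m' by lia.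
have hj : 0 < j < m by lia.
move/(GP_Staller_reply cx mm _ hj): hD => hD.
have tr r' : i.-1 + r' <= m' -> (r' <= m' - i.+1) -> 
   dwin n (hU (hU H (GW A al p' i.-1)) (GB B be (rv m' p') r')).
  move=> kr' hr'; have k1 : j.-1 <= m by lia. have r1 : m - j.+1 <= m by lia.
  have k2 : i.-1 <= m' by lia. have r2 : r' <= m' by lia.
  have [g1 g2 g3 g4] := gad_all cx k1 r1. have [g5 g6 g7 g8] := gad_all cx' k2 r2.
  have [_ _ cA cB _] := cx.
  apply: (@WB_transfer H A B al be p p' (rv m p) (rv m' p') j.-1 i.-1 (m - j.+1) r') => //.
  - by apply: sep_self => //; lia.
  - by apply: sep_self => //; lia.
  - by apply: co => //; lia.
  - by move: ij; case: (i) hi => // i1 _; case: (j) j0 => //= j1 _; lia.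
  - by rewrite /okz /okb; lia.
  by apply: dwin_leq hD; lia.
case: (ltnP i m') => im.
  exists (p' i.+1); apply/(GP_Staller_reply cx' mm'); first lia.
  by apply: tr; lia.
have {im}Ei : i = m' by lia.
have [gA gB [_ sA] [b1 sB] dab] := cx'.
(* The vertex after [p' m'] is the end itself, so Dominator takes that; nothing remains on the
   right. *)
have [b Eb] : exists b, be = [set b] by case: b1 nb => [->|//]; rewrite eqxx => h; have := h Ei.
have pb k : 0 < k <= m' -> p' k != b.
  by case: gB => _ _ _ gb hk; have := gb _ hk; rewrite Eb inE.
exists b; have h0 : i.-1 + 0 <= m' by lia.
apply: dwin_sub (tr 0 h0 isT); rewrite Ei.
move=> e [e0 [he|[[e1 he E0]|[e1 he E0]|[k hk E0]]] [ny ->]].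
- by left; left; rewrite setD1_notin // (pH cx' mm' he).
- left; right; rewrite E0.
  have -> : m'.-1 = m'.-2.+1 by lia.
  rewrite setU1_D1 ?(p_neq cx' mm'); try lia.
  rewrite setD1_notin ?(pA cx' mm' he) //.
  by left; left; split=> //; exists e1.
- move: ny; rewrite E0 !inE (subsetP (sB _ he)) ?Eb ?inE ?eqxx ?orbT //.
  by rewrite eq_sym pb.
left; right; have -> : m'.-1 = m'.-2.+1 by lia.
case: (eqVneq k m') => [Ek|km].
  move: ny; rewrite E0 Ek {2}/slP eqxx !inE Eb inE eqxx orbT andbT.
  by rewrite eq_sym pb.
have ht : 0 < k < m' by lia.
rewrite E0 (tri_left al be p' mm' ht).
case: (eqVneq k.+1 m') => [Ek|km'].
  right; have [-> [Ek1 hk']] : m'.-2 = k.-1 /\ k.-1.+1 = k /\ k.+1 <= m' by lia.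
  rewrite Ek1; apply/setP=> z; rewrite -Ek in gA *; rewrite !inE.
  case: (eqVneq z (p' k.+1)) => [->|_]; last by rewrite /= orbF.
  by rewrite (gad_sl gA) ?(gad_neq gA); lia.
have ht' : 0 < m' <= m' by lia.
rewrite (D1_tri gA ht' ht) ?inE; last lia.
by left; right; exists k => //; lia.
Qed.

(* Here the neighbour of [p 1] outside the path is claimed by Staller, so her
   move on [p 1] forces Dominator to answer on [p 2]. *)
Lemma GP_Staller_end n m p m' p' :
  pctx m H A al B be p -> pctx m' H A al B be p' -> 3 < m -> 2 < m' -> al = set0 ->
  dwin n.+3 (hU H (GP A al B be p m)) ->
  exists y, dwin n (res (p' 1) y (hU H (GP A al B be p' m'))).
Proof.
move=> cx cx' m3 m3' al0 hD.
have mm : 0 < m <= m by lia. have mm' : 0 < m' <= m' by lia.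
have h1 : 0 < 1 < m by lia. have h1' : 0 < 1 < m' by lia.
exists (p' 2); apply/(GP_Staller_reply cx' mm' _ h1').
have h2 : dwin n.+2 (res (p 1) (p 2) (hU H (GP A al B be p m))).
  apply: (dwin_forced hD (e := slP al be p m 0 :|: [set p 1] :|: slP al be p m 2)).
    by right; apply: Or33; exists 1; rewrite //; lia.
  rewrite (tri_left al be p mm h1) /= al0 set0U setU1K // inE (p_neq cx mm) //; lia.
move/(GP_Staller_reply cx mm _ h1): h2 => h2.
have g0 : forall k, k <= 0 -> 0 < k -> False by lia.
have k1 : m - 2 <= m by lia. have k2 : m' - 2 <= m' by lia.
have [gA gB gA1 gB1] := gad_all cx (leqnn m) k1.
have [gA' gB' gA1' gB1'] := gad_all cx' (leqnn m') k2.
have [_ _ cA cB _] := cx.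
apply: (GB_transferz (p := rv m p) (r := m - 2)) => //.
- by rewrite /okz /okb; lia.
- by apply: gad_hU => //; case: gA1.
- by apply: gad_hU => //; case: gA1'.
exact: dwin_pred h2.
Qed.
End Transfer.
End Path.

(** * Exchanging paths of equal parity between the same ends *)

Section PathTransfer.
Variable T : finType.
Implicit Types (e al be : {set T}) (x y : T) (n i j k m : nat) (p : nat -> T).
Implicit Types E H A B : hyp T.

Lemma pctx_leq m M H A al B be p : m <= M -> pctx M H A al B be p -> pctx m H A al B be p.
Proof. by move=> mM [gA gB cA cB d]; split=> //; [apply: gad_leq gA|apply: gad_leq gB]. Qed.

Lemma compat_self p m m' : inj_upto (maxn m m') p -> compat p m p m'.
Proof.
move=> ip k r k' r' h h'; case: (leqP k' (m - r)) => hk; [left|right] => i j hi hj.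
  by apply/eqP => /ip E; have := E; rewrite /rv; lia.
by apply/eqP => /ip E; have := E; rewrite /rv; lia.
Qed.

Lemma compat_rev p m m' : inj_upto (maxn m m') p -> compat (rv m p) m (rv m' p) m'.
Proof.
move=> ip k r k' r' h h'; case: (leqP r (m' - k')) => hk; [left|right] => i j hi hj.
  by rewrite /rv; apply/eqP => /ip E; have := E; lia.
by rewrite /rv; apply/eqP => /ip E; have := E; lia.
Qed.

Lemma GP_swap n x y H A al B be p m : 0 < m ->
  dwin n (res x y (hU H (GP A al B be p m))) <->
  dwin n (res x y (hU H (GP B be A al (rv m p) m))).
Proof.
move=> m0; split; apply: dwin_sub => e [e0 [he|he] h]; exists e0 => //.
- by left.
- by right; apply: (GP_rev A al B be p e0 m0).2.
- by left.
by right; apply: (GP_rev A al B be p e0 m0).1.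
Qed.

Lemma GP_swap0 n H A al B be p m : 0 < m ->
  dwin n (hU H (GP A al B be p m)) -> dwin n (hU H (GP B be A al (rv m p) m)).
Proof.
move=> m0; apply: dwin_sub => e [he|he]; first by left.
by right; apply: (GP_rev A al B be p e m0).2.
Qed.

(** The induction goes on while both paths are intact. Once a move breaks them or an end is taken,
    the pieces are compared directly, and the [m.+2] spare rounds pay for this single comparison. *)
Lemma GP_transfer n m m' p H A al B be :
  pctx (maxn m m') H A al B be p -> 7 < m -> 7 < m' -> odd m = odd m' ->
  dwin (n + m.+2) (hU H (GP A al B be p m)) -> dwin n (hU H (GP A al B be p m')).
Proof.
elim: n H A al B be => [|n IH] H A al B be cx m7 m7' mm hD.
  have hH : dwin 0 H by apply: (@dwin_leq _ 0 m.+2) => //; apply: dwin_sub hD => e; left.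
  split=> // -[/(dwin_n0 hH)//|[[e he E]|[e he E]|[j hj E]]].
  - by have := in_set0 (p 1); rewrite E !inE eqxx.
  - by have := in_set0 (p m'); rewrite E !inE eqxx.
  by have := in_set0 (p j); rewrite E !inE eqxx ?orbT.
have hH : dwin n.+1 H by apply: (@dwin_leq _ _ (n.+1 + m.+2)); [lia|apply: dwin_sub hD => e; left].
have [lm lm'] : m <= maxn m m' /\ m' <= maxn m m' by lia.
have [cm cm'] := (pctx_leq lm cx, pctx_leq lm' cx).
have [rm rm'] := (pctx_rev lm cx, pctx_rev lm' cx).
have [m0 m0'] : 0 < m <= m /\ 0 < m' <= m' by lia.
have [gA gB cA cB dab] := cx; have [gi gH gAA ga] := gA; have [_ _ gBB gb] := gB.
split.
  move=> [/(dwin_n0 hH)//|[[e he E]|[e he E]|[j hj E]]].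
  - by have := in_set0 (p 1); rewrite E !inE eqxx.
  - by have := in_set0 (p m'); rewrite E !inE eqxx.
  by have := in_set0 (p j); rewrite E !inE eqxx ?orbT.
move=> x; case: (upto_dec p m' x) => [[i hi <-]|nx'].
  (* Next to an end owned by Staller there is no vertex on the outer side to answer with, so these
     two moves are treated apart. *)
  case: (boolP ((al == set0) && (i == 1))) => [/andP[/eqP al0 /eqP ->]|ni1].
    by apply: (GP_Staller_end cm cm') => //; try lia; apply: dwin_leq hD; lia.
  case: (boolP ((be == set0) && (i == m'))) => [/andP[/eqP be0 /eqP ->]|nim].
    have [m1 m1'] : 0 < m /\ 0 < m' by lia.
    have [m3 m3'] : 3 < m /\ 2 < m' by lia.
    have n3 : n.+3 <= n.+1 + m.+2 by lia.
    have [y hy] := GP_Staller_end rm rm' m3 m3' be0 (GP_swap0 m1 (dwin_leq n3 hD)).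
    exists y; apply/(GP_swap _ _ _ _ _ _ _ _ _ m1').
    by move: hy; rewrite (rv1 _ m0').
  (* The source move has the parity of [i]. It needs [j.+3 <= m] for an answer on the right and
     [3 < j] for the mirrored condition on the left; with both parities this is the origin of the
     bound [7 < m]. *)
  pose j := if odd i then 5 else 4.
  have [j1 j2 oj] : [/\ 3 < j, j < 6 & odd i = odd j] by rewrite /j; case: (odd i).
  have E3 k : 1 < k < m -> slP al be p m k.-1 :|: [set p k] :|: slP al be p m k.+1
      = [set p k.-1; p k; p k.+1].
    by move=> hk; rewrite /slP; case: k hk => [|[|k]] //= hk; do 2?case: eqP; try lia.
  have hE k : 1 < k < m -> hU H (GP A al B be p m) [set p k.-1; p k; p k.+1].
    by move=> hk; right; apply: Or33; exists k; rewrite ?E3 //; lia.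
  have pn := p_neq cm m0.
  have d1 : dwin (n + m).+3 (hU H (GP A al B be p m)) by apply: dwin_leq hD; lia.
  have e1 : hU H (GP A al B be p m) [set p j.-1.-1; p j.-1; p j.-1.+1] by apply: hE; lia.
  have e2 : hU H (GP A al B be p m) [set p j.-1; p j; p j.+1] by apply: hE; lia.
  have e3 : hU H (GP A al B be p m) [set p j.+1.-1; p j.+1; p j.+1.+1] by apply: hE; lia.
  have q1 : [set p j.-1.-1; p j.-1; p j.-1.+1] :\ p j = [set p j.-1.-1; p j.-1].
    have -> : j.-1.+1 = j by lia.
    apply/setP=> z; rewrite !inE; case: (eqVneq z (p j)) => [->|_]; last by rewrite /= orbF.
    by rewrite !pn; lia.
  have q2 : [set p j.-1; p j; p j.+1] :\ p j = [set p j.-1; p j.+1].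
    apply/setP=> z; rewrite !inE; case: (eqVneq z (p j)) => [->|_]; last by rewrite /= orbF.
    by rewrite !pn; lia.
  have q3 : [set p j.+1.-1; p j.+1; p j.+1.+1] :\ p j = [set p j.+1; p j.+1.+1].
    apply/setP=> z; rewrite !inE; case: (eqVneq z (p j)) => [->|_] //=.
    by rewrite !pn; lia.
  have u : uniq [:: p j.-1.-1; p j.-1; p j.+1; p j.+1.+1] by rewrite /= !inE !pn; lia.
  case: (dwin_forced4 d1 e1 e2 e3 q1 q2 q3 u).
  (* The answer on the left is the previous situation on the reversed paths. Mirrored positions
     still agree in parity because [m] and [m'] do. *)
  - have Ej : rv m p (m.+1 - j) = p j by congr p; lia.
    have Ej1 : rv m p (m.+1 - j).+1 = p j.-1 by congr p; lia.
    have Ei : rv m' p (m'.+1 - i) = p i by congr p; lia.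
    have m1 : 0 < m by lia. have m1' : 0 < m' by lia.
    rewrite -Ej -Ej1 => /(GP_swap _ _ _ _ _ _ _ _ _ m1) hR.
    have oj' : odd (m'.+1 - i) = odd (m.+1 - j) by rewrite !oddB; [rewrite /= mm oj|lia|lia].
    have h1 : 0 < m'.+1 - i <= m' by lia. have h2 : 0 < m.+1 - j by lia.
    have h3 : (m.+1 - j).+3 <= m by lia.
    have h4 : m'.+1 - i = m' -> al != set0.
      move=> Eim; have Ei1 : i = 1 by lia.
      by move: ni1; rewrite Ei1 eqxx andbT.
    have m2' : 1 < m' by lia.
    have [y hy] := GP_Staller_near rm rm' (compat_rev gi) m2' oj' h1 h2 h3 h4 hR.
    by exists y; apply/(GP_swap _ _ _ _ _ _ _ _ _ m1'); move: hy; rewrite Ei.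
  have [m2' [j0 j3]] : 1 < m' /\ 0 < j /\ j.+3 <= m by lia.
  have h4 : i = m' -> be != set0 by move=> Eim; move: nim; rewrite Eim eqxx andbT.
  by move=> hR; apply: (GP_Staller_near cm cm' (compat_self gi) m2' oj hi j0 j3 h4 hR).
case: (upto_dec p m x) => [[i hi Ex]|nx].
  exists x; apply: dwin_sub (IH _ _ _ _ _ cx m7 m7' mm (dwin_pred hD)).
  have nin e : hU H (GP A al B be p m') e -> x \notin e.
    have h1 : 0 < i <= maxn m m' by lia.
    move=> [he|[[e1 he ->]|[e1 he ->]|[j hj ->]]].
    - by rewrite -Ex gH.
    - by rewrite in_setU1 negb_or [x == _]eq_sym nx' /=; [rewrite -Ex gAA|lia].
    - by rewrite in_setU1 negb_or [x == _]eq_sym nx' /=; [rewrite -Ex gBB|lia].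
    have slx k : k <= m'.+1 -> x \notin slP al be p m' k.
      rewrite /slP; case: k => [|k] hk; first by rewrite -Ex ga.
      by case: eqP => h; [rewrite -Ex gb|rewrite inE eq_sym nx' //; lia].
    by rewrite !in_setU in_set1 !negb_or !slx ?[x == _]eq_sym ?nx' //; lia.
  by move=> e [e0 he [_ ->]]; rewrite setD1_notin ?nin.
have hD1 : dwin (n + m.+2).+1 (hU H (GP A al B be p m)) := hD.
have [y hy] := dwin_step hD1 x.
have cxr y1 y2 y3 := pctx_res x y1 y2 y3 cx.
case: (upto_dec p m y) => [[i hi Ey]|ny].
  rewrite -Ey in hy; move/(GP_Dominator_move cm m0 nx _ hi): hy => hy.
  (* A side with at most one vertex is copied exactly. If both sides have at least two, position 2
     leaves a nonempty piece on each side, which suffices for [okb]. *)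
  pose i' := if i <= 2 then i else if m - i <= 1 then m' - (m - i) else 2.
  have hi' : 0 < i' <= m' by rewrite /i'; do 2?case: ifP; lia.
  exists (p i'); apply/(GP_Dominator_move cm' m0' nx' _ hi').
  have [_ _ cA' cB' _] := cxr x x x.
  have cmr := pctx_leq lm (cxr x x x). have cmr' := pctx_leq lm' (cxr x x x).
  have k1 : i.-1 <= m by lia. have r1 : m - i <= m by lia.
  have k2 : i'.-1 <= m' by lia. have r2 : m' - i' <= m' by lia.
  have [g1 g2 g3 g4] := gad_all cmr k1 r1. have [g5 g6 g7 g8] := gad_all cmr' k2 r2.
  apply: (@BB_transfer T _ _ _ _ _ p p (rv m p) (rv m' p) i.-1 i'.-1 (m - i) (m' - i')) => //.
  - by apply: (sep_self cmr); lia.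
  - by apply: (sep_self cmr'); lia.
  - by apply: compat_self => //; lia.
  - by rewrite /okz /okb /i'; do 2?case: ifP; lia.
  - by rewrite /okz /okb /i'; do 2?case: ifP; lia.
  by apply: dwin_leq hy; lia.
have m2 : 1 < m <= m by lia. have m2' : 1 < m' <= m' by lia.
have km : m <= m by []. have km' : m' <= m' by [].
have [cmy cmy'] := (pctx_leq lm (cxr y y y), pctx_leq lm' (cxr y y y)).
have okm : okb m m' by left; lia.
have [_ _ cAy cBy _] := cmy.
case: (boolP (y \in al :\ x)) => yal.
  exists y; apply/(GP_killed _ cm' m2' nx' yal).
  move/(GP_killed _ cm m2 nx yal): hy => hy.
  have [_ _ _ g1] := gad_all cmy km km. have [_ _ _ g2] := gad_all cmy' km' km'.
  by apply: (GB_transfer okm g1 g2 cBy); apply: dwin_leq hy; lia.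
case: (boolP (y \in be :\ x)) => ybe.
  have nxr k : 0 < k <= m -> rv m p k != x by move=> hk; apply: nx; lia.
  have nxr' k : 0 < k <= m' -> rv m' p k != x by move=> hk; apply: nx'; lia.
  have [m1 m1'] : 0 < m /\ 0 < m' by lia.
  exists y; apply/(GP_swap _ _ _ _ _ _ _ _ _ m1')/(GP_killed _ rm' m2' nxr' ybe).
  move/(GP_swap _ _ _ _ _ _ _ _ _ m1)/(GP_killed _ rm m2 nxr ybe): hy => hy.
  have rmy := pctx_rev lm (cxr y y y). have rmy' := pctx_rev lm' (cxr y y y).
  have [_ _ _ g1] := gad_all rmy km km. have [_ _ _ g2] := gad_all rmy' km' km'.
  by apply: (GB_transfer okm g1 g2 cAy); apply: dwin_leq hy; lia.
move/(GP_core H A B m0 nx _ ny yal ybe): hy => hy.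
case: (upto_dec p m' y) => [[j hj Ey]|ny'].
  have xx (e : {set T}) : x \notin e :\ x by rewrite !inE eqxx.
  exists x; apply/(GP_core H A B m0' nx' _ nx' (xx _) (xx _)).
  apply: IH => //.
  have resE (E : hyp T) e : avoids (maxn m m') p E -> res x x E e -> res x y E e.
    move=> aE [e0 he [_ ->]]; exists e0 => //; split=> //.
    by rewrite -Ey !inE negb_and (aE _ _ he) ?orbT //; lia.
  apply: dwin_sub hy => e [he|[[e1 he E0]|[e1 he E0]|h]].
  - by left; apply: resE.
  - by right; apply: Or31; exists e1 => //; apply: resE.
  - by right; apply: Or32; exists e1 => //; apply: resE.
  by right; apply: Or33.
exists y; apply/(GP_core H A B m0' nx' _ ny' yal ybe).
by apply: IH.
Qed.
End PathTransfer.

(** * The domination game as a hypergraph game *)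

Section Domination.
Variables (n : nat) (G : sgraph n).
Implicit Types (D S X Y : {set 'I_n}) (x y z v : 'I_n) (h : seq 'I_n).

Definition cnb x : {set 'I_n} := x |: [set y | G x y].

Lemma dominatingP X : reflect (forall x, ~~ [disjoint cnb x & X]) (dominating G X).
Proof.
apply: (iffP forallP) => h x; have := h x.
  rewrite -setI_eq0 => hx; apply/set0Pn; case/orP: hx => [xX|/existsP[y /andP[yX xy]]].
    by exists x; rewrite !inE eqxx.
  by exists y; rewrite !inE xy yX orbT.
rewrite -setI_eq0 => /set0Pn[y]; rewrite !inE => /andP[/predU1P[->->//|xy yX]].
by apply/orP; right; apply/existsP; exists y; rewrite yX.
Qed.

Lemma dominatingS X Y : X \subset Y -> dominating G X -> dominating G Y.
Proof.
move=> s /dominatingP h; apply/dominatingP => x; apply: contra (h x).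
by rewrite disjoint_sym => d; rewrite disjoint_sym; apply: disjointWl s d.
Qed.

(** An edge is what Staller still needs of a closed neighbourhood that Dominator has not met. An
    empty edge belongs to a vertex that can no longer be dominated. *)
Definition dom_hyp D S : hyp 'I_n :=
  fun e => exists2 x, [disjoint cnb x & D] & e = cnb x :\: S.

Lemma dom_hyp_step D S x y e : x \notin D -> y \notin S -> y != x ->
  res x y (dom_hyp D S) e -> dom_hyp (y |: D) (x |: S) e.
Proof.
move=> xD yS yx [e0 [z dz ->] [ny ->]]; exists z; last first.
  by apply/setP=> w; rewrite !inE negb_or -andbA.
rewrite -setI_eq0 setIUr setU_eq0 !setI_eq0 dz andbT disjoint_sym disjoints1.
by apply: contra ny => yz; rewrite in_setD1 yx in_setD yS.
Qed.

Lemma dom_hyp_stepV D S x y e : dom_hyp (y |: D) (x |: S) e -> res x y (dom_hyp D S) e.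
Proof.
move=> [z dz ->]; exists (cnb z :\: S).
  by exists z => //; apply: disjointWr dz; apply: subsetUr.
split; last by apply/setP=> w; rewrite !inE negb_or -andbA.
have : y \notin cnb z by rewrite (disjointFl dz) // !inE eqxx.
by apply: contra => /setD1P[_ /setDP[]].
Qed.

Lemma dom_hyp_pass D S x y e : (y == x) || (y \in D :|: S) ->
  dom_hyp D (x |: S) e -> res x y (dom_hyp D S) e.
Proof.
move=> hy [z dz ->]; exists (cnb z :\: S); first by exists z.
split; last by apply/setP=> w; rewrite !inE negb_or -andbA.
rewrite in_setD1 in_setD; case/orP: hy => [->//|].
by rewrite inE => /orP[yD|->]; rewrite ?andbF // (disjointFl dz yD) !andbF.
Qed.

Lemma dom_hyp_junk D S x e : x \in D :|: S -> res x x (dom_hyp D S) e -> dom_hyp D S e.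
Proof.
move=> hx [e0 [z dz ->] [_ ->]]; exists z => //; rewrite setD1_notin //.
by rewrite in_setD; move: hx; rewrite inE => /orP[xD|->]; rewrite ?andbF // (disjointFl dz xD) andbF.
Qed.

Lemma dominatingPn D : ~~ dominating G D -> exists z, [disjoint cnb z & D].
Proof.
move=> nD; case: (pickP (fun z => [disjoint cnb z & D])) => [z dz|h]; first by exists z.
by case/dominatingP: nD => z; rewrite h.
Qed.

Lemma dwin_dominating k D (E : hyp 'I_n) :
  (forall e, E e -> exists z, [disjoint cnb z & D]) -> dominating G D -> dwin k E.
Proof.
move=> sE /dominatingP dD; have {sE} : forall e, ~ E e.
  by move=> e /sE[z dz]; have := dD z; rewrite dz.
by elim: k E => [|k IH] E nE; split=> // x; exists x; apply: IH => e [e0 /nE].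
Qed.

(** * Strategies and plays versus rounds of the hypergraph game *)

Section Strategy.
Variables D S : {set 'I_n}.
Hypothesis dDS : [disjoint D & S].

Definition staller_moves h : {set 'I_n} := [set x in h | ~~ odd (index x h)].

Let Dh h := D :|: dominator_moves h.
Let Sh h := S :|: staller_moves h.

Lemma moves_nil : dominator_moves [::] = set0 :> {set 'I_n} /\ staller_moves [::] = set0.
Proof. by split; apply/setP=> z; rewrite !inE. Qed.

Lemma dominator_moves_rcons h x : x \notin h ->
  dominator_moves (rcons h x) = if odd (size h) then x |: dominator_moves h else dominator_moves h.
Proof.
move=> xh; case: (boolP (odd (size h))) => oh; apply/setP=> z;
  rewrite !inE mem_rcons inE -cats1 index_cat; case: (eqVneq z x) => [->|zx];
  rewrite ?(negPf xh) /= ?eqxx ?addn0 ?oh ?(negPf oh) //; by case: ifP.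
Qed.

Lemma staller_moves_rcons h x : x \notin h ->
  staller_moves (rcons h x) = if odd (size h) then staller_moves h else x |: staller_moves h.
Proof.
move=> xh; case: (boolP (odd (size h))) => oh; apply/setP=> z;
  rewrite !inE mem_rcons inE -cats1 index_cat; case: (eqVneq z x) => [->|zx];
  rewrite ?(negPf xh) /= ?eqxx ?addn0 ?oh ?(negPf oh) //; by case: ifP.
Qed.

Lemma mem_moves h x : (x \in dominator_moves h :|: staller_moves h) = (x \in h).
Proof. by rewrite !inE; case: (x \in h) => //=; case: odd. Qed.

Lemma moves_claimed h x : (x \in Dh h :|: Sh h) = (x \in D :|: S) || (x \in h).
Proof. by rewrite -(mem_moves h x) !in_setU orbACA. Qed.

Lemma history_rcons h x : history D S (rcons h x) =
  [&& history D S h, x \notin h & x \in unclaimed D S].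
Proof. by rewrite /history rcons_uniq all_rcons andbACA andbC. Qed.

Lemma moves_disjoint h : history D S h -> [disjoint Dh h & Sh h].
Proof.
move=> /andP[_ /allP hh]; rewrite -setI_eq0; apply/eqP/setP=> x.
rewrite in_set0 in_setI !in_setU; apply/negbTE/negP=> /andP[].
have hx : x \in h -> (x \notin D) && (x \notin S) by move=> /hh; rewrite !inE negb_or.
case/orP=> [xD|]; last rewrite inE => /andP[xh xo].
  by case/orP=> [|/[!inE] /andP[/hx]]; rewrite ?(disjointFr dDS xD) ?xD.
by case/orP=> [xS|/[!inE] /andP[_]]; [case/andP: (hx xh); rewrite xS | rewrite xo].
Qed.
Lemma history_size h : history D S h -> size h <= #|unclaimed D S|.
Proof.
move=> /andP[/card_uniqP <- /allP hh].
by apply: subset_leq_card; apply/subsetP=> x /hh.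
Qed.

Lemma history_avail h : size h < #|unclaimed D S| ->
  exists2 x, x \in unclaimed D S & x \notin h.
Proof.
move=> sz; have /subsetPn[x xu xh] : ~~ (unclaimed D S \subset h).
  by apply: contraL sz => /subset_leq_card s; rewrite -leqNgt (leq_trans s) // card_size.
by exists x.
Qed.

Lemma follows_rcons (sigma : strategy n) h x : follows sigma h ->
  (odd (size h) -> sigma h = Some x) -> follows sigma (rcons h x).
Proof.
move=> fh hx h1 y h2; case/lastP: h2 => [|h2 z].
  by rewrite cats1 => /rcons_inj[<- <-].
by rewrite -rcons_cons -rcons_cat => /rcons_inj[E _]; apply: fh E.
Qed.

Lemma follows_pre (sigma : strategy n) h x : follows sigma (rcons h x) -> follows sigma h.
Proof. by move=> f h1 y h2 E; apply: (f _ _ (rcons h2 x)); rewrite E rcons_cat. Qed.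

Lemma moves_subset_rcons h x : x \notin h ->
  Dh h \subset Dh (rcons h x) /\ Sh h \subset Sh (rcons h x).
Proof.
move=> xh; rewrite /Dh /Sh dominator_moves_rcons // staller_moves_rcons //.
by case: ifP => _; split; rewrite ?subxx ?setUS ?subsetUr.
Qed.

Lemma follows_extend (sigma : strategy n) h : legal_strategy D S sigma ->
  history D S h -> follows sigma h ->
  exists h', [/\ complete_play D S h', follows sigma h', Dh h \subset Dh h' & Sh h \subset Sh h'].
Proof.
move=> ls; move: {2}(#|unclaimed D S| - size h) (leqnn (#|unclaimed D S| - size h)) => m.
elim: m h => [|m IH] h sz hh fh; case: (ltnP (size h) #|unclaimed D S|) => lt.
- by move: sz lt; rewrite leqn0 subn_eq0; lia.
- by exists h; split=> //; rewrite /complete_play hh eqn_leq lt history_size.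
- have [x hx fx] : exists2 x, history D S (rcons h x) & (odd (size h) -> sigma h = Some x).
    case: (boolP (odd (size h))) => [o|_].
      by have [x fx hx] := ls _ hh o lt; exists x.
    have [x xu xh] := history_avail lt; exists x => //.
    by rewrite history_rcons hh xh xu.
  have xh : x \notin h by move: hx; rewrite history_rcons => /and3P[].
  have [|h' [c f' d s]] := IH _ _ hx (follows_rcons fh fx).
    by rewrite size_rcons; move: sz lt; lia.
  have [d0 s0] := moves_subset_rcons xh.
  by exists h'; split=> //; [apply: subset_trans d | apply: subset_trans s].
- by exists h; split=> //; rewrite /complete_play hh eqn_leq lt history_size.
Qed.

Lemma complete_play_dominating (sigma : strategy n) h : winning_strategy G D S sigma ->
  complete_play D S h -> follows sigma h -> dominating G (Dh h).
Proof. by move=> [_ w] c f; have [X s dX] := w _ c f; apply: dominatingS dX. Qed.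

(** If an edge were filled, completing the play by [follows_extend] would leave its vertex
    undominated at the end. A move of Staller on a claimed vertex is answered by a wasted move. *)
Lemma winning_dwin (sigma : strategy n) : winning_strategy G D S sigma ->
  forall k h, history D S h -> ~~ odd (size h) -> follows sigma h ->
  dwin k (dom_hyp (Dh h) (Sh h)).
Proof.
move=> ws; have [ls _] := ws; move=> k; have ne h : history D S h -> follows sigma h ->
    ~ dom_hyp (Dh h) (Sh h) set0.
  move=> hh fh [z dz /esym/eqP]; rewrite setD_eq0 => zS.
  have [h' [c f' d s]] := follows_extend ls hh fh.
  have /dominatingP/(_ z)/negP[] := complete_play_dominating ws c f'.
  have /andP[hh' _] := c; rewrite disjoint_sym.
  by apply: disjointWr (moves_disjoint hh'); apply: subset_trans s.
elim: k => [|k IH] h hh eh fh; split; try exact: ne; try by [].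
move=> x; case: (boolP (x \in Dh h :|: Sh h)) => [xc|xc].
  by exists x; apply: dwin_sub (IH _ hh eh fh) => e; apply: dom_hyp_junk.
have := xc; rewrite moves_claimed negb_or => /andP[xu xh].
have hx : history D S (rcons h x) by rewrite history_rcons hh xh inE.
have fx : follows sigma (rcons h x) by apply: follows_rcons => //; rewrite (negPf eh).
have [xD xS] : x \notin Dh h /\ x \notin Sh h by move: xc; rewrite inE negb_or => /andP[].
have Dx : Dh (rcons h x) = Dh h by rewrite /Dh dominator_moves_rcons // (negPf eh).
have Sx : Sh (rcons h x) = x |: Sh h.
  by rewrite /Sh staller_moves_rcons // (negPf eh) setUCA.
(* If Staller has just taken the last vertex, the play is complete; Dominator's set is then
   dominating and no edge is left. *)
case: (ltnP (size (rcons h x)) #|unclaimed D S|) => lt; last first.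
  exists x; apply: (@dwin_dominating _ (Dh h)) => [e [e0 [z dz _] _]|]; first by exists z.
  rewrite -Dx; apply: (complete_play_dominating ws _ fx).
  by rewrite /complete_play hx eqn_leq lt history_size.
have ox : odd (size (rcons h x)) by rewrite size_rcons /= eh.
have [y sy hy] := ls _ hx ox lt.
have yx : y \notin rcons h x by move: hy; rewrite history_rcons => /and3P[].
have fy : follows sigma (rcons (rcons h x) y) by apply: follows_rcons.
have ey : ~~ odd (size (rcons (rcons h x) y)) by rewrite size_rcons /= ox.
exists y; apply: dwin_sub (IH _ hy ey fy) => e he.
have -> : Dh (rcons (rcons h x) y) = y |: Dh h.
  by rewrite /Dh dominator_moves_rcons // ox setUCA -/(Dh _) Dx.
have -> : Sh (rcons (rcons h x) y) = x |: Sh h.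
  by rewrite /Sh staller_moves_rcons // ox -/(Sh _) Sx.
have yS : y \notin Sh h.
  have yu : y \notin D :|: S by move: hy; rewrite history_rcons inE => /and3P[].
  have : y \notin Dh h :|: Sh h.
    by rewrite moves_claimed negb_or yu; move: yx; rewrite mem_rcons inE negb_or => /andP[].
  by rewrite inE negb_or => /andP[].
apply: dom_hyp_step he => //.
by move: yx; rewrite mem_rcons inE negb_or => /andP[].
Qed.
End Strategy.

(** Boolean, so that a strategy can search for a good reply with [pick]; here both players move on
    unclaimed vertices. The first conjunct prevents a full board from counting as won vacuously. *)
Definition gwin_step (g : {set 'I_n} -> {set 'I_n} -> bool) D S :=
  [exists x, x \in unclaimed D S] &&
  [forall (x | x \in unclaimed D S), exists y,
     [&& y \in unclaimed D S, y != x & g (y |: D) (x |: S)]].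

Fixpoint gwin k D S : bool :=
  dominating G D || if k is k'.+1 then gwin_step (gwin k') D S else false.

(** A wasted reply is replaced by any other unclaimed vertex, since an extra vertex never hurts
    Dominator. If there is none, Staller's move has filled the neighbourhood of an undominated
    vertex, against [dwin]. *)
Lemma dwin_gwin k D S : #|unclaimed D S| <= k.*2 -> dwin k (dom_hyp D S) -> gwin k D S.
Proof.
elim: k D S => [|k IH] D S uk dD; rewrite [gwin _ _ _]/=; case: (boolP (dominating G D)) => //= nD;
  have [z dz] := dominatingPn nD; have nu : exists x, x \in unclaimed D S.
- case: (set_0Vmem (cnb z :\: S)) => [E0|[x /setDP[xz xS]]].
    by case: dD => -[]; exists z.
  by exists x; rewrite !inE negb_or (disjointFr dz xz).
- by case: nu => x xu; move: uk; rewrite leqn0 cards_eq0 => /eqP u0; rewrite u0 inE in xu.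
- case: (set_0Vmem (cnb z :\: S)) => [E0|[x /setDP[xz xS]]].
    by case: dD => -[]; exists z.
  by exists x; rewrite !inE negb_or (disjointFr dz xz).
apply/andP; split; first exact/existsP.
apply/forall_inP=> x xu; apply/existsP.
have [xD xS] : x \notin D /\ x \notin S by move: xu; rewrite !inE negb_or => /andP[].
have go y : y \in unclaimed D S -> y != x -> dwin k (dom_hyp (y |: D) (x |: S)) ->
    exists y, [&& y \in unclaimed D S, y != x & gwin k (y |: D) (x |: S)].
  move=> yu yx h; exists y; rewrite yu yx; apply: IH h.
  have s : unclaimed (y |: D) (x |: S) \subset unclaimed D S :\ x :\ y.
    by apply/subsetP=> w; rewrite !inE !negb_or => /andP[/andP[-> ->] /andP[-> ->]].
  apply: leq_trans (subset_leq_card s) _.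
  move: uk; rewrite (cardsD1 x) xu (cardsD1 y (unclaimed D S :\ x)) in_setD1 yx yu.
  by rewrite doubleS !add1n !ltnS.
have [y hy] := dwin_step dD x.
case: (boolP ((y \in unclaimed D S) && (y != x))) => [/andP[yu yx]|ny].
  by apply: (go y) => //; apply: dwin_sub hy => e; apply: dom_hyp_stepV.
have pass : (y == x) || (y \in D :|: S).
  by move: ny; rewrite in_setC negb_and !negbK orbC.
case: (set_0Vmem (unclaimed D S :\ x)) => [u0|[y' /setD1P[yx' yu']]].
  have [] := dwin_n0 hy; exists (cnb z :\: S); first by exists z.
  split.
    rewrite in_setD1 in_setD; case/orP: pass => [->//|].
    by rewrite inE => /orP[yD|->]; rewrite ?andbF // (disjointFl dz yD) !andbF.
  apply/esym/eqP; rewrite -subset0; apply/subsetP=> w; rewrite !inE => /and3P[wx wS wz].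
  have := in_set0 w; rewrite -u0 !inE wx negb_or wS andbT.
  by rewrite (disjointFr dz) // !inE.
apply: (go y') => //; apply: dwin_sub hy => e he; apply: dom_hyp_pass => //.
by case: he => w dw ->; exists w => //; apply: disjointWr dw; apply: subsetUr.
Qed.

Lemma gwin_full k D S : unclaimed D S = set0 -> gwin k D S -> dominating G D.
Proof.
move=> u0; case: k => [|k] /=; first by rewrite orbF.
by case/orP=> // /andP[/existsP[x]]; rewrite u0 inE.
Qed.

Lemma gwin_reply k D S x z : gwin k.+1 D S -> x \in unclaimed D S ->
  z \in unclaimed D S -> z != x ->
  exists y, [&& y \in unclaimed D S, y != x & gwin k (y |: D) (x |: S)].
Proof.
case/orP=> [dD|/andP[_ /forall_inP h]] xu zu zx; last exact/existsP/h.
exists z; rewrite zu zx; case: (k) => [|k'] /=.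
  by rewrite (dominatingS _ dD) // subsetUr.
by rewrite (dominatingS _ dD) // subsetUr.
Qed.

Lemma gwin_wins k D S : [disjoint D & S] -> #|unclaimed D S| <= k.*2 -> gwin k D S ->
  dominator_wins G D S.
Proof.
move=> dDS uk gk.
pose Dh h := D :|: dominator_moves h; pose Sh h := S :|: staller_moves h.
pose free h y := (y \in unclaimed D S) && (y \notin h).
(* On histories that do not follow the strategy the search may fail; an arbitrary free vertex then
   keeps it legal. *)
pose sigma : strategy n := fun h =>
  if [pick y | free h y && gwin (k - (size h).+1./2) (y |: Dh h) (Sh h)] is Some y
  then Some y else [pick y | free h y].
have freeP h : history D S h -> unclaimed (Dh h) (Sh h) = [set y | free h y].
  move=> hh; apply/setP=> y; rewrite [RHS]in_set /free.
  have inC D' S' : (y \in unclaimed D' S') = (y \notin D' :|: S') by exact: in_setC.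
  by rewrite !inC moves_claimed negb_or.
exists sigma; have legal : legal_strategy D S sigma.
  move=> h hh oh lt; have [x xu xh] := history_avail lt.
  rewrite /sigma; case: pickP => [y /andP[/andP[yu yh] _]|_].
    by exists y; rewrite // history_rcons hh yh yu.
  case: pickP => [y /andP[yu yh]|/(_ x)]; first by exists y; rewrite // history_rcons hh yh yu.
  by rewrite /free xu xh.
split=> // h /andP[hh /eqP sh] fh.
have inv h0 : history D S h0 -> follows sigma h0 -> ~~ odd (size h0) ->
    gwin (k - (size h0)./2) (Dh h0) (Sh h0).
  move: {2}(size h0)./2 (erefl (size h0)./2) => m; elim: m h0 => [|m IH] h0 hm hh0 fh0 eh0.
    have -> : h0 = [::] by apply: size0nil; move: hm eh0; lia.
    by rewrite /Dh /Sh subn0; have [-> ->] := moves_nil; rewrite !setU0.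
  case/lastP: h0 hm hh0 fh0 eh0 => [//|h1 y]; case/lastP: h1 => [|h2 x]; first by [].
  rewrite !size_rcons /= => hm hh0 fh0 eh0; rewrite negbK in eh0.
  have hh1 : history D S (rcons h2 x) by move: hh0; rewrite history_rcons => /and3P[].
  have := hh1; rewrite history_rcons => /and3P[hh2 xh2 xu].
  have := hh0; rewrite history_rcons => /and3P[_ yh1 yu].
  have fh1 := follows_pre fh0; have fh2 := follows_pre fh1.
  have e2 : ~~ odd (size h2) by move: eh0; lia.
  have o1 : odd (size (rcons h2 x)) by rewrite size_rcons /= e2.
  have g2 : gwin (k - (size h2)./2) (Dh h2) (Sh h2) by apply: IH => //; lia.
  have sz0 := history_size hh0; rewrite !size_rcons in sz0.
  have Dx : Dh (rcons h2 x) = Dh h2 by rewrite /Dh dominator_moves_rcons // (negPf e2).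
  have Sx : Sh (rcons h2 x) = x |: Sh h2.
    by rewrite /Sh staller_moves_rcons // (negPf e2) setUCA.
  have Dy : Dh (rcons (rcons h2 x) y) = y |: Dh h2.
    by rewrite /Dh dominator_moves_rcons // o1 setUCA -/(Dh _) Dx.
  have Sy : Sh (rcons (rcons h2 x) y) = x |: Sh h2.
    by rewrite /Sh staller_moves_rcons // o1 -/(Sh _) Sx.
  rewrite Dy Sy.
  have := fh0 (rcons h2 x) y [::]; rewrite cats1 o1 => /(_ erefl isT).
  have -> : k - (size h2).+2./2 = k - (size (rcons h2 x)).+1./2 by rewrite size_rcons.
  rewrite /sigma; case: pickP => [y' /andP[_ +] [<-] | none _]; first by rewrite Dx Sx.
  have ek : k - (size h2)./2 = (k - (size h2).+2./2).+1 by lia.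
  rewrite ek in g2; have [|||y' /and3P[yu' yx' gy']] := gwin_reply g2 (x := x) (z := y).
  - by rewrite freeP // inE /free xu.
  - rewrite freeP // inE /free yu /=; move: yh1; rewrite mem_rcons inE negb_or.
    by case/andP.
  - by move: yh1; rewrite mem_rcons inE negb_or => /andP[].
  have := none y'; rewrite size_rcons Dx Sx gy' andbT /free mem_rcons inE negb_or yx'.
  by move: yu'; rewrite freeP // inE /free => /andP[-> ->].
exists (Dh h) => //.
case: (boolP (odd (size h))) => oh; last first.
  apply: gwin_full (inv _ hh fh oh); rewrite freeP //; apply/setP=> y; rewrite !inE /free.
  apply/negbTE; rewrite negb_and negbK; case: (boolP (y \in h)); rewrite ?orbT // orbF => yh.
  apply/negP=> yu; have /history_size : history D S (rcons h y) by rewrite history_rcons hh yh.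
  by rewrite size_rcons sh ltnn.
(* Staller made the last move. Her vertex was the only free one, so Dominator could not have replied
   and must have dominated before. *)
case/lastP: h hh sh fh oh => [//|h x] hx sh fx; rewrite size_rcons /= => eh.
have := hx; rewrite history_rcons => /and3P[hh xh xu].
rewrite /Dh dominator_moves_rcons // (negPf eh) -/(Dh _).
have := inv _ hh (follows_pre fx) eh.
have : 0 < k - (size h)./2 by rewrite size_rcons in sh; lia.
case: (k - _) => // k' _ /orP[//|/andP[_ /forall_inP/(_ x)]].
rewrite freeP // inE /free xu xh => /(_ isT) /existsP[y /and3P[]].
rewrite inE => /andP[yu yh] yx _.
have /history_size : history D S (rcons (rcons h x) y).
  by rewrite history_rcons hx mem_rcons inE negb_or yx yh.
by rewrite size_rcons sh ltnn.
Qed.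

Lemma dominator_wins_dwin D S : [disjoint D & S] ->
  dominator_wins G D S <-> forall k, dwin k (dom_hyp D S).
Proof.
move=> dDS; split=> [[sigma ws] k|h].
  have := @winning_dwin D S dDS sigma ws k [::] isT isT.
  by have [-> ->] := moves_nil; rewrite !setU0; apply; case.
have uk : #|unclaimed D S| <= #|unclaimed D S|.*2 by lia.
exact: gwin_wins uk (dwin_gwin uk (h _)).
Qed.
End Domination.

(** * Reduction rules *)

Section Rules.
Variables (n : nat) (v : 'I_n).
Implicit Types (G : sgraph n) (x y z u w : 'I_n).

Definition whyp G : hyp 'I_n := dom_hyp G [set v] set0.

(* Not dominated by [v]. *)
Definition white G z := (z != v) && ~~ G z v.

Lemma whypP G e : whyp G e <-> exists2 z, white G z & e = cnb G z.
Proof.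
have E z : [disjoint cnb G z & [set v]] = white G z.
  by rewrite disjoint_sym disjoints1 !inE negb_or eq_sym.
by split=> -[z zw ->]; exists z; rewrite ?setD0 ?E // -E.
Qed.

(* The vertices of [K] become pendant at [v], hence irrelevant; the vertex set
   stays the same. *)
Definition kill (K : seq 'I_n) (r : rel 'I_n) : rel 'I_n :=
  fun i j => if i \in K then j == v else if j \in K then i == v else r i j.

Lemma in_cnb G x y : (y \in cnb G x) = (y == x) || G x y.
Proof. by rewrite !inE. Qed.

(** For the direct implication Staller's move on [w] forces Dominator to [u]. This removes the edges
    of [u] and [w] and takes [w] out of all others, which is exactly the hypergraph of [G']. The
    converse is a pairing. *)
Lemma leaf_rule G G' u w : u != v -> w != v -> (forall j, G u j = (j == w)) ->
  G' =2 kill [:: u; w] G ->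
  (forall k, dwin k (whyp G)) <-> (forall k, dwin k (whyp G')).
Proof.
move=> uv wv Gu EG.
have uw : u != w by have := adj_irr G u; rewrite Gu => ->.
have nu z : z != w -> G z u = false by rewrite adj_sym Gu => /negPf.
have white' z : white G' z = [&& z != u, z != w & white G z].
  rewrite /white EG /kill !inE (eq_sym v u) (eq_sym v w) (negPf uv) (negPf wv) /=.
  rewrite eqxx; case: (eqVneq z u) => //= _; first by rewrite andbF.
  by case: (eqVneq z w) => //= _; rewrite andbF.
have cnb' z : z != u -> z != w -> white G z -> cnb G' z = cnb G z :\ w.
  move=> zu zw /andP[zv _]; apply/setP=> y; rewrite in_setD1 !in_cnb EG /kill !inE.
  rewrite (negPf zu) (negPf zw) /= (negPf zv).
  case: (eqVneq y u) => [->|yu] /=; first by rewrite eq_sym (negPf zu) nu //= andbF.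
  by case: (eqVneq y w) => [->|yw] /=; rewrite ?orbF // eq_sym (negPf zw).
split=> h k.
  have hu : whyp G [set u; w].
    apply/whypP; exists u; first by rewrite /white uv Gu eq_sym.
    by apply/setP=> y; rewrite in_cnb !inE Gu.
  have wu1 : [set u; w] :\ w = [set u].
    apply/setP=> y; rewrite !inE; case: (eqVneq y w) => [->|_]; rewrite ?orbF //.
    by rewrite eq_sym (negPf uw).
  apply: dwin_pred; apply: dwin_sub (dwin_forced (h k.+2) hu wu1).
  move=> e /whypP[z]; rewrite white' => /and3P[zu zw zW] ->; exists (cnb G z).
    by apply/whypP; exists z.
  by rewrite cnb' // in_setD1 in_cnb uw eq_sym (negPf zu) nu.
pose M x y := [|| (x == u) && (y == w) | (x == w) && (y == u)].
apply: (@dwin_pairing _ k (whyp G') _ M) => //.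
- by move=> x y; rewrite /M orbC [X in X || _]andbC [X in _ || X]andbC.
- move=> x; rewrite /M; case: (eqVneq x u) => [->|]; rewrite ?andbF //=.
  by rewrite (negPf uw).
- move=> x y z /orP[] /andP[/eqP-> /eqP->] /orP[] /andP[/eqP E /eqP->] //;
    by move: uw; rewrite E eqxx.
- move=> e x y /whypP[z]; rewrite white' => /and3P[zu zw zW] ->; rewrite cnb' // /M !inE.
  by case/orP=> /andP[/eqP-> _]; [rewrite (eq_sym u z) (negPf zu) nu // andbF|rewrite eqxx].
move=> e /whypP[z zW ->]; case: (eqVneq z u) => [->|zu].
  by right; exists u, w; rewrite !in_cnb !Gu /M !eqxx !orbT.
case: (eqVneq z w) => [->|zw].
  by right; exists u, w; rewrite !in_cnb (adj_sym G w u) !Gu /M !eqxx !orbT.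
left; exists (cnb G' z); first by apply/whypP; exists z; rewrite // white' zu zw.
by rewrite cnb' // subsetDl.
Qed.

Definition contract (x : nat -> 'I_n) (r : rel 'I_n) : rel 'I_n := fun i j =>
  [|| kill [:: x 9; x 10] r i j, (i == x 8) && (j == x 11) | (i == x 11) && (j == x 8)].

(** The ends are [x 0] and [x 11]. Both hypergraphs are a [GP] with the same [H], [A] and [B], on
    ten and on eight vertices: in [G'] the vertex [x 8] takes over from [x 10] as the neighbour of
    [x 11]. *)
Lemma path_rule G G' (x : nat -> 'I_n) :
  (forall i j, i < 12 -> j < 12 -> x i = x j -> i = j) ->
  (forall i, i < 12 -> x i != v) ->
  (forall i j, 0 < i < 11 -> G (x i) j = (j == x i.-1) || (j == x i.+1)) ->
  G' =2 contract x G ->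
  (forall k, dwin k (whyp G)) <-> (forall k, dwin k (whyp G')).
Proof.
move=> ix xv Gx EG.
have nx i j : i < 12 -> j < 12 -> (x i == x j) = (i == j).
  by move=> hi hj; case: (eqVneq i j) => [->|ij]; rewrite ?eqxx //; apply/eqP => /ix E; case/eqP: ij; apply: E.
have Gx' i j : 0 < i < 11 -> G j (x i) = (j == x i.-1) || (j == x i.+1).
  by rewrite adj_sym; apply: Gx.
have wx i : 0 < i < 11 -> white G (x i).
  by move=> hi; rewrite /white xv ?Gx // ?[v == _]eq_sym ?negb_or ?xv //; lia.
pose H : hyp 'I_n :=
  fun e => exists2 z, white G z /\ (forall i, i < 12 -> z != x i) & e = cnb G z.
(* If [v] dominates an end, that end has no edge of its own. *)
pose A : hyp 'I_n := fun e => white G (x 0) /\ e = cnb G (x 0) :\ x 1.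
pose B : hyp 'I_n := fun e => white G (x 11) /\ e = cnb G (x 11) :\ x 10.
pose GPx m := hU H (GP A [set x 0] B [set x 11] x m).
have cases z : (exists2 i, i < 12 & z = x i) \/ (forall i, i < 12 -> z != x i).
  case: (boolP (has (fun i => z == x i) (iota 0 12))) => [/hasP[i]|/hasPn h].
    by rewrite mem_iota => hi /eqP; left; exists i.
  by right=> i hi; apply: h; rewrite mem_iota.
have cx : pctx 10 H A [set x 0] B [set x 11] x.
  have i10 : inj_upto 10 x by move=> i j hi hj; apply: ix; lia.
  have aH : avoids 10 x H.
    move=> e i [z [_ zx] ->] hi; rewrite in_cnb Gx' ?negb_or; last lia.
    by rewrite eq_sym !zx //; lia.
  have x0e e (w : 'I_n) : w != x 0 -> w \notin [set x 0] by rewrite inE.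
  split.
  - split=> // [e i [_ ->] hi|i hi]; last by rewrite inE nx //; lia.
    by rewrite in_setD1 in_cnb Gx' ?nx //; lia.
  - split=> // [e i [_ ->] hi|i hi]; last by rewrite inE nx //; lia.
    by rewrite in_setD1 in_cnb Gx' ?nx //; lia.
  - split=> [|e [_ ->]]; first by right; exists (x 0).
    by rewrite sub1set in_setD1 in_cnb eqxx nx.
  - split=> [|e [_ ->]]; first by right; exists (x 11).
    by rewrite sub1set in_setD1 in_cnb eqxx nx.
  by rewrite disjoints1 inE nx.
have whypG e : whyp G e <-> GPx 10 e.
  have triE j : 0 < j <= 10 -> slP [set x 0] [set x 11] x 10 j.-1 :|: [set x j] :|:
      slP [set x 0] [set x 11] x 10 j.+1 = cnb G (x j).
    have slE i : i < 12 -> slP [set x 0] [set x 11] x 10 i = [set x i].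
      by case: i => [|i] //=; case: eqP => [->|].
    move=> hj; rewrite !slE; try lia.
    by apply/setP=> y; rewrite in_cnb Gx // !inE orbAC orbC.
  have x0E : x 1 |: (cnb G (x 0) :\ x 1) = cnb G (x 0).
    by rewrite setD1K // in_cnb Gx' // eqxx orbT.
  have x11E : x 10 |: (cnb G (x 11) :\ x 10) = cnb G (x 11).
    by rewrite setD1K // in_cnb Gx' // eqxx !orbT.
  split=> [/whypP[z zW ->]|[[z [zW _] ->]|[[e0 [w ->] ->]|[e0 [w ->] ->]|[j hj ->]]]].
  - case: (cases z) => [[i hi Ez]|zx]; last by left; exists z.
    right; rewrite {z}Ez in zW *; case: (posnP i) => [i0|i0].
      by subst i; apply: Or31; exists (cnb G (x 0) :\ x 1); rewrite ?x0E.
    case: (eqVneq i 11) => [i11|i11].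
      by subst i; apply: Or32; exists (cnb G (x 11) :\ x 10); rewrite ?x11E.
    by apply: Or33; exists i; rewrite ?triE //; lia.
  - by apply/whypP; exists z.
  - by rewrite x0E; apply/whypP; exists (x 0).
  - by rewrite x11E; apply/whypP; exists (x 11).
  by rewrite triE //; apply/whypP; exists (x j) => //; apply: wx; lia.
have killE z y : z != x 9 -> z != x 10 -> z != v -> kill [:: x 9; x 10] G z y =
    [&& y != x 9, y != x 10 & G z y].
  move=> z9 z10 zv; rewrite /kill !inE (negPf z9) (negPf z10) (negPf zv) /=.
  by case: (y == x 9); case: (y == x 10).
have white' z : white G' z = [&& z != x 9, z != x 10 & white G z].
  rewrite /white EG /contract; case: (eqVneq z v) => [_|zv]; rewrite ?andbF //=.
  rewrite [v == _]eq_sym (negPf (xv _ _)) // [v == _]eq_sym (negPf (xv _ _)) // !andbF !orbF.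
  case: (eqVneq z (x 9)) => [->|z9]; first by rewrite /kill !inE eqxx /= eqxx.
  case: (eqVneq z (x 10)) => [->|z10]; first by rewrite /kill !inE eqxx orbT /= eqxx.
  by rewrite killE // ![v == _]eq_sym !xv.
have cnb' z : (forall i, 7 < i < 12 -> z != x i) -> z != v -> cnb G' z = cnb G z.
  move=> zx zv; apply/setP=> y; rewrite !in_cnb EG /contract killE ?zx //.
  rewrite (negPf (zx 8 isT)) (negPf (zx 11 isT)) !orbF.
  case: (eqVneq y (x 9)) => [->|y9] /=; first by rewrite Gx' // !(negPf (zx _ _)).
  by case: (eqVneq y (x 10)) => [->|y10] //=; rewrite Gx' // !(negPf (zx _ _)).
have cnb'8 : cnb G' (x 8) = [set x 7; x 8; x 11].
  apply/setP=> y; rewrite in_cnb EG /contract killE ?nx ?xv // !inE Gx // ?eqxx ?nx //=.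
  case: (eqVneq y (x 9)) => [->|y9] /=; first by rewrite !nx.
  case: (eqVneq y (x 10)) => [->|y10] /=; first by rewrite !nx.
  by case: (y == x 8); case: (y == x 7); case: (y == x 11).
have cnb'11 : cnb G' (x 11) = x 8 |: (cnb G (x 11) :\ x 10).
  apply/setP=> y; rewrite in_cnb [RHS]in_setU1 in_setD1 in_cnb EG /contract killE ?nx ?xv // ?eqxx ?nx //=.
  case: (eqVneq y (x 9)) => [->|y9] /=; first by rewrite Gx' // !nx.
  case: (eqVneq y (x 10)) => [->|y10] /=; first by rewrite !nx.
  by case: (y == x 8); case: (y == x 11); case: (G _ _).
have whypG' e : whyp G' e <-> GPx 8 e.
  have triE j : 0 < j <= 8 -> slP [set x 0] [set x 11] x 8 j.-1 :|: [set x j] :|: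
      slP [set x 0] [set x 11] x 8 j.+1 = cnb G' (x j).
    have slE i : i < 9 -> slP [set x 0] [set x 11] x 8 i = [set x i].
      by case: i => [|i] //=; case: eqP => [->|].
    move=> hj; rewrite slE; last lia.
    case: (eqVneq j 8) => [->|j8]; first by rewrite cnb'8.
    have -> : cnb G' (x j) = cnb G (x j).
      by apply: cnb' => [i hi|]; [rewrite nx; lia|apply: xv; lia].
    rewrite slE; last lia.
    by apply/setP=> y; rewrite in_cnb Gx ?inE 1?orbAC 1?orbC //; lia.
  have x0E : x 1 |: (cnb G (x 0) :\ x 1) = cnb G' (x 0).
    rewrite setD1K; last by rewrite in_cnb Gx' // eqxx orbT.
    by rewrite cnb' ?xv // => i hi; rewrite nx; lia.
  split=> [/whypP[z + ->]|[[z [zW zx] ->]|[[e0 [w ->] ->]|[e0 [w ->] ->]|[j hj ->]]]].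
  - rewrite white' => /and3P[z9 z10 zW].
    case: (cases z) => [[i hi Ez]|zx]; last first.
      left; exists z => //; rewrite cnb' //; last by case/andP: zW.
      by move=> i hi; apply: zx; lia.
    right; rewrite {z}Ez !nx // in z9 z10 zW *; case: (posnP i) => [i0|i0].
      by subst i; apply: Or31; exists (cnb G (x 0) :\ x 1); rewrite ?x0E.
    case: (eqVneq i 11) => [i11|i11].
      by subst i; apply: Or32; exists (cnb G (x 11) :\ x 10); rewrite ?cnb'11.
    by apply: Or33; exists i; rewrite ?triE //; lia.
  - apply/whypP; exists z; first by rewrite white' !zx.
    by rewrite cnb' //; [move=> i hi; apply: zx; lia|case/andP: zW].
  - by rewrite x0E; apply/whypP; exists (x 0); rewrite // white' w !nx.
  - by rewrite -cnb'11; apply/whypP; exists (x 11); rewrite // white' w !nx.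
  by rewrite triE //; apply/whypP; exists (x j); rewrite // white' wx ?nx //; lia.
have cx2 : pctx (maxn 10 8) H A [set x 0] B [set x 11] x by [].
have cx3 : pctx (maxn 8 10) H A [set x 0] B [set x 11] x by [].
split=> h k.
  apply: dwin_sub (GP_transfer cx2 isT isT erefl (dwin_sub _ (h _))) => e.
    by move/whypG'.
  by move/whypG.
apply: dwin_sub (GP_transfer cx3 isT isT erefl (dwin_sub _ (h _))) => e.
  by move/whypG.
by move/whypG'.
Qed.

Lemma isolated_lost G u : u != v -> (forall j, G u j = false) -> ~ dwin 1 (whyp G).
Proof.
move=> uv Gu /dwin_not1; apply; apply/whypP; exists u; first by rewrite /white uv Gu.
by apply/setP=> y; rewrite in_cnb !inE Gu orbF.
Qed.
End Rules.

(* The vertices outside the image are adjacent to [v] only: they are dominated and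
   help no other vertex. *)
Lemma compress_rule n n' (G : sgraph n) (G' : sgraph n') (v : 'I_n) (v' : 'I_n') (f : 'I_n' -> 'I_n) :
  injective f -> f v' = v -> (forall i j, G' i j = G (f i) (f j)) ->
  (forall z w, G z w -> w != v -> z \in codom f) -> (forall z, z != v -> exists w, G z w) ->
  (forall k, dwin k (whyp v G)) <-> (forall k, dwin k (whyp v' G')).
Proof.
move=> fI fv EG cf ni.
have cW z : white v G z -> exists2 i, f i = z & white v' G' i.
  move=> zW; have /andP[zv nzv] := zW; have [w zw] := ni z zv.
  have wv : w != v by apply: contraNneq nzv => <-.
  have /codomP[i Ei] := cf _ _ zw wv; exists i => //.
  by rewrite /white EG fv -Ei nzv andbT; apply: contraNneq zv => Evi; rewrite Ei Evi fv.
have Wc i : white v' G' i -> white v G (f i).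
  by rewrite /white -fv (inj_eq fI) EG.
have cnbE i : white v G (f i) -> cnb G (f i) = f @: cnb G' i.
  move=> /andP[iv niv]; apply/setP=> y; rewrite in_cnb; apply/idP/imsetP.
    case/predU1P=> [->|iy]; first by exists i; rewrite // in_cnb eqxx.
    have /codomP[j Ej] : y \in codom f by apply: (cf _ (f i)); rewrite // adj_sym.
    by exists j; rewrite // in_cnb EG -Ej iy orbT.
  by move=> [j]; rewrite in_cnb EG (eq_sym j) => /predU1P[<- ->|h ->]; rewrite ?eqxx ?h ?orbT.
split=> h k; first apply/(dwin_imset fI); last have /(dwin_imset fI) := h k;
  [apply: dwin_sub (h k) | apply: dwin_sub] => e.
  move=> [_ /whypP[i iW ->] ->]; apply/whypP; exists (f i); first exact: Wc.
  by rewrite cnbE //; apply: Wc.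
move=> /whypP[z zW ->]; have [i Ei iW] := cW z zW.
exists (cnb G' i); first by apply/whypP; exists i.
by rewrite -cnbE Ei.
Qed.

(** * Peeling forests *)

Section Peel.
Variable T : finType.
Implicit Types (r : rel T) (A : {set T}) (x y : T).

Definition nbrs r A x : {set T} := [set y in A | r x y].

(* Acyclicity, in a form that is inherited by induced subgraphs. *)
Definition peel r := forall A, A != set0 -> exists2 x, x \in A & #|nbrs r A x| <= 1.

(** Peeling off a vertex of degree at most one lowers the degree sum by at most two. *)
Lemma peel_sum r A : peel r -> symmetric r -> \sum_(x in A) #|nbrs r A x| <= (#|A|).*2.
Proof.
move=> pr sr; move: {2}#|A| (leqnn #|A|) => m; elim: m A => [|m IH] A.
  by rewrite leqn0 cards_eq0 => /eqP->; rewrite big_set0.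
case: (eqVneq A set0) => [->|A0]; first by rewrite big_set0.
have [x xA dx] := pr _ A0; rewrite (cardsD1 x) xA add1n ltnS => Am.
rewrite (big_setD1 x) //= doubleS -addn2 addnC.
have hs : \sum_(y in A :\ x) #|nbrs r A y| <=
    \sum_(y in A :\ x) (#|nbrs r (A :\ x) y| + r x y).
  apply: leq_sum => y _; rewrite (cardsD1 x) addnC leq_add //.
    apply: subset_leq_card; apply/subsetP=> z; rewrite !inE.
    by move=> /and3P[-> -> ->].
  by rewrite inE xA sr.
apply: leq_trans (leq_add hs (leqnn _)) _; rewrite big_split /= -addnA leq_add ?IH //.
rewrite -[2]/(1 + 1) leq_add //; apply: leq_trans dx.
rewrite -sum1_card (big_mkcond (fun y => y \in A :\ x)) [leqRHS]big_mkcond.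
apply: leq_sum => y _; rewrite !inE; by case: (y == x); case: (y \in A).
Qed.

(* A closed non-backtracking walk would give a set violating [peel]. *)
Lemma walk_inj r (y : nat -> T) N : peel r -> symmetric r -> irreflexive r ->
  (forall i, i < N -> r (y i) (y i.+1)) -> (forall i, i.+1 < N -> y i != y i.+2) ->
  forall i j, i <= N -> j <= N -> y i = y j -> i = j.
Proof.
move=> pr sr ir; elim: N => [|N IH] hr hb.
  by move=> i j; rewrite !leqn0 => /eqP-> /eqP->.
have {}IH := IH (fun i h => hr i (ltnW h)) (fun i h => hb i (ltnW h)).
suff new i : i <= N -> y i <> y N.+1.
  move=> i j; rewrite leq_eqVlt ltnS => /predU1P[->|hi];
    rewrite leq_eqVlt ltnS => /predU1P[->|hj] //; last exact: IH.
    by move=> /esym E; case: (new j hj).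
  by move=> E; case: (new i hi).
move=> hi E.
have iN : i.+2 <= N.
  rewrite ltn_neqAle; apply/andP; split.
    by apply/eqP=> EN; have := hb i; rewrite EN E eqxx => /(_ (leqnn _)).
  rewrite ltn_neqAle hi andbT; apply/eqP=> EN.
  by have := hr N (leqnn _); rewrite -E EN ir.
(* The closed part of the walk. Each of its vertices has both its predecessor and its successor in
   [A], cyclically, against [peel]. *)
pose A := [set y (val l) | l : 'I_N.+1 & i <= l].
have inA l : i <= l <= N -> y l \in A.
  move=> /andP[il lN]; apply/imsetP; have lN' : l < N.+1 by [].
  by exists (Ordinal lN'); rewrite ?inE.
have A0 : A != set0 by apply/set0Pn; exists (y i); apply: inA; rewrite leqnn hi.
have [x /imsetP[l]] := pr _ A0; rewrite inE => il -> {x}; apply/negP; rewrite -ltnNge.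
have two a b : y a \in A -> y b \in A -> r (y l) (y a) -> r (y l) (y b) -> y a != y b ->
    1 < #|nbrs r A (y l)|.
  move=> aA bA ra rb ab; apply: (@leq_trans #|[set y a; y b]|).
    by rewrite cards2 ab.
  by apply: subset_leq_card; apply/subsetP=> z; rewrite !inE => /orP[] /eqP->; apply/andP.
have lN : l <= N by rewrite -ltnS.
have ne a b : a <= N -> b <= N -> a != b -> y a != y b.
  by move=> ha hb'; apply: contraNneq => /(IH _ _ ha hb') ->.
have rS a : a < N.+1 -> r (y a.+1) (y a) by move=> ha; rewrite sr hr.
have [Nl|Nl] := eqVneq (l : nat) N.
  apply: (two i N.-1); rewrite ?inA ?Nl //; try lia.
  - by rewrite E hr.
  - by have {1}-> : N = N.-1.+1 by [lia]; apply: rS; lia.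
  - by apply: ne; lia.
have [li|li] := eqVneq (l : nat) i.
  apply: (two i.+1 N); rewrite ?inA ?li //; try lia.
  - by apply: hr; lia.
  - by rewrite E; apply: rS.
  - by apply: ne; lia.
apply: (two l.-1 l.+1); rewrite ?inA //; try lia.
- by have {1}-> : (l : nat) = l.-1.+1 by [lia]; apply: rS; lia.
- by apply: hr; lia.
by apply: ne; lia.
Qed.
End Peel.

(** * Feedback edge sets and the reduction rules *)

Section Feedback.
Variable n : nat.
Implicit Types (G : sgraph n) (F : {set {set 'I_n}}) (v u w : 'I_n).

(** Otherwise every vertex of [A] has two neighbours in [A], and a path can be extended at its head
    for ever: a neighbour of the head that is already on the path, other than the next vertex,
    closes a cycle of length at least three. *)
Lemma forest_peel (e : rel 'I_n) : symmetric e -> irreflexive e -> forest e -> peel e.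
Proof.
move=> se ie /forestP fe A A0; case: (pickP (fun x => (x \in A) && (#|nbrs e A x| <= 1))).
  by move=> x /andP[xA dx]; exists x.
move=> h; exfalso.
have two x y : x \in A -> exists2 z, z \in A & e x z && (z != y).
  move=> xA; have := h x; rewrite xA /= => /negbT; rewrite -ltnNge (cardsD1 y) => d.
  have /card_gt0P[z] : 0 < #|nbrs e A x :\ y| by move: d; case: (y \in _); rewrite ?add1n ?add0n //; lia.
  by rewrite !inE => /and3P[zy zA xz]; exists z; rewrite // xz.
suff long m : exists x s, [/\ x \in A, uniq (x :: s), path e x s & m < size (x :: s)].
  have [x [s [_ /card_uniqP u _]]] := long n.
  by rewrite -u ltnNge; have := max_card (mem (x :: s)); rewrite card_ord => ->.
elim: m => [|m [x [s [xA u p sz]]]]; first by have [x xA] := set0Pn _ A0; exists x, [::].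
have [z zA /andP[xz zs]] := two x (head x s) xA.
case: (boolP (z \in x :: s)) => [|zn]; last first.
  exists z, (x :: s); split=> //.
  - by rewrite cons_uniq zn.
  - by apply/andP; split; rewrite // se.
rewrite inE; have -> /= : (z == x) = false.
  by apply: contraTF xz => /eqP->; rewrite ie.
move=> zin; case/splitPr: zin u p zs {sz} => s1 s2 u p zs.
have s10 : s1 != [::] by apply: contraNneq zs => ->; rewrite /= eqxx.
have uc : ucycle e (x :: rcons s1 z).
  apply/andP; split.
    rewrite /= rcons_path last_rcons [e z x]se xz andbT.
    by move: p; rewrite -cat_rcons cat_path => /andP[].
  by move: u; rewrite -cat_rcons -cat_cons cat_uniq => /and3P[].
by have := fe _ uc; rewrite /= size_rcons; case: (s1) s10.
Qed.

(* [F] need not consist of edges of [G], so that [fes k] survives deletions. *)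
Definition fes k G := exists F, [/\ #|F| <= k, forall f, f \in F -> #|f| <= 2 &
  peel (remove_edges G F)].

Lemma remove_edges_sym G F : symmetric (remove_edges G F).
Proof. by move=> x y; rewrite /remove_edges /= adj_sym setUC. Qed.

Lemma remove_edges_irr G F : irreflexive (remove_edges G F).
Proof. by move=> x; rewrite /remove_edges /= adj_irr. Qed.

Lemma fes_fen G : fes (fen G) G.
Proof.
have [F /andP[sF fF] <-] := fen_attained G; exists F; split=> //.
  by move=> f /(subsetP sF) /imsetP[p _ ->]; rewrite cards2; case: eqP.
by apply: forest_peel => //; [apply: remove_edges_sym|apply: remove_edges_irr].
Qed.

Lemma peel_local (r r' : rel 'I_n) (A : {set 'I_n}) : peel r -> A != set0 ->
  {in A &, forall x y, r' x y -> r x y} -> exists2 x, x \in A & #|nbrs r' A x| <= 1.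
Proof.
move=> pr A0 s; have [x xA dx] := pr _ A0; exists x => //; apply: leq_trans dx.
by apply: subset_leq_card; apply/subsetP=> y; rewrite !inE => /andP[yA h]; rewrite yA s.
Qed.

Lemma nbrs_le1 (r : rel 'I_n) A x z : (forall y, r x y -> y = z) -> #|nbrs r A x| <= 1.
Proof.
move=> h; rewrite -(cards1 z); apply: subset_leq_card.
by apply/subsetP=> y; rewrite !inE => /andP[_ /h ->].
Qed.

Lemma fes_kill k v u w G G' : u != v -> w != v -> G' =2 kill v [:: u; w] G ->
  fes k G -> fes k G'.
Proof.
move=> uv wv EG [F [kF F2 pF]]; exists F; split=> // A A0.
case: (boolP (u \in A)) => [uA|uA].
  exists u => //; apply: (@nbrs_le1 _ _ _ v) => y /andP[].
  by rewrite EG /kill !inE eqxx /= => /eqP.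
case: (boolP (w \in A)) => [wA|wA].
  exists w => //; apply: (@nbrs_le1 _ _ _ v) => y /andP[].
  by rewrite EG /kill !inE eqxx orbT /= => /eqP.
apply: (peel_local pF A0) => x y xA yA; rewrite /remove_edges /= EG /kill !inE.
have nA z t : t \in A -> z \notin A -> (t == z) = false.
  by move=> tA; apply: contraNF => /eqP<-.
by rewrite (nA u x) // (nA w x) // (nA u y) // (nA w y).
Qed.

Lemma fes_contract k v (x : nat -> 'I_n) G G' :
  (forall i j, i < 12 -> j < 12 -> x i = x j -> i = j) ->
  (forall i j, 0 < i < 11 -> G (x i) j = (j == x i.-1) || (j == x i.+1)) ->
  G' =2 contract v x G -> fes k G -> fes k G'.
Proof.
move=> ix Gx EG [F [kF F2 pF]].
have nx i j : i < 12 -> j < 12 -> (x i == x j) = (i == j).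
  by move=> hi hj; case: (eqVneq i j) => [->|ij]; rewrite ?eqxx //; apply/eqP => /ix E; case/eqP: ij; apply: E.
have nA (A : {set 'I_n}) z t : t \in A -> z \notin A -> (t == z) = false.
  by move=> tA; apply: contraNF => /eqP<-.
have dead F' (A : {set 'I_n}) : (x 9 \in A) || (x 10 \in A) ->
    exists2 z, z \in A & #|nbrs (remove_edges G' F') A z| <= 1.
  case/orP=> zA; [exists (x 9)|exists (x 10)] => //; apply: (@nbrs_le1 _ _ _ v) => y /andP[];
  by rewrite EG /contract /kill !inE eqxx ?orbT !nx //= !orbF => /eqP.
have onA (A : {set 'I_n}) y z : y \in A -> z \in A -> x 9 \notin A -> x 10 \notin A ->
    G' y z = [|| G y z, (y == x 8) && (z == x 11) | (y == x 11) && (z == x 8)].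
  move=> yA zA n9 n10; rewrite EG /contract /kill !inE.
  by rewrite (nA A (x 9) y) // (nA A (x 10) y) // (nA A (x 9) z) // (nA A (x 10) z).
pose P3 := [:: [set x 8; x 9]; [set x 9; x 10]; [set x 10; x 11]].
(* If [F] contains an edge of the replaced stretch, the new edge between [x 8] and [x 11] takes its
   place in [F]. *)
case: (boolP (has [in F] P3)) => [/hasP[e eP eF]|nP].
  exists ([set x 8; x 11] |: (F :\ e)); split.
  - by apply: leq_trans kF; rewrite cardsU1 (cardsD1 e F) eF leq_add2r leq_b1.
  - by move=> f /setU1P[->|/setD1P[_ /F2]] //; rewrite cards2; case: eqP.
  move=> A A0; case: (boolP ((x 9 \in A) || (x 10 \in A))) => [|]; first exact: dead.
  rewrite negb_or => /andP[n9 n10]; apply: (peel_local pF A0) => y z yA zA.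
  rewrite /remove_edges /= (onA A) // !inE negb_or negb_and negbK.
  case/andP=> Gyz /andP[n811 /orP[/eqP Ee|nF]].
    have yz9 t : t \in [set y; z] -> t \in A by rewrite !inE => /orP[] /eqP->.
    move: eP; rewrite -Ee !inE => /or3P[] /eqP E.
    - by have := yz9 (x 9); rewrite E !inE eqxx orbT (negPf n9) => /(_ isT).
    - by have := yz9 (x 9); rewrite E !inE eqxx (negPf n9) => /(_ isT).
    - by have := yz9 (x 10); rewrite E !inE eqxx (negPf n10) => /(_ isT).
  rewrite nF andbT; case/or3P: Gyz n811 => // /andP[/eqP-> /eqP->]; first by rewrite eqxx.
  by rewrite setUC eqxx.
have [nF1 [nF2 nF3]] : [set x 8; x 9] \notin F /\ [set x 9; x 10] \notin F /\ [set x 10; x 11] \notin F.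
  by move: nP; rewrite /= !negb_or => /and4P[].
exists F; split=> // A A0.
case: (boolP ((x 9 \in A) || (x 10 \in A))) => [|]; first exact: dead.
rewrite negb_or => /andP[n9 n10].
case: (boolP ((x 8 \in A) && (x 11 \in A))) => [/andP[h8 h11]|nh]; last first.
  apply: (peel_local pF A0) => y z yA zA; rewrite /remove_edges /= (onA A) //.
  case/andP=> /or3P[-> -> //|/andP[/eqP Ey /eqP Ez]|/andP[/eqP Ey /eqP Ez]] _;
    by move: nh; rewrite -Ey -Ez yA zA.
(* The new edge is subdivided again. In [A2] the vertices [x 9] and [x 10] have two neighbours each,
   so the vertex that the old graph peels off lies in [A]. *)
pose A2 := [set x 9; x 10] :|: A.
have A2in y : y \in A -> y \in A2 by rewrite !inE => ->; rewrite !orbT.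
have A20 : A2 != set0 by apply/set0Pn; exists (x 8); apply: A2in.
have [z zA2 dz] := pF _ A20.
have two a b c : a \in A2 -> b \in A2 -> a != b -> remove_edges G F c a -> remove_edges G F c b ->
    1 < #|nbrs (remove_edges G F) A2 c|.
  move=> aA bA ab ra rb; apply: (@leq_trans #|[set a; b]|); first by rewrite cards2 ab.
  by apply: subset_leq_card; apply/subsetP=> y /set2P[->|->]; rewrite in_set; apply/andP.
have [x9A2 x10A2] : x 9 \in A2 /\ x 10 \in A2 by rewrite !inE !eqxx orbT.
have r89 : remove_edges G F (x 8) (x 9) by rewrite /remove_edges /= Gx // eqxx orbT.
have r910 : remove_edges G F (x 9) (x 10) by rewrite /remove_edges /= Gx // eqxx orbT.
have r1011 : remove_edges G F (x 10) (x 11) by rewrite /remove_edges /= Gx // eqxx orbT.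
have zA : z \in A.
  move: (zA2); rewrite !inE -orbA => /or3P[/eqP Ez|/eqP Ez|//]; move: dz; rewrite leqNgt Ez.
    case/negP; apply: (two (x 8) (x 10)); rewrite ?nx //; first exact: A2in.
    by rewrite remove_edges_sym.
  case/negP; apply: (two (x 9) (x 11)); rewrite ?nx //; first exact: A2in.
  by rewrite remove_edges_sym.
exists z => //; apply: leq_trans dz.
have rr y : y \in A -> remove_edges G' F z y -> (z == x 8) && (y == x 11) || (z == x 11) && (y == x 8)
    \/ remove_edges G F z y.
  move=> yA; rewrite /remove_edges /= (onA A) // => /andP[/or3P[->|->|->] ->]; rewrite ?orbT;
  by [right|left].
(* Sends the new neighbour of [x 8] or [x 11] back to the old one on the path; being injective, it
   bounds the new degree by the old one. *)
pose g y := if (z == x 8) && (y == x 11) then x 9 else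
            if (z == x 11) && (y == x 8) then x 10 else y.
have gI : {in nbrs (remove_edges G' F) A z &, injective g}.
  move=> a b; rewrite !inE /g => /andP[aA _] /andP[bA _].
  case: (eqVneq z (x 8)) => [->|z8] /=; rewrite ?nx //=.
    case: (eqVneq a (x 11)) => [->|_]; case: (eqVneq b (x 11)) => [->|_] // E; exfalso.
      by move: n9; rewrite E bA.
    by move: n9; rewrite -E aA.
  case: (eqVneq z (x 11)) => [_|z11] //=.
  case: (eqVneq a (x 8)) => [->|_]; case: (eqVneq b (x 8)) => [->|_] // E; exfalso.
    by move: n10; rewrite E bA.
  by move: n10; rewrite -E aA.
rewrite -(card_in_imset gI); apply: subset_leq_card; apply/subsetP=> _ /imsetP[y + ->].
rewrite in_set => /andP[yA /(rr _ yA) h]; rewrite in_set /g.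
case: (boolP ((z == x 8) && (y == x 11))) h => [/andP[/eqP-> _] _|_ h].
  by apply/andP; split.
case: (boolP ((z == x 11) && (y == x 8))) h => [/andP[/eqP-> _] _|_ h].
  by rewrite x10A2 remove_edges_sym.
by case: h => // h; apply/andP; split=> //; apply: A2in.
Qed.
End Feedback.

(** * The size of a reduced graph *)

Section Bound.
Variables (n : nat) (v : 'I_n) (G : sgraph n) (k : nat).

(* The vertices that survive the removal of those adjacent to [v] only. *)
Definition alive : {set 'I_n} := [set i | (i == v) || [exists j, (j != v) && G i j]].

Hypothesis fesG : fes k G.
Hypothesis red_leaf : forall u w, u != v -> w != v -> ~ (forall j, G u j = (j == w)).
Hypothesis red_path : forall x : nat -> 'I_n,
  (forall i j, i < 12 -> j < 12 -> x i = x j -> i = j) -> (forall i, i < 12 -> x i != v) ->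
  ~ (forall i j, 0 < i < 11 -> G (x i) j = (j == x i.-1) || (j == x i.+1)).

Let aliveN i j : i \in alive -> i != v -> G i j -> j \in alive.
Proof.
move=> _ iv ij; rewrite inE; apply/orP; right; apply/existsP; exists i.
by rewrite iv adj_sym.
Qed.

Let alive_two i : i \in alive -> i != v -> 1 < #|[set y | G i y]|.
Proof.
rewrite inE => /predU1P[->|/existsP[j /andP[jv ij]] iv]; first by rewrite eqxx.
rewrite ltnNge; apply/negP=> le1; apply: (red_leaf iv jv) => y.
apply/idP/eqP=> [iy|->//].
by apply: (card_le1_eqP le1); rewrite inE.
Qed.

(** With [s = #|S0|], the degree sum gives at most [3 * s] vertices in [Sp] and at most [6 * s]
    darts leaving them. Each dart accounts for at most ten further vertices, so there are at most
    [63 * s] in all, and [s <= k.*2.+1]. *)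
Lemma kernel_bound : #|alive| <= 126 * k + 63.
Proof.
have [F [kF F2 pF]] := fesG; set r := remove_edges G F in pF.
have rs : symmetric r := @remove_edges_sym _ G F.
have ri : irreflexive r := @remove_edges_irr _ G F.
have vX : v \in alive by rewrite inE eqxx.
move: aliveN alive_two vX; set X := alive => aN a2 vX; clearbody X.
pose deg i := #|nbrs r X i|.
(* Outside [S0], the branching vertices [S3] and the neighbours [Bk] of [v], every
   vertex has two neighbours; it is reached within ten steps from a dart in [D]. *)
pose S0 := (v |: cover F) :&: X; pose R := X :\: S0.
have S0X : S0 \subset X by apply: subsetIr.
have vS0 : v \in S0 by rewrite !inE eqxx vX.
have S0s : #|S0| <= k.*2.+1.
  apply: leq_trans (subset_leq_card (subsetIl _ _)) _.
  apply: leq_trans (leq_card_setU _ _) _; rewrite cards1 add1n ltnS.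
  apply: leq_trans (leq_card_cover F).1 _.
  apply: leq_trans (_ : \sum_(A in F) 2 <= _); first by apply: leq_sum => f /F2.
  by rewrite sum_nat_const muln2 leq_double.
have RP i : i \in R -> [/\ i \in X, i != v & i \notin cover F].
  by rewrite !inE negb_and negb_or => /andP[+ iX]; rewrite iX orbF => /andP[].
have rG i j : i \notin cover F -> r i j = G i j.
  move=> iF; rewrite /r /remove_edges /=; case: (G i j) => //=.
  by apply: contra iF => ijF; apply/bigcupP; exists [set i; j]; rewrite // !inE eqxx.
have degR i : i \in R -> deg i = #|[set y | G i y]|.
  move=> /RP[iX iv iF]; congr #|pred_of_set _|; apply/setP=> y; rewrite [LHS]in_set [RHS]in_set rG //.
  by case: (boolP (G i y)) => [/(aN _ _ iX iv) ->|_]; rewrite ?andbF.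
have deg2 i : i \in R -> 1 < deg i by move=> iR; rewrite degR //; have [iX iv _] := RP _ iR; apply: a2.
(* The degree sum over [X] is at most twice [#|X|]; every vertex of [R] has degree at least two,
   which cancels its share. *)
have sumX : \sum_(i in S0) deg i + \sum_(i in R) (deg i - 2) <= #|S0|.*2.
  have := peel_sum X pF rs; rewrite (big_setID S0) /= (setIidPr S0X) -/R.
  rewrite -(cardsID S0 X) (setIidPr S0X) -/R doubleD.
  have -> : \sum_(i in R) #|nbrs r X i| = \sum_(i in R) (deg i - 2) + #|R|.*2.
    rewrite -muln2 -sum_nat_const -big_split /=; apply: eq_bigr => i iR.
    by rewrite subnK // deg2.
  by rewrite addnA leq_add2r.
(* The neighbours of [v] are set apart because a reducible path must avoid [v] at its ends too. They
   are counted by the degree of [v], which lies in [S0]. *)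
pose S3 := [set i in R | 2 < deg i]; pose Bk := [set i in R | G i v].
have S3s : #|S3| <= \sum_(i in R) (deg i - 2).
  rewrite -sum1_card (big_mkcond (fun i => i \in S3)) [leqRHS]big_mkcond /=.
  by apply: leq_sum => i _; rewrite inE; case: (i \in R) => //=; case: ifP => //; lia.
have Bks : #|Bk| <= \sum_(i in S0) deg i.
  rewrite (big_setD1 v) //=; apply: leq_trans (leq_addr _ _); apply: subset_leq_card.
  apply/subsetP=> i; rewrite in_set => /andP[iR iv]; have [iX _ iF] := RP i iR.
  by rewrite in_set rs rG // iv iX.
pose Sp := S0 :|: (S3 :|: Bk); pose U := X :\: Sp.
have SpX : Sp \subset X.
  by rewrite !subUset S0X /=; apply/andP; split; apply/subsetP=> i; rewrite inE => /andP[/RP[]].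
have UP i : i \in U -> [/\ i \in R, deg i = 2 & ~~ G i v].
  rewrite in_setD !in_setU !negb_or => /andP[/and3P[i0 i3 iB] iX].
  have iR : i \in R by rewrite in_setD i0.
  move: i3 iB; rewrite [i \in S3]in_set [i \in Bk]in_set iR /= -leqNgt => d2 ->; split=> //.
  by apply/eqP; rewrite eqn_leq d2 deg2.
pose D := [set p : 'I_n * 'I_n | (p.1 \in Sp) && (p.2 \in nbrs r X p.1)].
have Ds : #|D| <= 6 * #|S0|.
  have -> : #|D| = \sum_(i in Sp) deg i.
    rewrite -sum1_card (eq_bigl (fun p => (p.1 \in Sp) && (p.2 \in nbrs r X p.1))).
      rewrite -(pair_big_dep (mem Sp) (fun i j => j \in nbrs r X i) (fun _ _ => 1)) /=.
      by apply: eq_bigr => i _; rewrite sum1_card.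
    by move=> p; rewrite !inE.
  rewrite (big_setID S0) /= (_ : Sp :&: S0 = S0); last exact: setUK.
  have s1 : \sum_(i in Sp :\: S0) deg i <= \sum_(i in R) (deg i - 2) + #|S3 :|: Bk|.*2.
    have SR : Sp :\: S0 \subset R.
      by apply/subsetP=> i /setDP[/(subsetP SpX) iX i0]; rewrite in_setD i0.
    rewrite (_ : \sum_(i in Sp :\: S0) deg i = \sum_(i in Sp :\: S0) (deg i - 2) + #|Sp :\: S0|.*2).
      apply: leq_add.
        rewrite [leqRHS](big_setID (Sp :\: S0)) /= (setIidPr SR); exact: leq_addr.
      rewrite leq_double; apply: subset_leq_card; apply/subsetP=> i.
      by rewrite in_setD [i \in Sp]in_setU => /andP[/negPf->].
    rewrite -muln2 -sum_nat_const -big_split /=; apply: eq_bigr => i /(subsetP SR) iR.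
    by rewrite subnK // deg2.
  have [h5 _] := leq_card_setU S3 Bk.
  have arith a w s b c d t : a + w <= s.*2 -> c <= w -> d <= a -> b <= c + d ->
    t <= w + b.*2 -> a + t <= 6 * s by clear; lia.
  exact: arith sumX S3s Bks h5 s1.
have Sps : #|Sp| <= 3 * #|S0|.
  have [h1 _] := leq_card_setU S0 (S3 :|: Bk); have [h2 _] := leq_card_setU S3 Bk.
  have arith a w s b c d t : a + w <= s.*2 -> c <= w -> d <= a -> b <= c + d ->
    t <= s + b -> t <= 3 * s by clear; lia.
  exact: arith sumX S3s Bks h2 h1.
(* For [b] in [U] this is the neighbour of [b] other than [a]; the default is then never reached. *)
pose nxt a b := odflt b [pick z | G b z && (z != a)].
have nxtP a b : b \in U -> G b a -> [/\ G b (nxt a b), nxt a b != a &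
    forall z, G b z -> z != a -> z = nxt a b].
  move=> bU ba; have [bR] := UP b bU; rewrite degR // => b2 _.
  move: b2; rewrite (cardsD1 a) inE ba => -[/eqP/cards1P[c Ec]].
  have cP z : G b z && (z != a) = (z == c) by rewrite -[RHS]in_set1 -Ec !inE andbC.
  have nE : nxt a b = c.
    by rewrite /nxt; case: pickP => [z|/(_ c)]; rewrite cP ?eqxx // => /eqP.
  have /andP[bc ca] : G b c && (c != a) by rewrite cP.
  rewrite nE; split=> // z bz za.
  by apply/eqP; rewrite -cP bz.
pose st (p : 'I_n * 'I_n) := (p.2, nxt p.1 p.2).
have Ucov : U \subset [set (iter (val q.1) st q.2).2 | q in setX [set: 'I_10] D].
  apply/subsetP=> u uU.
  have [uR u2 _] := UP u uU; have [uX uv uF] := RP u uR.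
  have [y1 uy1] : exists y1, G u y1.
    by have /card_gt0P[y1] : 0 < deg u by [rewrite u2]; rewrite inE rG // => /andP[]; exists y1.
  pose y i := (iter i st (u, y1)).1.
  have yS i : (iter i st (u, y1)).2 = y i.+1 by [].
  have y2 i : y i.+2 = nxt (y i) (y i.+1) by [].
  have adjU N : (forall i, i <= N -> y i \in U) -> forall i, i <= N -> G (y i) (y i.+1).
    move=> hU; elim=> [|i IH] hi //; rewrite y2.
    by have [] := nxtP (y i) (y i.+1) (hU _ hi); rewrite // adj_sym IH // ltnW.
  have back N : (forall i, i <= N -> y i \in U) -> forall i, i < N -> y i != y i.+2.
    move=> hU i hi; rewrite y2 eq_sym.
    by have [] := nxtP (y i) (y i.+1) (hU _ hi); rewrite // adj_sym (adjU N) // ltnW.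
  have mX i : (forall j, j < i -> y j \in U) -> y i \in X.
    case: i => [|i] hU; first by [].
    have [yR _ _] := UP _ (hU i (leqnn _)); have [yX yv _] := RP _ yR.
    by apply: aN yX yv _; apply: (adjU i).
  (* Otherwise [y 0], ..., [y 10] all lie in [U]. By [walk_inj] the vertices up to [y 11] are
     distinct, and they form a path excluded by [red_path]; [y 11] is not [v] since [y 10] is not
     adjacent to [v]. *)
  have [m m10 [mU mm]] : exists2 m, m <= 10 & y m \notin U /\ forall i, i < m -> y i \in U.
    case: (boolP (all (fun i => y i \in U) (iota 0 11))) => [/allP allU|].
      have hU i : i <= 10 -> y i \in U by move=> hi; apply: allU; rewrite mem_iota.
      have yI i j : i <= 11 -> j <= 11 -> y i = y j -> i = j.
        apply: (walk_inj pF rs ri) => l hl; last by apply: (back 10) => //; lia.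
        by rewrite rG ?(adjU 10) //; have [/RP[]] := UP _ (hU l hl).
      case: (red_path (x := y)) => [i j hi hj|i hi|i z /andP[i0 hi]]; first exact: yI.
        case: i hi => [|i] hi //; have [_ _] := UP _ (hU i hi); apply: contraNneq => <-.
        exact: (adjU 10).
      case: i i0 hi => // i _ hi; have hG : G (y i.+1) (y i) by rewrite adj_sym (adjU 10) //; apply: ltnW.
      have [h1 h2 h3] := nxtP _ _ (hU i.+1 hi) hG; rewrite /= y2.
      apply/idP/orP=> [hz|[/eqP->|/eqP->] //].
      by case: (eqVneq z (y i)) => [->|zi]; [left|right; apply/eqP/h3].
    rewrite -has_predC => hs; exists (find (predC (fun i => y i \in U)) (iota 0 11)).
      by move: hs; rewrite has_find size_iota.
    have := hs; rewrite has_find size_iota => hs'; split.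
      by have := nth_find 0 hs; rewrite nth_iota.
    move=> i hi; have := before_find 0 hi; rewrite nth_iota ?(ltn_trans hi) //=.
    by move/negbFE.
  case: m m10 mU mm => [|m] m10 mU mm; first by rewrite uU in mU.
  have hU i : i <= m -> y i \in U by apply: mm.
  have dD : (y m.+1, y m) \in D.
    have [yR _ _] := UP _ (hU m (leqnn _)); have [yX _ yF] := RP _ yR.
    apply/setIdP; split=> /=; last by rewrite inE yX rs rG // (adjU m).
    by move: mU; rewrite in_setD mX // andbT negbK.
  apply/imsetP; exists (Ordinal m10, (y m.+1, y m)); first by rewrite inE in_setT.
  (* The walk is retraced from the dart at its end: at a vertex of degree two the only way on is the
     way it came. *)
  have rev l : l <= m -> iter l st (y m.+1, y m) = (y (m - l).+1, y (m - l)).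
    elim: l => [|l IH] lm; first by rewrite subn0.
    rewrite iterS IH ?(ltnW lm) // /st /=.
    have E1 : m - l = (m - l.+1).+1 by rewrite subnSK.
    have hG : G (y (m - l)) (y (m - l).+1) by apply: (adjU m) => //; apply: leq_subr.
    have hG' : G (y (m - l)) (y (m - l.+1)).
      by rewrite E1 adj_sym (adjU m) // leq_subr.
    have [_ _ h3] := nxtP _ _ (hU _ (leq_subr _ _)) hG.
    rewrite -(h3 _ hG') ?E1 //; last by apply: (back m); rewrite // -E1 leq_subr.
  by rewrite /= rev // subnn.
have Us : #|U| <= 10 * #|D|.
  apply: leq_trans (subset_leq_card Ucov) _; apply: leq_trans (leq_imset_card _ _) _.
  by rewrite cardsX cardsT card_ord.
rewrite -(cardsID Sp X) (setIidPr SpX) -/U.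
have arith s d p u : s <= k.*2.+1 -> d <= 6 * s -> p <= 3 * s -> u <= 10 * d ->
  p + u <= 126 * k + 63 by clear; lia.
exact: arith S0s Ds Sps Us.
Qed.
End Bound.

(** * Polynomial-time functions on encoded data *)

Fixpoint rename (pi : nat -> nat) (e : expr) : expr :=
  match e with
  | EVar i => EVar i
  | ELeaf => ELeaf
  | ENode e1 e2 => ENode (rename pi e1) (rename pi e2)
  | ECase e0 e1 e2 => ECase (rename pi e0) (rename pi e1) (rename pi e2)
  | ELet e1 e2 => ELet (rename pi e1) (rename pi e2)
  | ECall f e1 => ECall (pi f) (rename pi e1)
  end.

Lemma eval_rename (P R : program) pi :
  (forall f, nth ELeaf R (pi f) = rename pi (nth ELeaf P f)) ->
  forall env e x t, eval P env e x t -> eval R env (rename pi e) x t.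
Proof.
move=> h env e x t; elim=> {env e x t} /=; try by intros; econstructor; eauto.
move=> env f e x y t1 t2 _ IH1 _ IH2; apply: eval_call IH1 _.
by rewrite h.
Qed.

(* Calling a function outside of a program yields [ELeaf]; such calls are
   redirected beyond the end of the linked program. *)
Lemma link (P1 P2 : program) : exists i j, forall main, exists R,
  [/\ nth ELeaf R 0 = main,
      forall x y t, runs P1 x y t -> forall env e te, eval R env e x te ->
        eval R env (ECall i e) y (te + t).+1
    & forall x y t, runs P2 x y t -> forall env e te, eval R env e x te ->
        eval R env (ECall j e) y (te + t).+1].
Proof.
pose N := (size P1 + size P2).+1.
pose p1 f := if f < size P1 then f.+1 else N.
pose p2 f := if f < size P2 then (size P1 + f).+1 else N.
exists (p1 0), (p2 0) => main.
pose R := main :: map (rename p1) P1 ++ map (rename p2) P2.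
have sR : size R = N by rewrite /= size_cat !size_map.
have h1 f : nth ELeaf R (p1 f) = rename p1 (nth ELeaf P1 f).
  rewrite /p1; case: ltnP => hf; last by rewrite !nth_default // sR.
  by rewrite /= nth_cat size_map hf (nth_map ELeaf).
have h2 f : nth ELeaf R (p2 f) = rename p2 (nth ELeaf P2 f).
  rewrite /p2; case: ltnP => hf; last by rewrite !nth_default // sR.
  by rewrite /= nth_cat size_map ltnNge leq_addr /= addKn (nth_map ELeaf).
exists R; split=> // x y t r env e te he; apply: eval_call he _.
  by rewrite h1; apply: eval_rename r.
by rewrite h2; apply: eval_rename r.
Qed.

(** The base is at least 2, so a single exponent also absorbs constants and sums. *)
Definition polyb (F : nat -> nat) := exists k, forall s, F s <= s.+2 ^ k.

Lemma polyb_leq F F' : (forall s, F s <= F' s) -> polyb F' -> polyb F.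
Proof. by move=> h [k hk]; exists k => s; apply: leq_trans (h s) (hk s). Qed.

Lemma polyb_const c : polyb (fun=> c).
Proof.
exists c => s; apply: leq_trans (_ : 2 ^ c <= _); first exact/ltnW/ltn_expl.
by case: c => // c; rewrite leq_exp2r.
Qed.

Lemma polyb_id : polyb id.
Proof. by exists 1 => s; rewrite expn1; lia. Qed.

Lemma polyb_add F F' : polyb F -> polyb F' -> polyb (fun s => F s + F' s).
Proof.
move=> [k hk] [l hl]; exists (k + l).+1 => s; rewrite expnS.
apply: leq_trans (leq_add (hk s) (hl s)) _.
apply: (@leq_trans (2 * s.+2 ^ (k + l))); last by rewrite leq_mul2r; apply/orP; right.
by rewrite mul2n -addnn leq_add // leq_pexp2l // ?leq_addr ?leq_addl.
Qed.

Lemma polyb_mul F F' : polyb F -> polyb F' -> polyb (fun s => F s * F' s).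
Proof.
by move=> [k hk] [l hl]; exists (k + l) => s; rewrite expnD; apply: leq_mul.
Qed.

Lemma polyb_exp F k : polyb F -> polyb (fun s => F s ^ k).
Proof.
move=> h; elim: k => [|k IH]; first by apply: (polyb_leq _ (polyb_const 1)) => s; rewrite expn0.
by apply: (polyb_leq _ (polyb_mul h IH)) => s; rewrite expnS.
Qed.

Lemma polyb_succ F : polyb F -> polyb (fun s => (F s).+1).
Proof. by move=> h; apply: (polyb_leq _ (polyb_add h (polyb_const 1))) => s; rewrite addn1. Qed.

Ltac polyb := repeat first
  [ apply: polyb_const | apply: polyb_id | apply: polyb_succ | apply: polyb_add
  | apply: polyb_mul | apply: polyb_exp ].

(** * Encodings and closure properties of polynomial-time functions *)

Class Enc (A : Type) := enc : A -> data.
#[export] Instance Enc_unit : Enc unit := fun=> Leaf.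
#[export] Instance Enc_bool : Enc bool := enc_bool.
#[export] Instance Enc_nat : Enc nat := enc_nat.
#[export] Instance Enc_seq A (eA : Enc A) : Enc (seq A) := fun s => enc_seq (map enc s).
#[export] Instance Enc_prod A B (eA : Enc A) (eB : Enc B) : Enc (A * B) :=
  fun p => Node (enc p.1) (enc p.2).

Definition dsz A (eA : Enc A) (a : A) := data_size (enc a).
Arguments dsz {A eA}.

Lemma dsz_pair A B (eA : Enc A) (eB : Enc B) (a : A) (b : B) : dsz (a, b) = (dsz a + dsz b).+1.
Proof. by []. Qed.

Lemma dsz_cons A (eA : Enc A) (a : A) s : dsz (a :: s) = (dsz a + dsz s).+1.
Proof. by []. Qed.

Lemma dsz_nil A (eA : Enc A) : dsz ([::] : seq A) = 1.
Proof. by []. Qed.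

Lemma dsz_bool (b : bool) : dsz b <= 3.
Proof. by case: b. Qed.

Lemma dsz_nat n : dsz n = n.*2.+1.
Proof. by elim: n => //= n; rewrite /dsz /= => ->; lia. Qed.

Lemma dsz_size A (eA : Enc A) (s : seq A) : size s < dsz s.
Proof. by elim: s => //= a s IH; rewrite dsz_cons; lia. Qed.

(* The output size is bounded as well, for composition. *)
Definition ptime A B (eA : Enc A) (eB : Enc B) (f : A -> B) := exists P k, forall a,
  exists2 t, runs P (enc a) (enc (f a)) t & t + dsz (f a) <= (dsz a).+2 ^ k.
Arguments ptime {A B eA eB}.

Lemma ptimeI A B (eA : Enc A) (eB : Enc B) (f : A -> B) P F : polyb F ->
  (forall a, exists2 t, runs P (enc a) (enc (f a)) t & t + dsz (f a) <= F (dsz a)) -> ptime f.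
Proof.
move=> [k hk] h; exists P, k => a; have [t r le] := h a; exists t => //.
exact: leq_trans le (hk _).
Qed.

Lemma ptime_ext A B (eA : Enc A) (eB : Enc B) (f g : A -> B) : f =1 g -> ptime f -> ptime g.
Proof. by move=> fg [P [k h]]; exists P, k => a; have [t] := h a; rewrite fg; exists t. Qed.

Lemma ptime_size A B (eA : Enc A) (eB : Enc B) (f : A -> B) : ptime f ->
  exists k, forall a, dsz (f a) <= (dsz a).+2 ^ k.
Proof. by move=> [P [k h]]; exists k => a; have [t _ le] := h a; apply: leq_trans le; apply: leq_addl. Qed.

(** For functions that only reread an encoding at another type. *)
Lemma ptime_same A B (eA : Enc A) (eB : Enc B) (f : A -> B) :
  (forall a, enc (f a) = enc a) -> ptime f.
Proof.
move=> h; apply: (@ptimeI _ _ _ _ _ [:: EVar 0] (fun s => s.+1)); first by polyb.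
by move=> a; exists 1; rewrite /dsz h //; apply: eval_var.
Qed.

Lemma pt_id A (eA : Enc A) : ptime (fun x : A => x).
Proof. exact: ptime_same. Qed.

Fixpoint quote (d : data) : expr := if d is Node x y then ENode (quote x) (quote y) else ELeaf.

Lemma eval_quote P env d : eval P env (quote d) d (data_size d).
Proof. by elim: d => [|x IHx y IHy] /=; constructor. Qed.

Lemma ev_var P env i x : nth Leaf env i = x -> eval P env (EVar i) x 1.
Proof. by move=> <-; apply: eval_var. Qed.

Ltac ev_case :=
  first [ eapply eval_case_node; [eapply ev_var; reflexivity|]
        | eapply eval_case_leaf; [eapply ev_var; reflexivity|] ].

Ltac ev := repeat first
  [ ev_case | eapply ev_var; reflexivity | apply eval_leaf | eapply eval_node ].

Section Prim.
Variables (A B C : Type) (eA : Enc A) (eB : Enc B) (eC : Enc C).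

Lemma pt_const (b : B) : ptime (fun _ : A => b).
Proof.
apply: (@ptimeI _ _ _ _ _ [:: quote (enc b)] (fun=> dsz b + dsz b)); first by polyb.
by move=> a; exists (dsz b) => //; apply: eval_quote.
Qed.

Lemma pt_comp (f : A -> B) (g : B -> C) : ptime f -> ptime g -> ptime (fun x => g (f x)).
Proof.
move=> [P1 [k1 h1]] [P2 [k2 h2]]; have [i [j hl]] := link P1 P2.
have [R [R0 r1 r2]] := hl (ECall j (ECall i (EVar 0))).
apply: (@ptimeI _ _ _ _ _ R (fun s => 3 + s.+2 ^ k1 + (s.+2 ^ k1).+2 ^ k2)); first by polyb.
move=> a; have [t1 e1 l1] := h1 a; have [t2 e2 l2] := h2 (f a).
exists ((1 + t1).+1 + t2).+1.
  rewrite /runs R0; apply: (r2 _ _ _ e2); apply: (r1 _ _ _ e1); exact: eval_var.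
have : (dsz (f a)).+2 ^ k2 <= ((dsz a).+2 ^ k1).+2 ^ k2.
  by case: (k2) => // m; rewrite leq_exp2r // !ltnS (leq_trans _ l1) // leq_addl.
by move: l1 l2; lia.
Qed.

Lemma pt_pair (f : A -> B) (g : A -> C) : ptime f -> ptime g -> ptime (fun x => (f x, g x)).
Proof.
move=> [P1 [k1 h1]] [P2 [k2 h2]]; have [i [j hl]] := link P1 P2.
have [R [R0 r1 r2]] := hl (ENode (ECall i (EVar 0)) (ECall j (EVar 0))).
apply: (@ptimeI _ _ _ _ _ R (fun s => 9 + s.+2 ^ k1 + s.+2 ^ k2)); first by polyb.
move=> a; have [t1 e1 l1] := h1 a; have [t2 e2 l2] := h2 a.
exists ((1 + t1).+1 + (1 + t2).+1).+1; last by rewrite dsz_pair; lia.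
rewrite /runs R0; apply: eval_node; [apply: (r1 _ _ _ e1)|apply: (r2 _ _ _ e2)]; exact: eval_var.
Qed.

Lemma pt_fst : ptime (fun p : A * B => p.1).
Proof.
apply: (@ptimeI _ _ _ _ _ [:: ECase (EVar 0) ELeaf (EVar 0)] (fun s => 3 + s)); first by polyb.
by move=> [a b]; eexists; [rewrite /runs /=; ev|rewrite dsz_pair /=; lia].
Qed.

Lemma pt_snd : ptime (fun p : A * B => p.2).
Proof.
apply: (@ptimeI _ _ _ _ _ [:: ECase (EVar 0) ELeaf (EVar 1)] (fun s => 3 + s)); first by polyb.
by move=> [a b]; eexists; [rewrite /runs /=; ev|rewrite dsz_pair /=; lia].
Qed.

Lemma pt_cons0 : ptime (fun p : A * seq A => p.1 :: p.2).
Proof. exact: ptime_same. Qed.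

Lemma pt_behead0 : ptime (fun s : seq A => behead s).
Proof.
apply: (@ptimeI _ _ _ _ _ [:: ECase (EVar 0) ELeaf (EVar 1)] (fun s => 3 + s)); first by polyb.
by case=> [|a s]; (eexists; [rewrite /runs /=; ev|rewrite /= ?dsz_cons ?dsz_nil; lia]).
Qed.

Lemma pt_head0 : ptime (fun p : A * seq A => head p.1 p.2).
Proof.
apply: (@ptimeI _ _ _ _ _ [:: ECase (EVar 0) ELeaf (ECase (EVar 1) (EVar 0) (EVar 0))] (fun s => 6 + s)); first by polyb.
by case=> a [|b s]; (eexists; [rewrite /runs /=; ev|rewrite dsz_pair ?dsz_cons /=; lia]).
Qed.

Lemma pt_if0 : ptime (fun p : bool * (A * A) => if p.1 then p.2.1 else p.2.2).
Proof.
apply: (@ptimeI _ _ _ _ _ [:: ECase (EVar 0) ELeaf (ECase (EVar 1) ELeaf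
  (ECase (EVar 2) (EVar 1) (EVar 2)))] (fun s => 9 + s)); first by polyb.
by case=> -[] [x y]; (eexists; [rewrite /runs /=; ev|rewrite !dsz_pair /=; lia]).
Qed.

(** The bound on the accumulator is essential: iterating a polynomial-time step could otherwise
    produce exponentially large data. With it each recursive call costs at most [W N]. *)
Lemma pt_foldr0 (step : C * (A * B) -> B) : ptime step ->
  (exists k, forall c b s,
     dsz (foldr (fun x y => step (c, (x, y))) b s) <= (dsz c + dsz b + dsz s).+2 ^ k) ->
  ptime (fun z : C * (seq A * B) => foldr (fun x y => step (z.1, (x, y))) z.2.2 z.2.1).
Proof.
move=> [P1 [k1 h1]] [k hk]; have [i [j hl]] := link P1 [::].
(* After the three case distinctions, variables 0 and 1 are head and tail, 3 is the initial value
   and 4 the context; [ECall 0] is the recursive call. *)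
have [R [R0 r1 _]] := hl (ECase (EVar 0) ELeaf (ECase (EVar 1) ELeaf (ECase (EVar 0) (EVar 1)
  (ECall i (ENode (EVar 4) (ENode (EVar 0)
     (ECall 0 (ENode (EVar 4) (ENode (EVar 1) (EVar 3)))))))))).
pose W N := 30 + (N + N + N.+2 ^ k).+4 ^ k1.
apply: (@ptimeI _ _ _ _ _ R (fun s => s * W s + s.+2 ^ k)); first by rewrite /W; polyb.
case=> c [s b]; set N := dsz (c, (s, b)).
have run s' : dsz c + dsz b + dsz s' <= N -> exists2 t,
    runs R (enc (c, (s', b))) (enc (foldr (fun x y => step (c, (x, y))) b s')) t &
    t <= (size s').+1 * W N.
  elim: s' => [|a s' IH] hN.
    by eexists; [rewrite /runs R0; ev|rewrite mul1n /W; lia].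
  rewrite dsz_cons in hN; have [t rt lt] := IH ltac:(lia).
  set acc := foldr _ b s' in rt *; have [t1 e1 l1] := h1 (c, (a, acc)).
  have lacc : dsz acc <= N.+2 ^ k.
    apply: leq_trans (hk c b s') _; case: (k) => // m; rewrite leq_exp2r //; lia.
  have lt1 : t1 <= (N + N + N.+2 ^ k).+4 ^ k1.
    apply: leq_trans (leq_trans (leq_addr _ _) l1) _; case: (k1) => // m.
    by rewrite leq_exp2r // !dsz_pair; lia.
  eexists.
    rewrite /runs R0; do 3 ev_case; apply: (r1 _ _ _ e1).
    eapply eval_node; first by ev.
    by eapply eval_node; [ev|eapply eval_call; [ev|exact: rt]].
  by rewrite [size _]/= mulSn {1}/W; move: lt lt1; clear; lia.
have hN : dsz c + dsz b + dsz s <= N by rewrite /N !dsz_pair; lia.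
have [t rt lt] := run s hN; exists t => //.
apply: leq_add.
  apply: leq_trans lt _; rewrite leq_mul2r; apply/orP; right.
  by rewrite (leq_trans (dsz_size _ s)) // (leq_trans _ hN) // leq_addl.
apply: leq_trans (hk c b s) _; case: (k) => // m; rewrite leq_exp2r //; lia.
Qed.
End Prim.

Section Derived.
Variables (X A B : Type) (eX : Enc X) (eA : Enc A) (eB : Enc B).

Lemma pt_foldr F (l : X -> seq A) (b : X -> B) (step : X -> A -> B -> B) :
  ptime l -> ptime b -> ptime (fun z : X * (A * B) => step z.1 z.2.1 z.2.2) -> polyb F ->
  (forall x b s, dsz (foldr (step x) b s) <= F (dsz x + dsz b + dsz s)) ->
  ptime (fun x => foldr (step x) (b x) (l x)).
Proof.
move=> pl pb ps [k hk] hF.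
apply: (pt_comp (pt_pair (pt_id _) (pt_pair pl pb)) (g := fun z => foldr (step z.1) z.2.2 z.2.1)).
apply: (pt_foldr0 ps); exists k => c y s.
exact: leq_trans (hF _ _ _) (hk _).
Qed.

Lemma pt_fst' (f : X -> A * B) : ptime f -> ptime (fun x => (f x).1).
Proof. by move=> h; apply: pt_comp h (pt_fst _ _). Qed.

Lemma pt_snd' (f : X -> A * B) : ptime f -> ptime (fun x => (f x).2).
Proof. by move=> h; apply: pt_comp h (pt_snd _ _). Qed.

Lemma pt_cons (f : X -> A) (g : X -> seq A) : ptime f -> ptime g -> ptime (fun x => f x :: g x).
Proof. by move=> pf pg; apply: pt_comp (pt_pair pf pg) (pt_cons0 _). Qed.

Lemma pt_head (f : X -> A) (g : X -> seq A) : ptime f -> ptime g ->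
  ptime (fun x => head (f x) (g x)).
Proof. by move=> pf pg; apply: pt_comp (pt_pair pf pg) (pt_head0 _). Qed.

Lemma pt_behead (g : X -> seq A) : ptime g -> ptime (fun x => behead (g x)).
Proof. by move=> pg; apply: pt_comp pg (pt_behead0 _). Qed.

Lemma pt_if (c : X -> bool) (f g : X -> A) : ptime c -> ptime f -> ptime g ->
  ptime (fun x => if c x then f x else g x).
Proof. by move=> pc pf pg; apply: pt_comp (pt_pair pc (pt_pair pf pg)) (pt_if0 _). Qed.

End Derived.

Lemma pt_foldrb (X A : Type) (eX : Enc X) (eA : Enc A) (l : X -> seq A) (b : X -> bool) (step : X -> A -> bool -> bool) :
  ptime l -> ptime b -> ptime (fun z : X * (A * bool) => step z.1 z.2.1 z.2.2) ->
  ptime (fun x => foldr (step x) (b x) (l x)).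
Proof.
move=> pl pb ps; apply: (pt_foldr pl pb ps (polyb_const 3)) => x y s.
exact: dsz_bool.
Qed.

Section Nat.
Variables (X : Type) (eX : Enc X).

Lemma pt_succ (f : X -> nat) : ptime f -> ptime (fun x => (f x).+1).
Proof.
move=> pf; apply: (pt_comp (pt_pair (pt_const _ _ tt) pf) (g := fun p : unit * nat => p.2.+1)).
exact: ptime_same.
Qed.

(** A unary numeral is literally a list of units, so list functions provide the arithmetic. *)
Lemma enc_size (s : seq unit) : enc (size s) = enc s.
Proof.
elim: s => // -[] s IH.
have -> : enc (size (tt :: s)) = Node Leaf (enc (size s)) by [].
by rewrite IH.
Qed.

Lemma pt_size (f : X -> seq unit) : ptime f -> ptime (fun x => size (f x)).
Proof. by move=> pf; apply: pt_comp pf _; apply: ptime_same => s; apply: enc_size. Qed.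

Lemma pt_nseq (f : X -> nat) : ptime f -> ptime (fun x => nseq (f x) tt).
Proof.
move=> pf; apply: pt_comp pf _; apply: ptime_same => n.
by rewrite -enc_size size_nseq.
Qed.

Lemma pt_pred (f : X -> nat) : ptime f -> ptime (fun x => (f x).-1).
Proof.
move=> /pt_nseq /pt_behead /pt_size; apply: ptime_ext => x.
by rewrite size_behead size_nseq.
Qed.

Lemma pt_isz (f : X -> nat) : ptime f -> ptime (fun x => f x == 0).
Proof.
move=> /pt_nseq pf.
have := @pt_foldrb _ _ _ _ _ _ (fun _ _ _ => false) pf (pt_const _ _ true) (pt_const _ _ false).
by apply: ptime_ext => x; case: (f x).
Qed.

End Nat.

Section Nat2.
Variables (X : Type) (eX : Enc X).

Lemma dsz_nat_mono m n : m <= n -> dsz m <= dsz n.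
Proof. by rewrite !dsz_nat; lia. Qed.

Lemma pt_subn (f g : X -> nat) : ptime f -> ptime g -> ptime (fun x => f x - g x).
Proof.
move=> pf /pt_nseq pg.
have E (s : seq unit) b : foldr (fun _ c => c.-1) b s = b - size s.
  by elim: s => [|_ s IH] /=; rewrite ?subn0 // IH subnS.
have ps : ptime (fun z : X * (unit * nat) => z.2.2.-1).
  exact: pt_pred (pt_snd' (pt_snd' (pt_id _))).
apply: ptime_ext (pt_foldr (step := fun _ _ c => c.-1) pg pf ps polyb_id _) => [x|x b s].
  by rewrite E size_nseq.
rewrite E; apply: leq_trans (dsz_nat_mono (leq_subr _ _)) _; lia.
Qed.

Lemma pt_andb (f g : X -> bool) : ptime f -> ptime g -> ptime (fun x => f x && g x).
Proof. by move=> pf pg; exact: (pt_if pf pg (pt_const _ _ false)). Qed.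

Lemma pt_orb (f g : X -> bool) : ptime f -> ptime g -> ptime (fun x => f x || g x).
Proof. by move=> pf pg; exact: (pt_if pf (pt_const _ _ true) pg). Qed.

Lemma pt_negb (f : X -> bool) : ptime f -> ptime (fun x => ~~ f x).
Proof. by move=> pf; exact: (pt_if pf (pt_const _ _ false) (pt_const _ _ true)). Qed.

Lemma pt_implb (f g : X -> bool) : ptime f -> ptime g -> ptime (fun x => f x ==> g x).
Proof. by move=> pf pg; exact: (pt_if pf pg (pt_const _ _ true)). Qed.

Lemma pt_eqb (f g : X -> bool) : ptime f -> ptime g -> ptime (fun x => f x == g x).
Proof.
move=> pf pg; apply: ptime_ext (pt_if pf pg (pt_negb pg)) => x.
by case: (f x); case: (g x).
Qed.

Lemma pt_eqn (f g : X -> nat) : ptime f -> ptime g -> ptime (fun x => f x == g x).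
Proof.
move=> pf pg; apply: ptime_ext (pt_andb (pt_isz (pt_subn pf pg)) (pt_isz (pt_subn pg pf))) => x.
by rewrite !subn_eq0 eqn_leq.
Qed.
End Nat2.

Section Lists.
Variables (X A B : Type) (eX : Enc X) (eA : Enc A) (eB : Enc B).

Lemma pt_all (l : X -> seq A) (p : X -> A -> bool) : ptime l ->
  ptime (fun z : X * A => p z.1 z.2) -> ptime (fun x => all (p x) (l x)).
Proof.
move=> pl pp; have ps : ptime (fun z : X * (A * bool) => p z.1 z.2.1 && z.2.2).
  apply: pt_andb; last exact: pt_snd' (pt_snd' (pt_id _)).
  exact: pt_comp (pt_pair (pt_fst' (pt_id _)) (pt_fst' (pt_snd' (pt_id _)))) pp.
apply: ptime_ext (pt_foldrb (step := fun x a b => p x a && b) pl (pt_const _ _ true) ps) => x.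
by elim: (l x) => //= a s ->.
Qed.

Lemma pt_has (l : X -> seq A) (p : X -> A -> bool) : ptime l ->
  ptime (fun z : X * A => p z.1 z.2) -> ptime (fun x => has (p x) (l x)).
Proof.
move=> pl pp; apply: ptime_ext (pt_negb (pt_all (p := fun x a => ~~ p x a) pl (pt_negb pp))) => x.
by rewrite -[RHS]negbK -all_predC.
Qed.

Lemma dsz_cat (s t : seq A) : dsz (s ++ t) <= dsz s + dsz t.
Proof. by elim: s => [|a s IH] /=; rewrite ?dsz_nil ?dsz_cons; lia. Qed.

Lemma pt_map (l : X -> seq A) (f : X -> A -> B) : ptime l ->
  ptime (fun z : X * A => f z.1 z.2) -> ptime (fun x => map (f x) (l x)).
Proof.
move=> pl pf; have [k hk] := ptime_size pf.
have ps : ptime (fun z : X * (A * seq B) => f z.1 z.2.1 :: z.2.2).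
  apply: pt_cons; last exact: pt_snd' (pt_snd' (pt_id _)).
  exact: pt_comp (pt_pair (pt_fst' (pt_id _)) (pt_fst' (pt_snd' (pt_id _)))) pf.
have pF : polyb (fun N => N + N * (N.+1.+2 ^ k).+1) by polyb.
apply: ptime_ext (pt_foldr (step := fun x a b => f x a :: b) pl (pt_const _ _ [::]) ps pF _) => [x|x b s].
  by elim: (l x) => //= a s ->.
set N := dsz x + _ + _; have sN : size s <= N by have := dsz_size eA s; rewrite /N; lia.
apply: (@leq_trans (dsz b + size s * (N.+1.+2 ^ k).+1)); last first.
  by rewrite leq_add //; [rewrite /N; lia|rewrite leq_mul2r sN orbT].
have: dsz x + dsz s <= N by rewrite /N; lia.
move: (N) => M; elim: s {N sN} => [|a s IH] /=; first by rewrite mul0n addn0.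
rewrite !dsz_cons mulSn => hM; have : dsz (f x a) <= M.+1.+2 ^ k.
  apply: leq_trans (hk (x, a)) _; case: (k) => // m; rewrite leq_exp2r // dsz_pair; lia.
by have := IH ltac:(lia); set E := (_ ^ _); clear; lia.
Qed.

Lemma pt_cat (f g : X -> seq A) : ptime f -> ptime g -> ptime (fun x => f x ++ g x).
Proof.
move=> pf pg; have ps : ptime (fun z : X * (A * seq A) => z.2.1 :: z.2.2).
  exact: pt_cons (pt_fst' (pt_snd' (pt_id _))) (pt_snd' (pt_snd' (pt_id _))).
apply: ptime_ext (pt_foldr (step := fun _ a b => a :: b) pf pg ps polyb_id _) => [x|x b s].
  by elim: (f x) => //= a s ->.
have -> : foldr cons b s = s ++ b by elim: s => //= a s ->.
by apply: leq_trans (dsz_cat _ _) _; lia.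
Qed.

Lemma pt_filter (l : X -> seq A) (p : X -> A -> bool) : ptime l ->
  ptime (fun z : X * A => p z.1 z.2) -> ptime (fun x => filter (p x) (l x)).
Proof.
move=> pl pp; have ps : ptime (fun z : X * (A * seq A) => if p z.1 z.2.1 then z.2.1 :: z.2.2 else z.2.2).
  apply: pt_if.
  - exact: pt_comp (pt_pair (pt_fst' (pt_id _)) (pt_fst' (pt_snd' (pt_id _)))) pp.
  - exact: pt_cons (pt_fst' (pt_snd' (pt_id _))) (pt_snd' (pt_snd' (pt_id _))).
  exact: pt_snd' (pt_snd' (pt_id _)).
apply: ptime_ext (pt_foldr (step := fun x a b => if p x a then a :: b else b) pl
  (pt_const _ _ [::]) ps polyb_id _) => [x|x b s].
  by elim: (l x) => //= a s ->.
elim: s => [|a s IH] /=; first by lia.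
by rewrite dsz_cons; case: ifP => _; rewrite ?dsz_cons; move: IH => /=; lia.
Qed.

Lemma pt_drop (f : X -> nat) (l : X -> seq A) : ptime f -> ptime l ->
  ptime (fun x => drop (f x) (l x)).
Proof.
move=> /pt_nseq pf pl; have ps : ptime (fun z : X * (unit * seq A) => behead z.2.2).
  exact: pt_behead (pt_snd' (pt_snd' (pt_id _))).
have E (s : seq unit) b : foldr (fun _ c => behead c) b s = drop (size s) b :> seq A.
  by elim: s => [|_ s IH] /=; rewrite ?drop0 // IH -drop1 drop_drop add1n.
apply: ptime_ext (pt_foldr (step := fun _ _ b => behead b) pf pl ps polyb_id _) => [x|x b s].
  by rewrite E size_nseq.
rewrite E; apply: (@leq_trans (dsz b)); last lia.
by elim: b (size s) => [|a b IH] [|m] //=; rewrite ?drop0 // dsz_cons; have := IH m; lia.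
Qed.

Lemma pt_nth (a0 : X -> A) (l : X -> seq A) (i : X -> nat) : ptime a0 -> ptime l -> ptime i ->
  ptime (fun x => nth (a0 x) (l x) (i x)).
Proof.
move=> pa pl pi; apply: ptime_ext (pt_head pa (pt_drop pi pl)) => x.
by rewrite -nth0 nth_drop addn0.
Qed.
End Lists.

Section Lists2.
Variables (X A : Type) (eX : Enc X) (eA : Enc A).

Lemma pt_flatten (f : X -> seq (seq A)) : ptime f -> ptime (fun x => flatten (f x)).
Proof.
move=> pf; have ps : ptime (fun z : X * (seq A * seq A) => z.2.1 ++ z.2.2).
  exact: pt_cat (pt_fst' (pt_snd' (pt_id _))) (pt_snd' (pt_snd' (pt_id _))).
apply: ptime_ext (pt_foldr (step := fun _ a b => a ++ b) pf (pt_const _ _ [::]) ps polyb_id _) => [x|x b s].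
  by elim: (f x) => //= a s ->.
elim: s => [|a s IH] /=; first by lia.
by apply: leq_trans (dsz_cat _ _ _) _; rewrite dsz_cons; move: IH; lia.
Qed.

Lemma pt_indices (l : X -> seq A) : ptime l -> ptime (fun x => iota 0 (size (l x))).
Proof.
move=> pl; have ps : ptime (fun z : X * (A * seq nat) => 0 :: map succn z.2.2).
  apply: pt_cons; first exact: pt_const.
  apply: (pt_map (f := fun _ n => n.+1)); first exact: pt_snd' (pt_snd' (pt_id _)).
  exact: pt_succ (pt_snd' (pt_id _)).
(* The size bound that [pt_foldr] asks for ranges over all initial values, hence the general [b]. *)
have E (s : seq A) b : foldr (fun _ c => 0 :: map succn c) b s = iota 0 (size s) ++ map (addn (size s)) b.
  elim: s => [|_ s IH] /=; first by rewrite map_id.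
  rewrite IH map_cat -map_comp; congr (_ :: (_ ++ _)).
  by rewrite -[1]addn0 iotaDl.
have pF : polyb (fun N => (N * (N + N + 2) + 1) + (N * (N + N + N + N + 2) + 1)) by polyb.
apply: ptime_ext (pt_foldr (step := fun _ _ c => 0 :: map succn c) pl (pt_const _ _ [::]) ps pF _) => [x|x b s].
  by rewrite E cats0.
rewrite E; apply: leq_trans (dsz_cat _ _ _) _; set N := (dsz x + _ + _).
have sN : size s <= N by have := dsz_size eA s; rewrite /N; lia.
have bN : size b <= N by have := dsz_size Enc_nat b; rewrite /N; lia.
have bound (t : seq nat) M : (forall n, n \in t -> n <= M) -> dsz t <= size t * (M + M + 2) + 1.
  elim: t => // a t IH hM; rewrite dsz_cons mulSn dsz_nat -addnn.
  have := hM a (mem_head _ _).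
  have := IH (fun n (h : n \in t) => hM n (@mem_behead _ (a :: t) n h)).
  by set K := _ * _; clear; lia.
apply: leq_add.
  apply: leq_trans (bound _ N _) _; last by rewrite size_iota leq_add2r leq_mul2r sN orbT.
  by move=> n; rewrite mem_iota => /andP[_ hn]; apply: leq_trans (ltnW hn) sN.
have -> : N + N + N + N + 2 = (N + N) + (N + N) + 2 by rewrite !addnA.
apply: leq_trans (bound _ (N + N) _) _; last by rewrite size_map leq_add2r leq_mul2r bN orbT.
move=> _ /mapP[n nb ->]; apply: leq_add => //.
have : dsz n <= dsz b.
  elim: (b) nb => // a t IH; rewrite inE dsz_cons => /predU1P[->|/IH h].
    exact: leqW (leq_addr _ _).
  exact: leq_trans h (leqW (leq_addl _ _)).
rewrite dsz_nat => h; apply: leq_trans (_ : dsz b <= N); last by rewrite /N; lia.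
by apply: leq_trans h; apply: leqW; rewrite -addnn leq_addr.
Qed.
End Lists2.

(** * The kernelization algorithm *)

Notation graph := (seq (seq bool)).
Implicit Types (g : graph) (x : graph * nat) (c : seq nat).

Definition adjm g i j := nth false (nth [::] g i) j.
Definition verts g := iota 0 (size g).
Definition mkm g (F : nat -> nat -> bool) : graph := [seq [seq F i j | j <- verts g] | i <- verts g].

(* Exhaustive search over [k]-tuples is polynomial since [k] is 2 or 12. *)
Fixpoint tuples k (s : seq nat) : seq (seq nat) :=
  if k is k'.+1 then flatten [seq [seq a :: t | t <- tuples k' s] | a <- s] else [:: [::]].

(** The empty list stands for failure, hence the second test of the condition in [try]. *)
Definition find_tuple (p : pred (seq nat)) (cs : seq (seq nat)) :=
  foldr (fun c d => if p c then c else d) [::] cs.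

Definition leaf_cond x c :=
  [&& nth 0 c 0 != x.2, nth 0 c 1 != x.2 &
      all (fun j => adjm x.1 (nth 0 c 0) j == (j == nth 0 c 1)) (verts x.1)].

Definition killm v u w g i j :=
  if (i == u) || (i == w) then j == v else if (j == u) || (j == w) then i == v else adjm g i j.

Definition leaf_upd x c := mkm x.1 (killm x.2 (nth 0 c 0) (nth 0 c 1) x.1).

Definition path_cond x c :=
  [&& all (fun i => all (fun j => (nth 0 c i == nth 0 c j) ==> (i == j)) (iota 0 12)) (iota 0 12),
      all (fun i => nth 0 c i != x.2) (iota 0 12) &
      all (fun i => all (fun j => adjm x.1 (nth 0 c i) j ==
         ((j == nth 0 c i.-1) || (j == nth 0 c i.+1))) (verts x.1)) (iota 1 10)].

Definition path_upd x c := mkm x.1 (fun i j =>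
  killm x.2 (nth 0 c 9) (nth 0 c 10) x.1 i j ||
  (((i == nth 0 c 8) && (j == nth 0 c 11)) || ((i == nth 0 c 11) && (j == nth 0 c 8)))).

Definition try k cond upd x : graph :=
  let c := find_tuple (cond x) (tuples k (verts x.1)) in
  if cond x c then upd x c else x.1.

Definition leaf_step := try 2 leaf_cond leaf_upd.
Definition path_step := try 12 path_cond path_upd.
Definition step x := path_step (leaf_step x, x.2).

(* The fold over the rows iterates [step] once per vertex. *)
Definition reduce x : graph := foldr (fun _ g => step (g, x.2)) x.1 x.1.

Definition isolated x :=
  has (fun u => (u != x.2) && all (fun j => ~~ adjm x.1 u j) (verts x.1)) (verts x.1).

Definition alivem x :=
  [seq i <- verts x.1 | (i == x.2) || has (fun j => (j != x.2) && adjm x.1 i j) (verts x.1)].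

Definition compress x : graph * (seq bool * seq bool) :=
  ([seq [seq adjm x.1 i j | j <- alivem x] | i <- alivem x],
   ([seq i == x.2 | i <- alivem x], [seq false | _ <- alivem x])).

(* An isolated vertex other than [v] is lost; so is the one-vertex position. *)
Definition output x : graph * (seq bool * seq bool) :=
  if isolated x then ([:: [:: false]], ([:: false], [:: false])) else compress x.

Definition kernel x := output (reduce x, x.2).

(** * Running time of the kernelization *)

Section PtimeAlg.
Variables (X : Type) (eX : Enc X).

Lemma pt_verts (g : X -> graph) : ptime g -> ptime (fun z => verts (g z)).
Proof. exact: pt_indices. Qed.

Lemma pt_adjm (g : X -> graph) (i j : X -> nat) : ptime g -> ptime i -> ptime j ->
  ptime (fun z => adjm (g z) (i z) (j z)).
Proof.
move=> pg pi pj; apply: (pt_nth (a0 := fun=> false)) => //; first exact: pt_const.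
by apply: (pt_nth (a0 := fun=> [::])) => //; apply: pt_const.
Qed.

End PtimeAlg.

Ltac pt1 := cbv beta; lazymatch goal with
  | |- ptime (fun z => z) => exact: pt_id
  | |- ptime fst => exact: pt_fst
  | |- ptime snd => exact: pt_snd
  | |- ptime (fun z => (@?f z).1) => apply: (pt_fst' (f := f))
  | |- ptime (fun z => (@?f z).2) => apply: (pt_snd' (f := f))
  | |- ptime (fun z => (@?f z, @?g z)) => apply: (pt_pair (f := f) (g := g))
  | |- ptime (fun z => @?f z && @?g z) => apply: (pt_andb (f := f) (g := g))
  | |- ptime (fun z => @?f z || @?g z) => apply: (pt_orb (f := f) (g := g))
  | |- ptime (fun z => ~~ @?f z) => apply: (pt_negb (f := f))
  | |- ptime (fun z => @?f z ==> @?g z) => apply: (pt_implb (f := f) (g := g))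
  | |- ptime (fun z => adjm (@?f z) (@?g z) (@?h z)) =>
      apply: (pt_adjm (g := f) (i := g) (j := h))
  | |- ptime (fun z => @?f z == @?g z) =>
      first [apply: (pt_eqn (f := f) (g := g)) | apply: (pt_eqb (f := f) (g := g))]
  | |- ptime (fun z => nth 0 (@?f z) (@?g z)) => apply: (pt_nth (a0 := fun=> 0) (l := f) (i := g))
  | |- ptime (fun z => (@?f z).+1) => apply: (pt_succ (f := f))
  | |- ptime (fun z => (@?f z).-1) => apply: (pt_pred (f := f))
  | |- ptime (fun z => verts (@?f z)) => apply: (pt_verts (g := f))
  | |- ptime (fun z => all (@?p z) (@?l z)) => apply: (pt_all (p := p) (l := l))
  | |- ptime (fun z => has (@?p z) (@?l z)) => apply: (pt_has (p := p) (l := l))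
  | |- ptime (fun z => map (@?p z) (@?l z)) => apply: (pt_map (f := p) (l := l))
  | |- ptime (fun z => filter (@?p z) (@?l z)) => apply: (pt_filter (p := p) (l := l))
  | |- ptime (fun z => alivem (@?f z)) => apply: (pt_comp (f := f) (g := alivem))
  | |- ptime (fun z => @?f z :: @?g z) => apply: (pt_cons (f := f) (g := g))
  | |- ptime (fun _ => ?b) => exact: pt_const
  | |- _ => apply: pt_if
  end.
Ltac pt := repeat first [assumption | pt1].

Section PtimeAlg2.
Variables (X : Type) (eX : Enc X).

Lemma pt_mkm (g : X -> graph) (F : X -> nat -> nat -> bool) : ptime g ->
  ptime (fun z : X * nat * nat => F z.1.1 z.1.2 z.2) -> ptime (fun z => mkm (g z) (F z)).
Proof.
move=> pg pF; apply: (pt_map (f := fun z i => [seq F z i j | j <- verts (g z)])).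
  exact: pt_verts.
apply: (pt_map (l := fun z : X * nat => verts (g z.1)) (f := fun z j => F z.1 z.2 j)) => //.
by apply: pt_verts; apply: pt_comp (pt_fst _ _) pg.
Qed.

Lemma pt_tuples k (s : X -> seq nat) : ptime s -> ptime (fun z => tuples k (s z)).
Proof.
move=> ps; elim: k => [|k IH] /=; first exact: pt_const.
apply: pt_flatten; apply: (pt_map (f := fun z a => [seq a :: t | t <- tuples k (s z)])) => //.
apply: (pt_map (l := fun z : X * nat => tuples k (s z.1)) (f := fun z t => z.2 :: t)).
  exact: pt_comp (pt_fst _ _) IH.
by pt.
Qed.

Lemma pt_find_tuple (p : X -> seq nat -> bool) (cs : X -> seq (seq nat)) :
  ptime (fun z : X * seq nat => p z.1 z.2) -> ptime cs ->
  ptime (fun z => find_tuple (p z) (cs z)).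
Proof.
move=> pp pc; apply: (pt_foldr (b := fun=> [::]) (step := fun z c d => if p z c then c else d)
  (F := id)) => //; first exact: pt_const.
- apply: pt_if; [|by pt|by pt].
  exact: pt_comp (pt_pair (pt_fst _ _) (pt_fst' (pt_snd _ _))) pp.
- exact: polyb_id.
move=> z b s; elim: s => [|a s IH] /=; first lia.
by case: ifP => _; rewrite dsz_cons; move: IH => /=; lia.
Qed.
End PtimeAlg2.

Lemma pt_try k cond upd : ptime (fun z : (graph * nat) * seq nat => cond z.1 z.2) ->
  ptime (fun z : (graph * nat) * seq nat => upd z.1 z.2) -> ptime (try k cond upd).
Proof.
move=> pc pu.
have pf : ptime (fun x => find_tuple (cond x) (tuples k (verts x.1))).
  by apply: pt_find_tuple => //; apply: pt_tuples; pt.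
apply: pt_if.
- exact: pt_comp (pt_pair (pt_id _) pf) pc.
- exact: pt_comp (pt_pair (pt_id _) pf) pu.
exact: pt_fst.
Qed.

Lemma pt_killm (X : Type) (eX : Enc X) (v u w i j : X -> nat) (g : X -> graph) :
  ptime v -> ptime u -> ptime w -> ptime i -> ptime j -> ptime g ->
  ptime (fun z => killm (v z) (u z) (w z) (g z) (i z) (j z)).
Proof. by move=> *; rewrite /killm; pt. Qed.

Lemma pt_leaf_step : ptime leaf_step.
Proof.
apply: pt_try; first by rewrite /leaf_cond; pt.
by apply: pt_mkm; [pt|apply: pt_killm; pt].
Qed.

Lemma pt_path_step : ptime path_step.
Proof.
apply: pt_try; first by rewrite /path_cond; pt.
by apply: pt_mkm; [pt|apply: pt_orb; [apply: pt_killm; pt|pt]].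
Qed.

Lemma pt_step : ptime step.
Proof.
exact: pt_comp (pt_pair pt_leaf_step (pt_snd _ _)) pt_path_step.
Qed.

Definition square m g := size g = m /\ all (fun r => size r == m) g.

Lemma mkm_square g F : square (size g) (mkm g F).
Proof.
split; first by rewrite size_map size_iota.
by apply/allP=> _ /mapP[i _ ->]; rewrite size_map size_iota.
Qed.

Lemma try_square k cond upd x : (forall c, exists F, upd x c = mkm x.1 F) ->
  try k cond upd x = x.1 \/ square (size x.1) (try k cond upd x).
Proof.
move=> h; rewrite /try; case: ifP => _; last by left.
by right; have [F ->] := h (find_tuple (cond x) (tuples k (verts x.1))); apply: mkm_square.
Qed.

(** This keeps the accumulator of [reduce] polynomial, for arbitrary input lists: a step leaves its
    input alone or outputs a square matrix with the same number of rows. *)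
Lemma step_square x : step x = x.1 \/ square (size x.1) (step x).
Proof.
have h1 : leaf_step x = x.1 \/ square (size x.1) (leaf_step x).
  by apply: try_square => c; eexists.
have h2 : path_step (leaf_step x, x.2) = leaf_step x \/
    square (size (leaf_step x)) (path_step (leaf_step x, x.2)).
  by apply: (@try_square _ _ _ (leaf_step x, x.2)) => c; eexists.
rewrite /step; case: h2 => [->|h2] //; right.
by case: h1 => [E|[E _]]; move: h2; rewrite E.
Qed.

Lemma dsz_square m g : square m g -> dsz g <= m * (m * 4).+2 + 1.
Proof.
move=> [<-]; move: {1 3}(size g) => m'; elim: g => [|r g IH] //= /andP[/eqP sr /IH h].
rewrite dsz_cons mulSn; have : dsz r <= (m' * 4).+1.
  by rewrite -sr; elim: (r) => //= b s IHs; rewrite dsz_cons mulSn; have := dsz_bool b; lia.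
by move: h; clear; lia.
Qed.

Lemma pt_reduce : ptime reduce.
Proof.
pose F N := N + (N * (N * 4).+2 + 1).
apply: (pt_foldr (l := fun x => x.1) (b := fun x => x.1)
  (step := fun x _ g => step (g, x.2)) (F := F)); try by pt.
- apply: (pt_comp (pt_pair (pt_snd' (pt_snd _ _)) (pt_snd' (pt_fst _ _))) pt_step).
- by rewrite /F; polyb.
move=> x b s.
have h : foldr (fun _ g => step (g, x.2)) b s = b \/
    square (size b) (foldr (fun _ g => step (g, x.2)) b s).
  elim: s => [|r s IH] /=; first by left.
  have := step_square (foldr (fun _ g => step (g, x.2)) b s, x.2); rewrite [_.1]/=.
  by case=> [->|] //; case: IH => [->|[-> _]]; right.
case: h => [->|/dsz_square h]; first by rewrite /F; lia.
apply: leq_trans h _; rewrite /F; set N := dsz x + dsz b + dsz s.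
have sN : size b <= N by have := dsz_size (Enc_seq Enc_bool) b; rewrite /N; lia.
by apply: leq_trans (leq_addl _ _); rewrite leq_add2r; apply: leq_mul => //; lia.
Qed.

Lemma pt_alivem : ptime alivem.
Proof. by rewrite /alivem; pt. Qed.

Lemma pt_output : ptime output.
Proof.
have pa := pt_alivem; apply: pt_if; [by rewrite /isolated; pt|exact: pt_const|].
have pa1 : ptime (fun z : graph * nat * nat => alivem z.1) by apply: pt_comp (pt_fst _ _) pa.
by apply: pt_pair; [|apply: pt_pair]; pt.
Qed.

Lemma pt_kernel : ptime kernel.
Proof. exact: pt_comp (pt_pair pt_reduce (pt_snd _ _)) pt_output. Qed.

(** * Correctness of the algorithm *)

Lemma mem_tuples k s c : (c \in tuples k s) = (size c == k) && all (mem s) c.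
Proof.
elim: k c => [|k IH] c /=; first by rewrite inE; case: c.
apply/flatten_mapP/idP => [[a /= sa /mapP[t]]|].
  by rewrite IH => /andP[/eqP <- st] -> /=; rewrite eqxx sa.
case: c => // a t /= /andP[]; rewrite eqSS => st /andP[sa tt].
by exists a => //; apply: map_f; rewrite IH st.
Qed.

Lemma find_tupleP (p : pred (seq nat)) cs :
  (find_tuple p cs \in cs) || (find_tuple p cs == [::]) /\
  forall c, c \in cs -> p c -> p (find_tuple p cs).
Proof.
elim: cs => [|a cs [IH1 IH2]] /=; first by split.
case: ifP => pa; first by rewrite inE eqxx.
split; first by rewrite inE -orbA IH1 orbT.
by move=> c; rewrite inE => /predU1P[->|/IH2//]; rewrite pa.
Qed.

Section Correct.
Variables (n : nat) (v : 'I_n).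
Implicit Types (G : sgraph n) (u w : 'I_n).

Definition mx G : graph := [seq [seq G i j | j <- enum 'I_n] | i <- enum 'I_n].

Lemma verts_mx G : verts (mx G) = map val (enum 'I_n).
Proof. by rewrite /verts size_map size_enum_ord val_enum_ord. Qed.

Lemma adjm_mx G (i j : 'I_n) : adjm (mx G) i j = G i j.
Proof.
have si (k : 'I_n) : k < size (enum 'I_n) by rewrite size_enum_ord.
by rewrite /adjm (nth_map i) // (nth_map j) // !nth_ord_enum.
Qed.

Lemma all_verts G (p : pred nat) : reflect (forall i : 'I_n, p i) (all p (verts (mx G))).
Proof.
rewrite verts_mx all_map; apply: (iffP allP) => [h i|h i _]; last exact: h.
by apply: h; rewrite mem_enum.
Qed.

Lemma mkm_mx G G' (F : nat -> nat -> bool) : (forall i j, G' i j = F i j) ->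
  mkm (mx G) F = mx G'.
Proof.
move=> h; rewrite /mkm verts_mx -map_comp; apply: eq_map => i /=.
by rewrite -map_comp; apply: eq_map => j /=; rewrite h.
Qed.

Definition leaf_free G :=
  forall u w, u != v -> w != v -> ~ (forall j, G u j = (j == w)).

Definition path_free G := forall x : nat -> 'I_n,
  (forall i j, i < 12 -> j < 12 -> x i = x j -> i = j) -> (forall i, i < 12 -> x i != v) ->
  ~ (forall i j, 0 < i < 11 -> G (x i) j = (j == x i.-1) || (j == x i.+1)).

Definition reduced G := leaf_free G /\ path_free G.

(* [G'] may replace [G] in the course of the reduction. *)
Definition refines G G' :=
  [/\ (forall k, dwin k (whyp v G)) <-> (forall k, dwin k (whyp v G')),
      forall k, fes k G -> fes k G' & alive v G' \subset alive v G].

Lemma refines_refl G : refines G G.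
Proof. by split. Qed.

Lemma refines_trans G1 G2 G3 : refines G1 G2 -> refines G2 G3 -> refines G1 G3.
Proof.
move=> [w1 f1 s1] [w2 f2 s2]; split; first by rewrite w1.
  by move=> k /f1/f2.
exact: subset_trans s2 s1.
Qed.

Lemma kill_sym (K : seq 'I_n) (r : rel 'I_n) : v \notin K -> symmetric r -> symmetric (kill v K r).
Proof.
move=> vK sr i j; rewrite /kill sr; case: ifP => iK; case: ifP => jK //.
have nv z : z \in K -> (z == v) = false by move=> zK; apply: contraNF vK => /eqP<-.
by rewrite !nv.
Qed.

Lemma kill_irr (K : seq 'I_n) (r : rel 'I_n) : v \notin K -> irreflexive r -> irreflexive (kill v K r).
Proof.
move=> vK ir i; rewrite /kill ir; case: (boolP (i \in K)) => // iK.
by apply: contraNF vK => /eqP<-.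
Qed.

Lemma aliveP G i : reflect (i = v \/ exists2 j, j != v & G i j) (i \in alive v G).
Proof.
rewrite inE; apply: (iffP predU1P) => -[->|h]; [by left| |by left|]; right.
  by case/existsP: h => j /andP[jv ij]; exists j.
by case: h => j jv ij; apply/existsP; exists j; rewrite jv.
Qed.

Lemma kill_alive G (K : seq 'I_n) i j : v \notin K -> i != v -> j != v ->
  kill v K G i j -> G i j.
Proof.
move=> vK iv jv; rewrite /kill; case: ifP => _; first by rewrite (negPf jv).
by case: ifP => _ //; rewrite (negPf iv).
Qed.

Lemma leaf_refines G u w : u != v -> w != v -> (forall j, G u j = (j == w)) ->
  exists G', [/\ G' =2 kill v [:: u; w] G, refines G G' & alive v G' \proper alive v G].
Proof.
move=> uv wv Gu; have vK : v \notin [:: u; w].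
  by rewrite !inE negb_or !(eq_sym v) uv wv.
pose G' := SGraph (kill_sym vK (adj_sym G)) (kill_irr vK (adj_irr G)).
have EG : G' =2 kill v [:: u; w] G by [].
have sub : alive v G' \subset alive v G.
  apply/subsetP=> i /aliveP[->|[j jv ij]]; apply/aliveP; first by left.
  case: (eqVneq i v) => [->|iv]; first by left.
  by right; exists j => //; apply: kill_alive ij.
exists G'; split=> //.
  by split=> //; [apply: leaf_rule EG | move=> k; apply: fes_kill EG].
apply/properP; split=> //; exists u; first by apply/aliveP; right; exists w; rewrite ?Gu.
apply/aliveP=> -[/eqP|[j jv]]; first by rewrite (negPf uv).
by rewrite EG /kill inE eqxx /= (negPf jv).
Qed.

Lemma path_refines G (x : nat -> 'I_n) :
  (forall i j, i < 12 -> j < 12 -> x i = x j -> i = j) -> (forall i, i < 12 -> x i != v) ->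
  (forall i j, 0 < i < 11 -> G (x i) j = (j == x i.-1) || (j == x i.+1)) ->
  exists G', [/\ G' =2 contract v x G, refines G G' & alive v G' \proper alive v G].
Proof.
move=> ix xv Gx; have vK : v \notin [:: x 9; x 10].
  by rewrite !inE negb_or; apply/andP; split; rewrite eq_sym xv.
have cs : symmetric (contract v x G).
  move=> i j; rewrite /contract (kill_sym vK (adj_sym G)) ![(i == _) && _]andbC.
  by congr (_ || _); rewrite orbC.
have ci : irreflexive (contract v x G).
  move=> i; rewrite /contract (kill_irr vK (adj_irr G)) /=.
  have n811 : x 8 != x 11 by apply/eqP=> /ix; lia.
  by case: (eqVneq i (x 8)) => [->|_] /=; rewrite ?andbF ?(negPf n811).
pose G' := SGraph cs ci; have EG : G' =2 contract v x G by [].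
have sub : alive v G' \subset alive v G.
  apply/subsetP=> i /aliveP[->|[j jv]]; first by apply/aliveP; left.
  rewrite EG /contract => /or3P[ij|/andP[/eqP-> _]|/andP[/eqP-> _]]; apply/aliveP.
  - case: (eqVneq i v) => [->|iv]; first by left.
    by right; exists j => //; apply: kill_alive ij.
  - by right; exists (x 7); rewrite ?xv // Gx // eqxx.
  - by right; exists (x 10); rewrite ?xv // adj_sym Gx // eqxx orbT.
exists G'; split=> //.
  by split=> //; [apply: path_rule EG | move=> k; apply: fes_contract EG].
apply/properP; split=> //; exists (x 9).
  by apply/aliveP; right; exists (x 8); rewrite ?xv // Gx // eqxx.
apply/aliveP=> -[/eqP|[j jv]]; first by rewrite (negPf (xv _ _)).
have x9 k : k < 12 -> k != 9 -> (x 9 == x k) = false by move=> hk k9; apply/eqP=> /ix; lia.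
by rewrite EG /contract /kill inE eqxx /= (negPf jv) !x9.
Qed.

(** This holds on failure too: the default 0 is a vertex because [v] exists. *)
Lemma find_bound k p G i : nth 0 (find_tuple p (tuples k (verts (mx G)))) i < n.
Proof.
have n0 : 0 < n by apply: leq_ltn_trans (ltn_ord v).
have [h _] := find_tupleP p (tuples k (verts (mx G))).
case/orP: h => [|/eqP->]; last by rewrite nth_nil.
rewrite mem_tuples => /andP[_ /allP hc].
case: (ltnP i (size (find_tuple p (tuples k (verts (mx G)))))) => hi; last by rewrite nth_default.
have := hc _ (mem_nth 0 hi); rewrite inE verts_mx => /mapP[j _ ->].
exact: ltn_ord.
Qed.

Lemma killm_mx G u w (i j : 'I_n) : killm v u w (mx G) i j = kill v [:: u; w] G i j.
Proof. by rewrite /killm /kill adjm_mx !inE. Qed.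

Lemma leaf_stepP G : exists G', [/\ leaf_step (mx G, nat_of_ord v) = mx G', refines G G' &
  G' = G /\ leaf_free G \/ ~ leaf_free G /\ alive v G' \proper alive v G].
Proof.
rewrite /leaf_step /try; set c := find_tuple _ _.
have [_ fc] := find_tupleP (leaf_cond (mx G, nat_of_ord v)) (tuples 2 (verts (mx G))).
have cn i : nth 0 c i < n by apply: find_bound.
case: ifP => hc; last first.
  exists G; split; [by []|exact: refines_refl|left; split=> // u w uv wv Gu].
  have /fc : [:: val u; val w] \in tuples 2 (verts (mx G)).
    rewrite mem_tuples eqxx; apply/allP=> z; rewrite !inE => /orP[] /eqP->;
    by rewrite verts_mx map_f // mem_enum.
  rewrite -/c hc => F; apply/notF/F.
  apply/and3P; split=> //; apply/all_verts => j.
  by rewrite [nth _ _ 0]/= [nth _ _ 1]/= adjm_mx Gu eqxx.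
have := hc; rewrite /leaf_cond [_.1]/= [_.2]/=.
pose u := Ordinal (cn 0); pose w := Ordinal (cn 1).
rewrite -[nth 0 c 0]/(val u) -[nth 0 c 1]/(val w) => /and3P[uv wv /all_verts Gu].
have {}Gu j : G u j = (j == w) by have := Gu j; rewrite adjm_mx => /eqP.
have [G' [EG r pr]] := leaf_refines uv wv Gu.
exists G'; split=> //; last by right; split=> // lf; apply: (lf u w).
by apply: mkm_mx => i j; rewrite EG -killm_mx.
Qed.

Lemma path_stepP G : exists G', [/\ path_step (mx G, nat_of_ord v) = mx G', refines G G' &
  G' = G /\ path_free G \/ ~ path_free G /\ alive v G' \proper alive v G].
Proof.
rewrite /path_step /try; set c := find_tuple _ _.
have [_ fc] := find_tupleP (path_cond (mx G, nat_of_ord v)) (tuples 12 (verts (mx G))).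
have cn i : nth 0 c i < n by apply: find_bound.
have condP d (x : nat -> 'I_n) : (forall i, i < 12 -> nth 0 d i = x i) ->
  path_cond (mx G, nat_of_ord v) d <->
  [/\ forall i j, i < 12 -> j < 12 -> x i = x j -> i = j, forall i, i < 12 -> x i != v &
   forall i j, 0 < i < 11 -> G (x i) j = (j == x i.-1) || (j == x i.+1)].
  move=> dx; rewrite /path_cond [_.1]/= [_.2]/=; split.
    move=> /and3P[/allP h1 /allP h2 /allP h3]; split.
    - move=> i j hi hj E; have /allP/(_ j) := h1 i ltac:(by rewrite mem_iota).
      by rewrite mem_iota hj => /(_ isT) /implyP; rewrite !dx // E eqxx => /(_ isT) /eqP.
    - by move=> i hi; have := h2 i ltac:(by rewrite mem_iota); rewrite dx.
    move=> i j hi; have /all_verts/(_ j) := h3 i ltac:(by rewrite mem_iota).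
    by rewrite !dx ?adjm_mx; try lia; move/eqP.
  move=> [h1 h2 h3]; apply/and3P; split; apply/allP=> i; rewrite mem_iota => hi.
  - apply/allP=> j; rewrite mem_iota => hj; rewrite !dx //.
    by apply/implyP=> /eqP/val_inj/h1 ->.
  - by rewrite dx // h2.
  by apply/all_verts => j; rewrite !dx ?adjm_mx ?h3 //; lia.
case: ifP => hc; last first.
  exists G; split; [by []|exact: refines_refl|left; split=> // x ix xv Gx].
  pose d := [seq val (x i) | i <- iota 0 12].
  have /fc : d \in tuples 12 (verts (mx G)).
    rewrite mem_tuples size_map size_iota eqxx; apply/allP=> _ /mapP[i _ ->].
    by rewrite inE verts_mx map_f // mem_enum.
  rewrite -/c hc => F; apply/notF/F.
  by apply/(condP d x) => // i hi; rewrite (nth_map 0) ?size_iota // nth_iota.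
pose x i := Ordinal (cn i); have cx i : i < 12 -> nth 0 c i = x i by [].
have [ix xv Gx] := (condP c x cx).1 hc.
have [G' [EG r pr]] := path_refines ix xv Gx.
exists G'; split=> //; last by right; split=> // pf; apply: (pf x).
apply: mkm_mx => i j; rewrite EG /contract [_.1]/= [_.2]/=.
by rewrite -[nth 0 c 9]/(val (x 9)) -[nth 0 c 10]/(val (x 10)) killm_mx.
Qed.

Lemma stepP G : exists G', [/\ step (mx G, nat_of_ord v) = mx G', refines G G' &
  G' = G /\ reduced G \/ ~ reduced G /\ alive v G' \proper alive v G].
Proof.
have [G1 [E1 r1 h1]] := leaf_stepP G; have [G2 [E2 r2 h2]] := path_stepP G1.
exists G2; split; first by rewrite /step E1.
  exact: refines_trans r1 r2.
have [_ _ s1] := r1; have [_ _ s2] := r2.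
case: h1 => [[EG h1]|[n1 p1]]; last first.
  by right; split; [case=> /n1|apply: sub_proper_trans s2 p1].
by subst G1; case: h2 => [[EG2 h2]|[n2 p2]]; [left|right; split=> // -[_ /n2]].
Qed.

(** A step on a graph that is not reduced makes the set of alive vertices smaller. With one step per
    row, [n] such losses would leave nothing, whereas [v] always stays alive. *)
Lemma reduceP G : exists G', [/\ reduce (mx G, nat_of_ord v) = mx G', refines G G' & reduced G'].
Proof.
rewrite /reduce [_.1]/= [_.2]/=.
have it (s : graph) : exists G', [/\ foldr (fun _ g => step (g, nat_of_ord v)) (mx G) s = mx G',
    refines G G' & reduced G' \/ #|alive v G'| + size s <= #|alive v G|].
  elim: s => [|r s [G1 [E1 r1 h1]]] /=.
    by exists G; split; [by []|exact: refines_refl|right; rewrite addn0].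
  have [G2 [E2 r2 h2]] := stepP G1; exists G2; split; first by rewrite E1.
    exact: refines_trans r1 r2.
  case: h2 => [[-> red]|[nred /proper_card lt]]; first by left.
  case: h1 => [/nred []|h1]; right; rewrite addnS.
  by apply: leq_trans h1; rewrite -addSn leq_add2r.
have [G' [E r h]] := it (mx G); exists G'; split=> //; case: h => // h; exfalso.
have : 0 < #|alive v G'| by apply/card_gt0P; exists v; rewrite inE eqxx.
have := max_card (mem (alive v G)); rewrite card_ord.
move: h; rewrite size_map size_enum_ord; set a := #|_|; set b := #|_|; clear; lia.
Qed.
End Correct.

(** * The output position *)

Lemma enc_mx n (G : sgraph n) : enc (mx G) = enc_graph G.
Proof.
rewrite /enc_graph -[LHS]/(enc_seq (map enc (mx G))); congr enc_seq.
rewrite -map_comp; apply: eq_map => i /=.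
by rewrite -[LHS]/(enc_seq (map enc _)) -map_comp.
Qed.

Lemma enc_bools n (X : {set 'I_n}) : enc [seq i \in X | i <- enum 'I_n] = enc_set X.
Proof. by rewrite /enc_set -[LHS]/(enc_seq (map enc _)) -map_comp. Qed.

Lemma map_enum_val (T : finType) (A : {set T}) :
  [seq enum_val i | i <- enum 'I_#|A|] = enum A.
Proof.
case E: (enum A) => [|x s].
  by apply: size0nil; rewrite size_map size_enum_ord cardE E.
rewrite -E; apply: (@eq_from_nth _ x); first by rewrite size_map size_enum_ord cardE.
move=> i; rewrite size_map size_enum_ord => hi.
by rewrite (nth_map (Ordinal hi)) ?size_enum_ord // (nth_ord_enum _ (Ordinal hi)) (enum_val_nth x).
Qed.

Section Output.
Variables (n : nat) (v : 'I_n) (G : sgraph n).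

Lemma isolated_mx : isolated (mx G, nat_of_ord v) =
  [exists u, (u != v) && [forall j, ~~ G u j]].
Proof.
rewrite /isolated [_.1]/= [_.2]/=.
apply/hasP/existsP => [[u']|[u /andP[uv /forallP h]]].
  rewrite {1}verts_mx => /mapP[u _ ->] /andP[uv /all_verts h].
  by exists u; rewrite uv; apply/forallP=> j; have := h j; rewrite adjm_mx.
exists (val u); first by rewrite verts_mx map_f // mem_enum.
by apply/andP; split=> //; apply/all_verts => j; rewrite adjm_mx h.
Qed.

Lemma alivem_mx : alivem (mx G, nat_of_ord v) = map val (enum (alive v G)).
Proof.
rewrite /alivem [_.1]/= [_.2]/=.
have F (p : pred nat) : filter p (verts (mx G)) = map val (filter (preim val p) (enum 'I_n)).
  by rewrite verts_mx filter_map.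
rewrite F enumT /enum_mem; congr map; apply: eq_filter => i.
rewrite [LHS]/= -[RHS]/(i \in alive v G) [RHS]inE.
congr (_ || _); apply/hasP/existsP => [[j']|[j /andP[jv ij]]].
  rewrite verts_mx => /mapP[j _ ->]; rewrite adjm_mx => ij.
  by exists j.
by exists (val j); rewrite ?verts_mx ?map_f ?mem_enum // adjm_mx jv.
Qed.
End Output.

Section Answer.
Variables (n : nat) (v : 'I_n) (G : sgraph n).

Lemma start_wins : dominator_wins G [set v] set0 <-> forall k, dwin k (whyp v G).
Proof. by apply: dominator_wins_dwin; rewrite disjoints_subset setC0 subsetT. Qed.

Definition induced m (f : 'I_m -> 'I_n) : sgraph m :=
  @SGraph m [rel i j | G (f i) (f j)] (fun i j => adj_sym G (f i) (f j))
    (fun i => adj_irr G (f i)).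

Lemma compressP : ~~ isolated (mx G, nat_of_ord v) ->
  exists (G' : sgraph #|alive v G|) v',
    enc (compress (mx G, nat_of_ord v)) = enc_position G' [set v'] set0 /\
    (dominator_wins G [set v] set0 <-> dominator_wins G' [set v'] set0).
Proof.
rewrite isolated_mx => /existsPn noiso.
have va : v \in alive v G by rewrite inE eqxx.
pose f := @enum_val _ (mem (alive v G)); pose v' := enum_rank_in va v.
have fv : f v' = v by rewrite /f enum_rankK_in.
have inf : injective f by apply: enum_val_inj.
have E : alivem (mx G, nat_of_ord v) = [seq val (f i) | i <- enum 'I_#|alive v G|].
  by rewrite alivem_mx -map_enum_val -map_comp.
exists (induced f), v'; split.
  have -> X Y : enc_position (induced f) X Y = enc (mx (induced f),
      ([seq i \in X | i <- enum 'I_#|alive v G|], [seq i \in Y | i <- enum 'I_#|alive v G|])).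
    by rewrite /enc_position -enc_mx -!enc_bools.
  rewrite /compress E [_.1]/= [_.2]/=; congr (enc (_, (_, _))).
  - rewrite -map_comp; apply: eq_map => i /=.
    by rewrite -map_comp; apply: eq_map => j /=; rewrite adjm_mx.
  - rewrite -map_comp; apply: eq_map => i /=.
    by rewrite inE -(inj_eq inf) fv.
  by rewrite -map_comp; apply: eq_map => i /=; rewrite inE.
rewrite start_wins dominator_wins_dwin; last by rewrite disjoints_subset setC0 subsetT.
apply: (@compress_rule _ _ _ _ _ _ f) => //.
  move=> z w zw wv; apply/codomP.
  have za : z \in alive v G by apply/aliveP; right; exists w.
  by exists (enum_rank_in va z); rewrite /f enum_rankK_in.
move=> z zv; have := noiso z; rewrite zv /= => /forallPn[w].
by rewrite negbK; exists w.
Qed.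
End Answer.

Lemma answer_exists n (G : sgraph n) (v : 'I_n) :
  exists (n' : nat) (G' : sgraph n') (D' S' : {set 'I_n'}),
    [/\ enc (kernel (mx G, nat_of_ord v)) = enc_position G' D' S',
        [disjoint D' & S'],
        n' <= 126 * fen G + 63
      & dominator_wins G [set v] set0 <-> dominator_wins G' D' S'].
Proof.
have [G1 [E [w1 f1 _] [lf pf]]] := reduceP v G.
have ds m (X : {set 'I_m}) : [disjoint X & set0] by rewrite disjoints_subset setC0 subsetT.
rewrite /kernel /output E [_.2]/=; case: ifP => [iso|/negbT/compressP[G2 [v' [E2 W]]]].
  pose e := (fun _ _ => false) : rel 'I_1.
  have es : symmetric e by []. have ei : irreflexive e by [].
  have ord1 : enum 'I_1 = [:: ord0] by apply: (inj_map val_inj); rewrite val_enum_ord.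
  exists 1, (SGraph es ei), set0, set0; split; first 1 last.
  - exact: ds.
  - by lia.
  - split=> W; exfalso.
      have /w1/(_ 1) := (start_wins v G).1 W.
      move: iso; rewrite isolated_mx => /existsP[u /andP[uv /forallP h]].
      by apply/(@isolated_lost _ v G1 u) => // j; apply/negbTE.
    have /(_ 1) := (dominator_wins_dwin (SGraph es ei) (ds _ _)).1 W.
    move=> h; apply: (dwin_not1 (z := ord0) h); exists ord0; first exact: ds.
    by apply/setP=> y; rewrite setD0 in_cnb !inE orbF.
  by rewrite /enc_position /enc_graph /enc_set ord1 /= !inE.
exists #|alive v G1|, G2, [set v'], set0; split; [exact: E2|exact: ds| |].
  by apply: kernel_bound => //; apply: f1; apply: fes_fen.
exact: iff_trans (iff_trans (iff_trans (start_wins v G) w1) (iff_sym (start_wins v G1))) W.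
Qed.

Theorem theorem6p1 :
  exists (P : program) (a b c d : nat),
  forall (n : nat) (G : sgraph n) (v : 'I_n),
  exists (n' : nat) (G' : sgraph n') (D' S' : {set 'I_n'}) (t : nat),
    [/\ runs P (enc_instance G v) (enc_position G' D' S') t,
        t <= c * data_size (enc_instance G v) ^ d + c,
        [disjoint D' & S'],
        n' <= a * fen G + b
      & dominator_wins G [set v] set0 <-> dominator_wins G' D' S'].
Proof.
have [P [k hP]] := pt_kernel.
exists P, 126, 63, (3 ^ k), k => n G v.
have [n' [G' [D' [S' [E dS bd W]]]]] := answer_exists G v.
have [t r le] := hP (mx G, nat_of_ord v).
have I : enc (mx G, nat_of_ord v) = enc_instance G v.
  by rewrite /enc_instance -enc_mx.
rewrite E I in r; exists n', G', D', S', t; split=> //.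
have s0 : 0 < data_size (enc_instance G v) by [].
move: s0 le; rewrite /dsz I; move: (data_size (enc_instance G v)) => s s0 le.
(* Since [s] is positive, [s.+2 <= 3 * s]; hence the factor [3 ^ k]. *)
apply: leq_trans (leq_addr _ _); rewrite -expnMn.
apply: leq_trans (leq_trans (leq_addr _ _) le) _.
by case: k {le hP} => // k; rewrite leq_exp2r //; lia.
Qed.
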